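(* Let $u\in C^0(B_1)$ be a viscosity solution of $\Delta_\infty u=\mathcal{G}(x,u,Du)$ in $B_1\subset\mathbb{R}^n$ with $\|u\|_{L^\infty(B_1)}\le 1$, where $\mathcal{G}$ satisfies the structure condition stated in the context, and let $x_0\in\mathrm{C}_{\mathcal{Z}}(u)$. Suppose that $\Xi^{\mathrm{H}}_n(B_1)\ne\emptyset$, that $\alpha^{\mathrm{H}}_n\in(0,1)$, and that all viscosity solutions of $\Delta_\infty\mathfrak{h}=0$ in $B_1\subset\mathbb{R}^n$ are of class $C^{1,\alpha^{\mathrm{H}}_n}_{\mathrm{loc}}$. Let $$\hat\alpha\in\left(0,\alpha^{\mathrm{H}}_n\right)\cap\left(0,\frac{1+m}{3-(m+\kappa)}\right].$$ Then there exists a constant $\mathrm{C}_0>0$ such that for all sufficiently small $r>0$ $$\sup_{B_r(x_0)}|u(x)|\le\mathrm{C}_0\,r^{1+\hat\alpha}.$$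
   Context: $B_r(x_0)\subset\mathbb{R}^n$ is the open ball, $B_r=B_r(0)$. $\Delta_\infty u=\langle D^2u\,Du,Du\rangle$. Structure condition: $\mathcal{G}:B_1\times\mathbb{R}\times\mathbb{R}^n\to\mathbb{R}$ and there is a constant $C_*>0$ with $$|\mathcal{G}(x,rt,s\xi)|\le C_*\,r^m s^\kappa|f(x)||t|^m\min\{1,|\xi|^\kappa\}\quad\text{for all } r,s\in(0,1],\ x\in B_1,\ t\in\mathbb{R},\ \xi\in\mathbb{R}^n,$$ where $f\in L^\infty(B_1)\cap C^0(B_1)$ and $(m,\kappa)\in[0,3)\times[0,4)$ satisfies $m<3-\kappa$. Viscosity solution: $u$ is a viscosity subsolution (resp. supersolution) of $\Delta_\infty u=\mathcal{G}(x,u,Du)$ if whenever $\varphi\in C^2$ and $u-\varphi$ has a local maximum (resp. minimum) at $y$, then $\Delta_\infty\varphi(y)\ge\mathcal{G}(y,u(y),D\varphi(y))$ (resp. $\le$); $u$ is a viscosity solution if it is both. $\mathrm{C}_{\mathcal{Z}}(u):=\{x\in B_1: u(x)=|Du(x)|=0\}$ (in particular $u$ is differentiable at such points). $\Xi^{\mathrm{H}}_n(B_1)$ is the set of $\mathfrak{h}\in C^0(B_1)\cap L^\infty(B_1)$ with $\Delta_\infty\mathfrak{h}=0$ in $B_1\subset\mathbb{R}^n$ (viscosity sense) and $\mathfrak{h}\in C^{1,\alpha}_{\mathrm{loc}}(B_1)$ for some $\alpha\in(0,1)$. $\alpha^{\mathrm{H}}_n:=\sup\{\alpha\in[0,1]:\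 \exists\,\mathrm{C}_{\alpha,n}>0 \text{ such that } \|\mathfrak{h}\|_{C^{1,\alpha}(B_{1/2})}\le\mathrm{C}_{\alpha,n}\|\mathfrak{h}\|_{L^\infty(B_1)}\text{ for all }\mathfrak{h}\in\Xi^{\mathrm{H}}_n(B_1)\}$. *)

(* Defs.v *)
From HB Require Import structures.
From mathcomp Require Import all_boot all_order all_algebra.
From mathcomp Require Import all_classical all_reals all_analysis.

Set Implicit Arguments.
Unset Strict Implicit.
Unset Printing Implicit Defensive.

Import Order.TTheory GRing.Theory Num.Theory.
Import numFieldNormedType.Exports.

Local Open Scope classical_set_scope.
Local Open Scope ring_scope.

(* The library norm on ['rV[R]_n] is the maximum norm.  It induces the right
   topology and the right notion of differentiability, but balls and Hoelder
   quotients below have to be Euclidean, hence [enorm] and [eball]. *)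

Definition dot {R : realType} {n : nat} (v w : 'rV[R]_n) : R :=
  \sum_i v 0 i * w 0 i.

Definition enorm {R : realType} {n : nat} (v : 'rV[R]_n) : R :=
  Num.sqrt (dot v v).

Definition eball {R : realType} {n : nat} (x : 'rV[R]_n) (r : R) :
    set 'rV[R]_n :=
  [set y | enorm (y - x) < r].

Definition partial {R : realType} {n : nat} (i : 'I_n) (u : 'rV[R]_n -> R)
    (x : 'rV[R]_n) : R :=
  'D_(delta_mx 0 i) u x.

Definition grad {R : realType} {n : nat} (u : 'rV[R]_n -> R) (x : 'rV[R]_n) :
    'rV[R]_n :=
  \row_i partial i u x.

Definition hessian {R : realType} {n : nat} (u : 'rV[R]_n -> R)
    (x : 'rV[R]_n) : 'M[R]_n :=
  \matrix_(i, j) partial i (partial j u) x.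

(* <D^2u Du, Du>; vectors are rows, so D^2u Du is the transpose of
   [hessian u x *m (grad u x)^T]. *)
Definition infty_laplacian {R : realType} {n : nat} (u : 'rV[R]_n -> R)
    (x : 'rV[R]_n) : R :=
  dot (hessian u x *m (grad u x)^T)^T (grad u x).

Definition C1_on {R : realType} {n : nat} (A : set 'rV[R]_n)
    (u : 'rV[R]_n -> R) : Prop :=
  (forall x, A x -> differentiable u x) /\ {within A, continuous (grad u)}.

Definition C2_on {R : realType} {n : nat} (A : set 'rV[R]_n)
    (u : 'rV[R]_n -> R) : Prop :=
  C1_on A u /\ forall i, C1_on A (partial i u).

(* Functions are total; only their values on the domain [A] matter.  For a
   continuous function on an open set this is the L^infty norm. *)
Definition sup_norm {R : realType} {n : nat} (A : set 'rV[R]_n)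
    (u : 'rV[R]_n -> R) : \bar R :=
  ereal_sup [set `|u x|%:E | x in A].

(* Pairs with x = y contribute the value 0, whatever [a] is. *)
Definition holder_seminorm {R : realType} {n : nat} (a : R)
    (A : set 'rV[R]_n) (g : 'rV[R]_n -> 'rV[R]_n) : \bar R :=
  ereal_sup [set (enorm (g x - g y) / (enorm (x - y) `^ a))%:E
            | x in A & y in A].

(* Meaningful for functions that are differentiable on [A]; it is only used for
   functions that are C^1 on a neighbourhood of [A]. *)
Definition C1a_norm {R : realType} {n : nat} (a : R) (A : set 'rV[R]_n)
    (u : 'rV[R]_n -> R) : \bar R :=
  (sup_norm A u + sup_norm A (fun x => enorm (grad u x))
   + holder_seminorm a A (grad u))%E.

Definition C1a_loc {R : realType} {n : nat} (a : R) (A : set 'rV[R]_n)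
    (u : 'rV[R]_n -> R) : Prop :=
  C1_on A u /\
  forall K : set 'rV[R]_n, compact K -> K `<=` A -> (C1a_norm a K u < +oo)%E.

(* Viscosity sub- and supersolutions of Delta_infty u = G(x, u, Du) in [A]. *)

Definition viscosity_subsolution {R : realType} {n : nat} (A : set 'rV[R]_n)
    (G : 'rV[R]_n -> R -> 'rV[R]_n -> R) (u : 'rV[R]_n -> R) : Prop :=
  forall (phi : 'rV[R]_n -> R) (y : 'rV[R]_n), C2_on A phi -> A y ->
    (\forall z \near y, u z - phi z <= u y - phi y) ->
    G y (u y) (grad phi y) <= infty_laplacian phi y.

Definition viscosity_supersolution {R : realType} {n : nat} (A : set 'rV[R]_n)
    (G : 'rV[R]_n -> R -> 'rV[R]_n -> R) (u : 'rV[R]_n -> R) : Prop :=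
  forall (phi : 'rV[R]_n -> R) (y : 'rV[R]_n), C2_on A phi -> A y ->
    (\forall z \near y, u y - phi y <= u z - phi z) ->
    infty_laplacian phi y <= G y (u y) (grad phi y).

Definition viscosity_solution {R : realType} {n : nat} (A : set 'rV[R]_n)
    (G : 'rV[R]_n -> R -> 'rV[R]_n -> R) (u : 'rV[R]_n -> R) : Prop :=
  viscosity_subsolution A G u /\ viscosity_supersolution A G u.

(* The power [`^] satisfies [0 `^ 0 = 1], so that the factors |t|^m and
   |xi|^kappa are 1 when the exponent vanishes. *)
Definition structure_condition {R : realType} {n : nat}
    (G : 'rV[R]_n -> R -> 'rV[R]_n -> R) (Cstar : R) (f : 'rV[R]_n -> R)
    (m kappa : R) : Prop :=
  forall (r s : R) (x : 'rV[R]_n) (t : R) (xi : 'rV[R]_n),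
    0 < r <= 1 -> 0 < s <= 1 -> eball 0 1 x ->
    `|G x (r * t) (s *: xi)|
    <= Cstar * r `^ m * s `^ kappa * `|f x| * `|t| `^ m
       * Num.min 1 (enorm xi `^ kappa).

Definition critical_zeros {R : realType} {n : nat} (u : 'rV[R]_n -> R) :
    set 'rV[R]_n :=
  [set x | [/\ eball 0 1 x, u x = 0, differentiable u x & grad u x = 0]].

Definition infty_harmonic {R : realType} {n : nat} (h : 'rV[R]_n -> R) :
    Prop :=
  {within eball 0 1, continuous h} /\
  viscosity_solution (eball 0 1) (fun _ _ _ => 0) h.

Definition XiH (R : realType) (n : nat) : set ('rV[R]_n -> R) :=
  [set h | [/\ infty_harmonic h, (sup_norm (eball 0 1) h < +oo)%E
             & exists2 a : R, 0 < a < 1 & C1a_loc a (eball 0 1) h]].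

Arguments XiH : clear implicits.

Definition alphaH (R : realType) (n : nat) : R :=
  sup [set a : R | 0 <= a <= 1 /\
         exists2 C : R, 0 < C &
           forall h, XiH R n h ->
             (C1a_norm a (eball 0 (1 / 2)) h
              <= C%:E * sup_norm (eball 0 1) h)%E].

Arguments alphaH : clear implicits.

(* Main.v *)
Require Import Defs.
From mathcomp Require Import all_boot all_order all_algebra.
From mathcomp Require Import all_classical all_reals all_analysis.
From mathcomp Require Import ring lra.

Import Order.TTheory GRing.Theory Num.Theory.
Import numFieldNormedType.Exports.

Local Open Scope classical_set_scope.
Local Open Scope ring_scope.

(* Rescaling [u] on the ball of radius [R = r0 rho^k] around [x0] by [S = r0 rho^(k (1 + ahat))]
   keeps the right-hand side below [Cstar (sup |f|) r0], because [ahat (3 - (m + kappa)) <= 1 + m].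
   So it suffices to improve the flatness once: if [|w| <= 1] solves the equation with a small
   right-hand side and [w(0) = 0], [Dw(0) = 0], then [|w| <= rho^(1 + ahat)] on the ball of radius
   [rho].  By compactness [w] is close to an infinity-harmonic [h], and the C^(1,a) estimate for [h]
   settles the case of a small [Dh(0)].

   Uniform convergence does not carry [Dw(0) = 0] over to [h], so a large [Dh(0)] has to be excluded:
   a solution [w] with small right-hand side that is close to a linear function of slope one is not
   critical at the center.  Otherwise the slope of [w] degenerates at some point and some tiny scale,
   and one can choose such a point [y] and scale [eps] so that near [y] all slopes at scales above
   [8 eps + 2 |z - y|^2] are bounded below.  Where slopes are bounded below, composing a
   sup-convolution of [w] with a convex quadratic function makes it infinity-subharmonic; with its
   mirror image as upper barrier, Perron's method gives an infinity-harmonic function at distance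
   O(eps + R^2) from [w] on the ball of radius [R] around [y].  The C^(1,a) estimates of these
   functions for [R = 8^-k], used at radius [16^-k], show by telescoping that the slope of [w] at [y]
   hardly changes down to scales comparable to [eps], and compactness bridges the remaining bounded
   factor: a contradiction. *)

(** Only a bound for the right-hand side is ever used: [sol eta] asks for |Delta_infty w| <= 2 eta
    on second-order jets, a class closed under rescaling, sign change and uniform limits. The
    operator degenerates where the gradient vanishes, so a small right-hand side is negligible only
    where the gradient is bounded below. The convex change w + k w^2 adds a term of order k |Dw|^4,
    which pays for eta when k is a large multiple of eta; the sup-convolution over balls of radius
    eps turns growth of w at scale eps into a lower bound for |Dw| at the maximum points.

    The quadratic growth of the bad scales makes the windows work: in units of the window radius R,
    slopes are controlled at scale eps / R + R, which shrinks with R as long as eps / R is small;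
    linear growth would leave it bounded below. With s = 2^-k the two radii are R = s^3 and R s, so
    on the inner ball the error R^2 and the C^(1,a) error are both at most a multiple of R s s^a,
    and slopes change by summable amounts s^a. The contribution of eps stays small only down to
    radii N eps, with N large and fixed. *)

(** * Euclidean norm, bilinear forms and Euclidean balls *)

Section Euclid.
Context {R : realType} {n : nat}.
Local Notation V := 'rV[R]_n.
Implicit Types (a b v w x y z : V) (r s t : R) (X : 'M[R]_n).

Lemma dotC v w : dot v w = dot w v.
Proof. by apply: eq_bigr => i _; rewrite mulrC. Qed.

Lemma dotDl a v w : dot (a + v) w = dot a w + dot v w.
Proof. by rewrite -big_split; apply: eq_bigr => i _; rewrite mxE mulrDl. Qed.

Lemma dotZl t v w : dot (t *: v) w = t * dot v w.
Proof. by rewrite mulr_sumr; apply: eq_bigr => i _; rewrite mxE mulrA. Qed.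

Lemma dotDr a v w : dot w (a + v) = dot w a + dot w v.
Proof. by rewrite dotC dotDl !(dotC w). Qed.

Lemma dotZr t v w : dot w (t *: v) = t * dot w v.
Proof. by rewrite dotC dotZl dotC. Qed.

Lemma dotNl v w : dot (- v) w = - dot v w.
Proof. by rewrite -scaleN1r dotZl mulN1r. Qed.

Lemma dotNr v w : dot w (- v) = - dot w v.
Proof. by rewrite dotC dotNl dotC. Qed.

Lemma dot0l v : dot 0 v = 0.
Proof. by rewrite -(scale0r 0) dotZl mul0r. Qed.

Lemma dot0r v : dot v 0 = 0.
Proof. by rewrite dotC dot0l. Qed.

Lemma dot_ge0 v : 0 <= dot v v.
Proof. by apply: sumr_ge0 => i _; rewrite -expr2 sqr_ge0. Qed.

Lemma dot_eq0 v : dot v v = 0 -> v = 0.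
Proof.
move/eqP; rewrite psumr_eq0; last by move=> i _; rewrite -expr2 sqr_ge0.
move=> /allP H; apply/rowP => i; rewrite mxE.
have := H i (mem_index_enum _); rewrite /= mulf_eq0 orbb => /eqP ->; by [].
Qed.

Lemma enorm_ge0 v : 0 <= enorm v.
Proof. exact: sqrtr_ge0. Qed.

Lemma enormE v : dot v v = enorm v ^+ 2.
Proof. by rewrite sqr_sqrtr ?dot_ge0. Qed.

Lemma enorm0 : enorm (0 : V) = 0.
Proof. by rewrite /enorm dot0l sqrtr0. Qed.

Lemma enorm_eq0 v : enorm v = 0 -> v = 0.
Proof. by move=> h; apply: dot_eq0; rewrite enormE h expr0n. Qed.

Lemma enorm_gt0 v : v != 0 -> 0 < enorm v.
Proof.
by move=> h; rewrite lt0r enorm_ge0 andbT; apply: contra h => /eqP/enorm_eq0 ->.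
Qed.

Lemma enormZ t v : enorm (t *: v) = `|t| * enorm v.
Proof.
by rewrite /enorm dotZl dotZr mulrA -expr2 sqrtrM ?sqr_ge0// sqrtr_sqr.
Qed.

Lemma enormN v : enorm (- v) = enorm v.
Proof. by rewrite -scaleN1r enormZ normrN1 mul1r. Qed.

Lemma enormB v w : enorm (v - w) = enorm (w - v).
Proof. by rewrite -enormN opprB. Qed.

Lemma cauchy_schwarz v w : dot v w <= enorm v * enorm w.
Proof.
have [->|w0] := eqVneq w 0; first by rewrite dot0r enorm0 mulr0.
have [->|v0] := eqVneq v 0; first by rewrite dot0l enorm0 mul0r.
have hv := enorm_gt0 _ v0; have hw := enorm_gt0 _ w0.
have := dot_ge0 (enorm w *: v - enorm v *: w).
rewrite dotDl !dotDr !dotNl !dotNr !dotZl !dotZr (dotC w v) !enormE => h.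
rewrite -(ler_pM2l (mulr_gt0 hv hw)).
by move: h; set d := dot v w; nra.
Qed.

Lemma cauchy_schwarz_abs v w : `|dot v w| <= enorm v * enorm w.
Proof.
rewrite ler_norml cauchy_schwarz andbT lerNl -dotNl -(enormN v).
exact: cauchy_schwarz.
Qed.

Lemma enormD v w : enorm (v + w) <= enorm v + enorm w.
Proof.
rewrite -(@ler_pXn2r _ 2)// ?nnegrE ?addr_ge0 ?enorm_ge0//.
rewrite -enormE dotDl !dotDr (dotC w v) !enormE sqrrD.
by have := cauchy_schwarz v w; lra.
Qed.

Lemma enorm_sub_ge v w : enorm v - enorm w <= enorm (v - w).
Proof. by have := enormD (v - w) w; rewrite subrK; lra. Qed.

Lemma enorm_tri x y z : enorm (x - z) <= enorm (x - y) + enorm (y - z).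
Proof. by rewrite -(subrKA y); exact: enormD. Qed.

Lemma coord_enorm v i : `|v 0 i| <= enorm v.
Proof.
rewrite -sqrtr_sqr ler_sqrt ?dot_ge0// /dot (bigD1 i)//= -expr2 lerDl.
by apply: sumr_ge0 => j _; rewrite -expr2 sqr_ge0.
Qed.

Lemma norm_le_enorm v : `|v| <= enorm v.
Proof.
rewrite [leLHS]/Num.norm /= mx_normrE; apply: bigmax_le; first exact: enorm_ge0.
by move=> [i j] _ /=; rewrite (ord1 i); exact: coord_enorm.
Qed.

Lemma coord_norm v i : `|v 0 i| <= `|v|.
Proof.
rewrite [leRHS]/Num.norm /= mx_normrE.
by apply/bigmax_geP; right; exists (0, i).
Qed.

Lemma enorm_le_norm v : enorm v <= n%:R * `|v|.
Proof.
rewrite -(@ler_pXn2r _ 2)// ?nnegrE ?enorm_ge0 ?mulr_ge0 ?ler0n//.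
rewrite -enormE exprMn.
have h : dot v v <= \sum_(i < n) `|v| ^+ 2.
  by apply: ler_sum => i _; rewrite -expr2 -real_normK ?num_real// ler_pXn2r// ?nnegrE// coord_norm.
apply: (le_trans h); rewrite sumr_const card_ord -[leLHS]mulr_natl.
apply: ler_wpM2r; first exact: sqr_ge0.
by rewrite -natrX ler_nat; case: (n) => // k; rewrite leq_pmulr.
Qed.

Definition bil X a b : R := dot (a *m X) b.

Lemma bilDl X a a' b : bil X (a + a') b = bil X a b + bil X a' b.
Proof. by rewrite /bil mulmxDl dotDl. Qed.
Lemma bilZl X t a b : bil X (t *: a) b = t * bil X a b.
Proof. by rewrite /bil -scalemxAl dotZl. Qed.
Lemma bilDr X a b b' : bil X a (b + b') = bil X a b + bil X a b'.
Proof. by rewrite /bil dotDr. Qed.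
Lemma bilZr X t a b : bil X a (t *: b) = t * bil X a b.
Proof. by rewrite /bil dotZr. Qed.
Lemma bilNl X a b : bil X (- a) b = - bil X a b.
Proof. by rewrite -scaleN1r bilZl mulN1r. Qed.
Lemma bilNr X a b : bil X a (- b) = - bil X a b.
Proof. by rewrite -scaleN1r bilZr mulN1r. Qed.
Lemma bil0l X b : bil X 0 b = 0.
Proof. by rewrite /bil mul0mx dot0l. Qed.
Lemma bil0r X b : bil X b 0 = 0.
Proof. by rewrite /bil dot0r. Qed.
Lemma bilDm X Y a b : bil (X + Y) a b = bil X a b + bil Y a b.
Proof. by rewrite /bil mulmxDr dotDl. Qed.
Lemma bilZm t X a b : bil (t *: X) a b = t * bil X a b.
Proof. by rewrite /bil -scalemxAr dotZl. Qed.
Lemma bilNm X a b : bil (- X) a b = - bil X a b.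
Proof. by rewrite -scaleN1r bilZm mulN1r. Qed.
Lemma bil_scalar t a b : bil t%:M a b = t * dot a b.
Proof. by rewrite /bil mul_mx_scalar dotZl. Qed.
Lemma bil_tr X a b : bil X^T a b = bil X b a.
Proof.
rewrite /bil /dot.
under eq_bigr do rewrite mxE mulr_suml.
rewrite exchange_big /=; apply: eq_bigr => i _; rewrite mxE mulr_suml.
by apply: eq_bigr => j _; rewrite mxE; ring.
Qed.
Lemma bil_rank1 p q a b : bil (p^T *m q) a b = dot a p * dot q b.
Proof.
rewrite /bil mulmxA.
suff -> : a *m p^T = (dot a p)%:M by rewrite mul_scalar_mx dotZl.
by rewrite [LHS]mx11_scalar; congr (_%:M); rewrite mxE; apply: eq_bigr => i _; rewrite mxE.
Qed.

Lemma bil_bound X : exists2 C, 0 < C &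
  forall a b, `|bil X a b| <= C * (enorm a * enorm b).
Proof.
pose C := \sum_i \sum_j `|X i j|.
have C0 : 0 <= C by apply: sumr_ge0 => i _; apply: sumr_ge0.
exists (C + 1); first lra.
move=> a b; have e0 := enorm_ge0 a; have f0 := enorm_ge0 b.
have -> : bil X a b = \sum_j \sum_i a 0 i * X i j * b 0 j.
  by rewrite /bil /dot; apply: eq_bigr => j _; rewrite mxE mulr_suml.
rewrite exchange_big /=.
apply: (@le_trans _ _ (C * (enorm a * enorm b))); last first.
  by rewrite ler_wpM2r ?mulr_ge0// lerDl.
apply: (le_trans (ler_norm_sum _ _ _)).
rewrite mulr_suml; apply: ler_sum => i _.
apply: (le_trans (ler_norm_sum _ _ _)).
rewrite mulr_suml; apply: ler_sum => j _.
rewrite !normrM [`|a 0 i| * _]mulrC -mulrA.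
by apply: ler_wpM2l => //; rewrite ler_pM// coord_enorm.
Qed.

(** Passage between the library topology, given by the maximum norm, and Euclidean balls. *)
Lemma nbhs_enorm x (P : set V) :
  nbhs x P <-> exists2 r, 0 < r & forall y, enorm (y - x) < r -> P y.
Proof.
split.
  move=> /nbhs_ballP[r r0 h]; exists r => // y hy; apply: h.
  rewrite mx_norm_ball /ball_/=.
  by apply: le_lt_trans (norm_le_enorm _) _; rewrite enormB.
move=> [r r0 h]; apply/nbhs_ballP; exists (r / n.+1%:R) => /=.
  by rewrite divr_gt0.
move=> y; rewrite mx_norm_ball /ball_ /= => hy; apply: h.
rewrite enormB; apply: le_lt_trans (enorm_le_norm _) _.
move: hy; rewrite ltr_pdivlMr// mulrC => hy.
apply: le_lt_trans hy; rewrite ler_wpM2r//.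
by rewrite ler_nat.
Qed.

Definition cball x r : set V := [set y | enorm (y - x) <= r].

Lemma enorm_continuous x : continuous (fun y : V => enorm (y - x)).
Proof.
move=> y; rewrite /continuous_at; apply/(@cvgrPdist_lt _ _ _ (nbhs y)) => e e0.
apply/nbhs_enorm; exists e => // z hz.
apply: le_lt_trans hz; rewrite ler_norml.
have := enorm_tri y z x; have := enorm_tri z y x.
by rewrite (enormB y z) => h1 h2; apply/andP; split; lra.
Qed.

Lemma cball_compact x r : compact (cball x r).
Proof.
apply: bounded_closed_compact.
  exists (`|x| + r); split; first exact: num_real.
  move=> M hM y hy /=; apply: le_trans (ltW hM).
  rewrite -(subrK x y) addrC; apply: le_trans (ler_normD _ _) _.
  by rewrite lerD2l (le_trans (norm_le_enorm _)).
have -> : cball x r = (fun y => enorm (y - x)) @^-1` [set t | t <= r] by [].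
by apply: closed_comp; [move=> y _; exact: enorm_continuous|exact: closed_le].
Qed.

Lemma eball_open x r : open (eball x r).
Proof.
rewrite openE => y hy; apply/nbhs_enorm; exists (r - enorm (y - x)).
  by move: hy; rewrite /eball/= subr_gt0.
move=> z hz; rewrite /eball/=; apply: le_lt_trans (enorm_tri _ y _) _; lra.
Qed.

End Euclid.

(** * Relative continuity in epsilon-delta form *)

Section EpsilonContinuity.
Context {R : realType} {n : nat}.
Local Notation V := 'rV[R]_n.
Implicit Types (x y z : V) (r : R) (w : V -> R) (A B : set V).

Definition econt (A : set V) (w : V -> R) : Prop :=
  forall y, A y -> forall e, 0 < e ->
    exists2 d, 0 < d & forall x, A x -> enorm (x - y) < d -> `|w x - w y| < e.

Lemma econtP A w : econt A w <-> {within A, continuous w}.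
Proof.
rewrite subspace_continuousP; split.
  move=> h y Ay; apply/cvgrPdist_lt => e e0.
  have [d d0 hd] := h y Ay e e0.
  apply/nbhs_enorm; exists d => // x hx Ax; rewrite distrC; exact: hd.
move=> h y Ay e e0; have /cvgrPdist_lt/(_ e e0)/nbhs_enorm[d d0 hd] := h y Ay.
by exists d => // x Ax hx; rewrite distrC; exact: hd.
Qed.

Lemma econt_sub A B w : B `<=` A -> econt A w -> econt B w.
Proof.
move=> BA h y By e e0; have [d d0 hd] := h y (BA _ By) e e0.
by exists d => // x Bx; apply: hd; exact: BA.
Qed.

Lemma econtN A w : econt A w -> econt A (fun x => - w x).
Proof.
move=> h y Ay e e0; have [d d0 hd] := h y Ay e e0; exists d => // x Ax hx.
by rewrite -opprD normrN; exact: hd.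
Qed.

Lemma econtD A w1 w2 : econt A w1 -> econt A w2 -> econt A (fun x => w1 x + w2 x).
Proof.
move=> h1 h2 y Ay e e0.
have [d1 d10 hd1] := h1 y Ay (e / 2) ltac:(lra).
have [d2 d20 hd2] := h2 y Ay (e / 2) ltac:(lra).
exists (Num.min d1 d2); first by rewrite lt_min d10.
move=> x Ax; rewrite lt_min => /andP[/(hd1 _ Ax) + /(hd2 _ Ax)].
by rewrite !ltr_norml => /andP[? ?] /andP[? ?]; apply/andP; split; lra.
Qed.

Lemma econt_cst A c : econt A (fun=> c).
Proof. by move=> y _ e e0; exists 1 => // x _ _; rewrite subrr normr0. Qed.

Lemma econt_max A w1 w2 : econt A w1 -> econt A w2 ->
  econt A (fun x => Num.max (w1 x) (w2 x)).
Proof.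
move=> h1 h2 y Ay e e0.
have [d1 d10 hd1] := h1 y Ay e e0; have [d2 d20 hd2] := h2 y Ay e e0.
exists (Num.min d1 d2); first by rewrite lt_min d10.
move=> x Ax; rewrite lt_min => /andP[/(hd1 _ Ax) + /(hd2 _ Ax)].
rewrite !ltr_norml => /andP[? ?] /andP[? ?].
rewrite /Num.max; case: (ltP (w1 x)) => ?; case: (ltP (w1 y)) => ?.
all: by apply/andP; split; lra.
Qed.

Lemma econt_lipschitz A w (L : R) : 0 <= L ->
  (forall x y, A x -> A y -> w x <= w y + L * enorm (x - y)) -> econt A w.
Proof.
move=> L0 h y Ay e e0; exists (e / (L + 1)); first by rewrite divr_gt0//; lra.
move=> x Ax; rewrite ltr_pdivlMr; last lra.
move=> hx; have h1 := h x y Ax Ay; have := h y x Ay Ax; rewrite enormB => h2.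
have := enorm_ge0 (x - y); move: hx h1 h2; set d := enorm _ => hx h1 h2 d0.
by rewrite ltr_norml; apply/andP; split; nra.
Qed.

Lemma cball_argmax y r w : 0 <= r -> econt (cball y r) w ->
  exists2 z, cball y r z & forall x, cball y r x -> w x <= w z.
Proof.
move=> r0 h; have [||c] := @EVT_max_rV R n w (cball y r) _ (cball_compact y r).
- by exists y; rewrite /cball/= subrr enorm0.
- by apply/econtP.
move=> hc hm; exists c; first by move: hc; rewrite inE.
by move=> x hx; apply: hm; rewrite inE.
Qed.

End EpsilonContinuity.

(** * Second-order jets, viscosity inequalities and comparison with cones *)

Section Jets.
Context {R : realType} {n : nat}.
Local Notation V := 'rV[R]_n.
Implicit Types (p q h k x y z : V) (r s t b c d eta : R) (w v phi : V -> R)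
  (A B : set V) (X : 'M[R]_n).

(* [X] plays the role of half the Hessian. *)
Definition upper_jet w y p X : Prop :=
  forall d, 0 < d -> exists2 r, 0 < r & forall h, enorm h < r ->
    w (y + h) <= w y + dot p h + bil X h h + d * dot h h.

(** Since [X] is half a Hessian, this is Delta_infty w >= - 2 eta in the viscosity sense. *)
Definition subsol eta A w : Prop :=
  forall y p X, A y -> upper_jet w y p X -> - eta <= bil X p p.

Definition sol eta A w : Prop := subsol eta A w /\ subsol eta A (fun x => - w x).

Lemma subsolS eta eta' A B w : B `<=` A -> eta <= eta' ->
  subsol eta A w -> subsol eta' B w.
Proof.
by move=> BA ee h y p X /BA Ay /(h _ _ _ Ay); apply: le_trans; rewrite lerN2.
Qed.

Lemma solS eta eta' A B w : B `<=` A -> eta <= eta' -> sol eta A w -> sol eta' B w.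
Proof. by move=> BA ee [h1 h2]; split; apply: subsolS BA ee _. Qed.

(** The two base points may differ: this carries a jet of a sup-convolution over to the point where
    its supremum is attained. *)
Lemma jet_touch w phi z y p X : upper_jet phi y p X ->
  (exists2 r, 0 < r & forall h, enorm h < r ->
     w (z + h) - w z <= phi (y + h) - phi y) -> upper_jet w z p X.
Proof.
move=> J [r r0 hr] d d0; have [s s0 hs] := J d d0.
exists (Num.min r s); first by rewrite lt_min r0.
by move=> h; rewrite lt_min => /andP[/hr + /hs]; lra.
Qed.

Lemma jet_quadratic (a : R) p X y k :
  upper_jet (fun x => a + dot p (x - y) + bil X (x - y) (x - y)) (y + k)
    (p + k *m (X + X^T)) X.
Proof.
move=> d d0; exists 1 => // h _.
have -> : y + k + h - y = k + h by rewrite addrAC [y + k]addrC addrK.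
have -> : y + k - y = k by rewrite addrC addKr.
rewrite !bilDl !bilDr !dotDr dotDl -/(bil (X + X^T) k h) bilDm bil_tr.
by have := dot_ge0 h; nra.
Qed.

(** After squaring both sides, the term [d * dot h h] leaves a surplus 2 r d |h|^2, with r = |z|,
    which absorbs the cubic cross term for small [h]. *)
Lemma enorm_second_order z : z != 0 -> forall d, 0 < d ->
  exists2 r, 0 < r & forall h, enorm h < r ->
    enorm (z + h) <= enorm z + dot z h / enorm z
      + (dot h h - (dot z h / enorm z) ^+ 2) / (2 * enorm z) + d * dot h h.
Proof.
move=> z0 d d0; have r0 := enorm_gt0 _ z0; set r := enorm z in r0 *.
have K0 : 0 < (2 * r)^-1 by rewrite invr_gt0; lra.
set K := (2 * r)^-1 in K0 *.
(* The first bound keeps the right-hand side nonnegative, so that squaring is allowed; the second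
   bounds the cubic term by r d |h|^2. *)
exists (Num.min (r / 2) (r * d / (K + d))).
  by rewrite lt_min !divr_gt0 ?mulr_gt0 ?addr_gt0.
move=> h; rewrite lt_min => /andP[h1 h2].
set a := dot z h / r; set m := enorm h.
have m0 : 0 <= m by exact: enorm_ge0.
have am : `|a| <= m.
  rewrite /a normrM (gtr0_norm (x := r^-1)) ?invr_gt0// ler_pdivrMr//.
  by rewrite mulrC; exact: cauchy_schwarz_abs.
rewrite (enormE h) -/m.
set e := (m ^+ 2 - a ^+ 2) / (2 * r) + d * m ^+ 2.
rewrite -addrA -/e.
have ar : a * r = dot z h by rewrite /a divfK// gt_eqF.
have eK : e = (m ^+ 2 - a ^+ 2) * K + d * m ^+ 2 by [].
have Kr : K * (2 * r) = 1 by rewrite /K mulVf// gt_eqF//; lra.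
have am2 : a ^+ 2 <= m ^+ 2.
  by rewrite -(real_normK (num_real a)) ler_pXn2r ?nnegrE.
have e0 : 0 <= e.
  by rewrite eK addr_ge0// mulr_ge0 ?sqr_ge0// ?subr_ge0// ltW.
have eM : e <= (K + d) * m ^+ 2 by rewrite eK mulrDl; have := sqr_ge0 a; nra.
have mKd : m * (K + d) <= r * d.
  by move: h2; rewrite ltr_pdivlMr ?addr_gt0// => /ltW.
move: am; rewrite ler_norml => /andP[a1 a2].
have b0 : 0 <= r + a + e by rewrite -/m in h1; lra.
rewrite -(@ler_pXn2r _ 2)// ?nnegrE ?enorm_ge0//.
rewrite -enormE !dotDl !dotDr (dotC h z) -ar !enormE -/r -/m.
have er : e * (2 * r) = m ^+ 2 - a ^+ 2 + 2 * r * d * m ^+ 2.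
  by rewrite eK mulrDl -mulrA Kr; ring.
have ae : - (r * d * m ^+ 2) <= a * e.
  apply: (@le_trans _ _ (- m * e)); last by rewrite ler_wpM2r//; lra.
  rewrite mulNr lerN2; apply: (@le_trans _ _ (m * ((K + d) * m ^+ 2))).
    by rewrite ler_wpM2l.
  by rewrite mulrA ler_wpM2r ?sqr_ge0.
have e2 := sqr_ge0 e.
have -> : (r + a + e) ^+ 2 = r ^+ 2 + a ^+ 2 + e * (2 * r) + 2 * (a * r) + 2 * (a * e) + e ^+ 2.
  by ring.
by rewrite er; lra.
Qed.

(* The radial profile [b t - c t^2] is strictly concave, so this cone is a strict supersolution. *)
Lemma jet_cone b c y z : 0 <= b -> z != y ->
  exists p X, upper_jet (fun x => b * enorm (x - y) - c * enorm (x - y) ^+ 2) z p X /\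
    bil X p p = - c * (b - 2 * c * enorm (z - y)) ^+ 2.
Proof.
move=> b0; rewrite -subr_eq0 => zy; have r0 := enorm_gt0 _ zy.
have [u uE] : exists u, u = z - y by eexists.
rewrite -uE in zy r0 *; set r := enorm u in r0 *.
pose g := (b - 2 * c * r) / r.
pose X := (b / (2 * r) - c)%:M - (b / (2 * r ^+ 3)) *: (u^T *m u).
exists (g *: u), X; split; last first.
  rewrite bilZl bilZr /X bilDm bilNm bilZm bil_scalar bil_rank1 !enormE -/r.
  by rewrite /g; field; rewrite gt_eqF.
move=> d d0.
have bd : 0 < d / (b + 1) by rewrite divr_gt0//; lra.
have [s s0 hs] := enorm_second_order u zy _ bd.
exists s => // h /hs {}hs.
have -> : z + h - y = u + h by rewrite addrAC -uE.
rewrite -uE -!enormE /X bilDm bilNm bilZm bil_scalar bil_rank1 !dotZl !dotDl !dotDr.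
rewrite !(dotC h u) !enormE -/r /g; rewrite enormE -/r in hs.
set a := dot u h in hs *; set m := enorm h in hs *.
have hb : b * enorm (u + h) <= b * (r + a / r + (m ^+ 2 - (a / r) ^+ 2) / (2 * r)
   + d / (b + 1) * m ^+ 2) by rewrite ler_wpM2l.
have hd : b * (d / (b + 1) * m ^+ 2) <= d * m ^+ 2.
  rewrite mulrA ler_wpM2r ?sqr_ge0// mulrA ler_pdivrMr; last lra.
  by nra.
rewrite -/r; apply: le_trans (_ : b * (r + a / r + (m ^+ 2 - (a / r) ^+ 2) / (2 * r))
   + d * m ^+ 2 - c * (r ^+ 2 + a + (a + m ^+ 2)) <= _).
  by move: hb; rewrite mulrDr; lra.
rewrite le_eqVlt; apply/orP; left; apply/eqP; field.
by rewrite gt_eqF.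
Qed.

(** If [w] minus the cone had a maximum inside the ball and off the vertex, the jet of the cone
    would be an upper jet of [w] with [bil X p p] = - c (b - 2 c t)^2, t being the distance to the
    vertex. As b - 2 c t decreases in t and is still positive at r, this is below - eta. *)
Lemma cone_comparison eta A w y r b c : 0 < r -> 0 < c -> 2 * c * r < b ->
  eta < c * (b - 2 * c * r) ^+ 2 ->
  eball y r `<=` A -> subsol eta A w -> econt (cball y r) w ->
  (forall x, enorm (x - y) = r -> w x <= w y + b * r - c * r ^+ 2) ->
  forall x, enorm (x - y) <= r ->
    w x <= w y + b * enorm (x - y) - c * enorm (x - y) ^+ 2.
Proof.
move=> r0 c0 cb ce yA hw cw hbd x hx.
pose phi := fun x => b * enorm (x - y) - c * enorm (x - y) ^+ 2.
have b0 : 0 <= b by nra.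
have cphi : econt (cball y r) phi.
  apply/econtP/continuous_subspaceT => z.
  have H := @enorm_continuous R n y z.
  have -> : phi = (fun x => b * enorm (x - y) - c * (enorm (x - y) * enorm (x - y))).
    by apply/funext => t; rewrite /phi expr2.
  exact: (cvgB (cvgM (cvg_cst b) H) (cvgM (cvg_cst c) (cvgM H H))).
have [z zr hz] := cball_argmax _ _ _ (ltW r0) (econtD _ _ _ cw (econtN _ _ cphi)).
(* A maximum above [w y] can be neither at the vertex nor, by the boundary condition, on the
   sphere. *)
suff : w z - phi z <= w y.
  by have := hz x hx; rewrite /phi/=; lra.
rewrite leNgt; apply/negP => H.
have zy : z != y.
  by apply/eqP => zy; move: H; rewrite zy /phi subrr enorm0; lra.
have zr' : enorm (z - y) < r.
  rewrite lt_neqAle zr andbT; apply/eqP => e.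
  by have := hbd z e; move: H; rewrite /phi e; lra.
have [p [X [J e]]] := jet_cone b c y z b0 zy.
have J' : upper_jet w z p X.
  apply: jet_touch J _; exists (r - enorm (z - y)); first by rewrite subr_gt0.
  move=> h hh; have /= := hz (z + h); rewrite -!/(phi _) => H'.
  have : cball y r (z + h).
    rewrite /cball/=; have := enormD (z - y) h; rewrite addrAC; lra.
  by move=> /H'; lra.
have := hw z p X (yA z zr') J'; rewrite e.
have := enorm_ge0 (z - y); set t := enorm _ in zr' *.
have : (b - 2 * c * r) ^+ 2 <= (b - 2 * c * t) ^+ 2.
  by rewrite ler_pXn2r// ?nnegrE; nra.
by move=> ? ?; nra.
Qed.

(** The cone has c = 1. The slope 2 M / r carries it from at least - M up to M on the sphere, 2 r
    pays for the concave term, and eta + 1 gives strictness because (eta + 1)^2 > eta. *)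
Lemma local_lipschitz eta A w y r M : 0 < r -> 0 <= eta ->
  eball y r `<=` A -> subsol eta A w -> econt (cball y r) w ->
  (forall x, cball y r x -> `|w x| <= M) ->
  forall x, cball y r x ->
    w x <= w y + (2 * M / r + 2 * r + eta + 1) * enorm (x - y).
Proof.
move=> r0 eta0 yA hw cw hM x hx.
have My : `|w y| <= M by apply: hM; rewrite /cball/= subrr enorm0 ltW.
have M0 : 0 <= M by exact: le_trans My.
have Mr : 0 <= M / r by rewrite divr_ge0// ltW.
have Mrr : M / r * r = M by rewrite divfK// gt_eqF.
set b := 2 * M / r + 2 * r + eta + 1.
have bE : b = 2 * (M / r) + 2 * r + eta + 1 by rewrite /b mulrA.
have := @cone_comparison eta A w y r b 1 r0 ltr01 _ _ yA hw cw _ x hx.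
have H1 : 2 * 1 * r < b by lra.
have H2 : eta < 1 * (b - 2 * 1 * r) ^+ 2.
  by rewrite mul1r bE expr2; nra.
move=> /(_ H1 H2) H; apply: le_trans (H _) _; last by have := sqr_ge0 (enorm (x - y)); lra.
move=> z hz; have : `|w z| <= M by apply: hM; rewrite /cball/= hz.
move: My; rewrite !ler_norml bE => /andP[? ?] /andP[? ?].
have : M <= M / r * r by rewrite Mrr.
nra.
Qed.

End Jets.

(** * Stability of subsolutions under approximation *)

Section Stability.
Context {R : realType} {n : nat}.
Local Notation V := 'rV[R]_n.
Implicit Types (p q h k x y z : V) (r s t b c d eta : R) (w phi : V -> R)
  (A B : set V) (X : 'M[R]_n).

Lemma le_limit (a b K : R) : (forall d, 0 < d <= 1 -> a <= b + K * d) -> a <= b.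
Proof.
move=> H; apply/ler_addgt0Pr => e e0.
pose d := Num.min 1 (e / (`|K| + 1)).
have K0 : 0 < `|K| + 1 by have := normr_ge0 K; lra.
have d0 : 0 < d by rewrite lt_min ltr01 divr_gt0.
have d1 : d <= 1 by rewrite ge_min lexx.
have dK : d * (`|K| + 1) <= e by rewrite -ler_pdivlMr// ge_min lexx orbT.
have := H d; rewrite d0 d1 => /(_ isT); have := ler_norm K.
by nra.
Qed.

Lemma mulmx_bound X : exists2 C, 0 < C & forall v, enorm (v *m X) <= C * enorm v.
Proof.
have [C C0 hC] := bil_bound X; exists C => // v.
have [->|/enorm_gt0 e0] := eqVneq (v *m X) 0.
  by rewrite enorm0 mulr_ge0 ?enorm_ge0// ltW.
rewrite -(ler_pM2r e0) -expr2 -enormE -mulrA.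
by apply: le_trans (hC v (v *m X)); exact: ler_norm.
Qed.

(** [p2] and [X2] are the jet, at offset [k] from the center, of the paraboloid with data [p] and
    [X + 2d]; the lemma controls what is lost when a contact point moves by [k]. *)
Lemma bil_perturb X p : exists2 K, 0 <= K & forall d k, 0 <= d <= 1 -> enorm k <= 1 ->
  let X2 := X + (2 * d)%:M in let p2 := p + k *m (X2 + X2^T) in
  `|bil X2 p2 p2 - bil X p p| <= K * (d + enorm k).
Proof.
have [C C0 hC] := bil_bound X.
have [D D0 hD] := mulmx_bound (X + X^T).
set P := enorm p; have P0 : 0 <= P by exact: enorm_ge0.
exists (C * (2 * P * (D + 4) + (D + 4) ^+ 2) + 2 * (P + D + 4) ^+ 2).
  by rewrite addr_ge0 ?mulr_ge0 ?sqr_ge0//; nra.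
move=> d k /andP[d0 d1] k1 /=.
pose X2 := X + (2 * d)%:M; rewrite -/X2; pose q := k *m (X2 + X2^T); pose p2 := p + q.
rewrite -/q -/p2.
have k0 : 0 <= enorm k := enorm_ge0 k.
have qE : q = k *m (X + X^T) + (4 * d) *: k.
  have tE : X2^T = X^T + (2 * d)%:M by rewrite /X2 linearD/= tr_scalar_mx.
  rewrite /q tE /X2 addrACA mulmxDr; congr (_ + _).
  by rewrite -raddfD/= mul_mx_scalar; congr (_ *: _); ring.
have hq : enorm q <= (D + 4) * enorm k.
  rewrite qE; apply: (le_trans (enormD _ _)); have := hD k.
  by rewrite enormZ ger0_norm; nra.
have q0 := enorm_ge0 q.
have hp2 : enorm p2 <= P + D + 4.
  by apply: (le_trans (enormD _ _)); rewrite -/P; nra.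
have -> : bil X2 p2 p2 - bil X p p =
   bil X p q + bil X q p + bil X q q + 2 * d * enorm p2 ^+ 2.
  rewrite /X2 bilDm bil_scalar enormE.
  have -> : bil X p2 p2 = bil X p p + bil X p q + bil X q p + bil X q q.
    by rewrite /p2 !bilDl !bilDr; ring.
  by ring.
have e2 := enorm_ge0 p2.
have h1 := hC p q; have h2 := hC q p; have h3 := hC q q.
have dq : 0 <= 2 * d * enorm p2 ^+ 2 by rewrite !mulr_ge0 ?sqr_ge0//.
apply: (le_trans (ler_normD _ _)); rewrite (ger0_norm dq).
apply: (le_trans (lerD (le_trans (ler_normD _ _) (lerD (ler_normD _ _) (lexx _))) (lexx _))).
rewrite -/P in h1 h2.
set Q := enorm q in hq h1 h2 h3 q0; set kk := enorm k in k0 k1 hq *.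
have g1 : C * (P * Q) <= C * (P * ((D + 4) * kk)) by rewrite !ler_wpM2l// ltW.
have g3 : C * (Q * Q) <= C * ((D + 4) ^+ 2 * kk).
  apply: ler_wpM2l; first exact: ltW.
  apply: (@le_trans _ _ (((D + 4) * kk) * ((D + 4) * kk))).
    by rewrite ler_pM.
  have : kk * kk <= kk by nra.
  have : 0 <= (D + 4) ^+ 2 by exact: sqr_ge0.
  by nra.
have g4 : d * enorm p2 ^+ 2 <= d * (P + D + 4) ^+ 2.
  by rewrite ler_wpM2l// ler_pXn2r// ?nnegrE; lra.
have s1 : 0 <= (P + D + 4) ^+ 2 := sqr_ge0 _.
have s2 : 0 <= (D + 4) ^+ 2 := sqr_ge0 _.
have s3 : 0 <= C * (2 * P * (D + 4)) by rewrite !mulr_ge0//; lra.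
have s4 : 0 <= C * (D + 4) ^+ 2 by rewrite !mulr_ge0//; lra.
rewrite (mulrC Q P) in h2.
have -> : (C * (2 * P * (D + 4) + (D + 4) ^+ 2) + 2 * (P + D + 4) ^+ 2) * (d + kk) =
  C * (2 * P * (D + 4)) * d + C * (D + 4) ^+ 2 * d + 2 * (C * (P * ((D + 4) * kk)))
  + C * ((D + 4) ^+ 2 * kk) + 2 * (d * (P + D + 4) ^+ 2) + 2 * (P + D + 4) ^+ 2 * kk by ring.
have t1 : 0 <= C * (2 * P * (D + 4)) * d by rewrite mulr_ge0.
have t2 : 0 <= C * (D + 4) ^+ 2 * d by rewrite mulr_ge0.
have t3 : 0 <= (P + D + 4) ^+ 2 * kk by rewrite mulr_ge0.
by lra.
Qed.

(** The approximation [v] lies below [w + s] and almost reaches [w] at one point only, and it may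
    depend on that point; this covers suprema of families as well as uniform limits. A paraboloid
    touching [w] strictly at [y] touches a translate of [v] at a nearby point. *)
Lemma subsol_stable eta A w :
  (forall y, A y -> exists2 r, 0 < r & forall s, 0 < s -> exists v,
     [/\ subsol (eta + s) (eball y r) v, econt (eball y r) v,
         forall x, eball y r x -> v x <= w x + s & w y <= v y + s]) ->
  subsol eta A w.
Proof.
move=> H y p X Ay J.
have [r r0 hr] := H y Ay; have [K K0 hK] := bil_perturb X p.
apply: (@le_limit _ _ (2 * K + 1)) => d /andP[d0 d1].
have [r1 r10 hr1] := J d d0.
pose m := Num.min r r1; have m0 : 0 < m by rewrite lt_min r0.
(* The offset [k] of the contact point satisfies d |k|^2 <= 2 s: the first bound keeps it off the
   sphere of radius m / 2, the second gives |k| <= d. *)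
pose s := Num.min (d * (m / 2) ^+ 2 / 4) (Num.min (d ^+ 3 / 2) d).
have s0 : 0 < s by rewrite !lt_min d0 !divr_gt0// ?exprn_gt0// mulr_gt0// exprn_gt0// divr_gt0.
have s1 : s <= d * (m / 2) ^+ 2 / 4 by rewrite ge_min lexx.
have s2 : s <= d ^+ 3 / 2 by rewrite !ge_min lexx orbT.
have s3 : s <= d by rewrite !ge_min lexx !orbT.
have [v [v1 v2 v3 v4]] := hr s s0.
(* The jet inequality uses up one [d]; the second one makes the contact strict. *)
pose X2 := X + (2 * d)%:M.
pose q x := 0 + dot p (x - y) + bil X2 (x - y) (x - y).
have mr : m <= r by rewrite ge_min lexx.
have mr1 : m <= r1 by rewrite ge_min lexx orbT.
have sub : cball y (m / 2) `<=` eball y r by move=> x; rewrite /cball/eball/=; lra.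
have cq : econt (cball y (m / 2)) q.
  have [C C0 hC] := bil_bound X2.
  apply: (@econt_lipschitz _ _ _ _ (enorm p + C * m)).
    by rewrite addr_ge0 ?enorm_ge0// mulr_ge0// ltW.
  move=> a b; rewrite /cball/= => ha hb.
  have -> : q a = q b + (dot p (a - b) + bil X2 (a - b) (a - y) + bil X2 (b - y) (a - b)).
    have -> : a - b = (a - y) - (b - y) by rewrite opprB addrA subrK.
    rewrite /q; move: (a - y) (b - y) => a' b'.
    by rewrite !bilDl !bilDr !dotDr !bilNl !bilNr !dotNr; ring.
  rewrite lerD2l.
  have := cauchy_schwarz p (a - b); have := le_trans (ler_norm _) (hC (a - b) (a - y)).
  have := le_trans (ler_norm _) (hC (b - y) (a - b)).
  have := enorm_ge0 (a - b); set e := enorm (a - b); move=> e0 g1 g2 g3.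
  have : C * (enorm (b - y) * e) <= C * (m / 2 * e) by rewrite ler_wpM2l ?ler_wpM2r// ltW.
  have : C * (e * enorm (a - y)) <= C * (e * (m / 2)) by rewrite ler_wpM2l ?ler_wpM2l// ltW.
  by lra.
have m20 : 0 <= m / 2 by rewrite divr_ge0// ltW.
have [z zm hz] := cball_argmax _ _ _ m20 (econtD _ _ _ (econt_sub _ _ _ sub v2) (econtN _ _ cq)).
pose k := z - y.
have zE : z = y + k by rewrite /k addrC subrK.
have km : enorm k <= m / 2 by [].
have zy := hz y; rewrite /cball/= subrr enorm0 in zy; have {}zy := zy m20.
have qy : q y = 0 by rewrite /q subrr dot0r bil0r !addr0.
have qz : q z = dot p k + bil X k k + 2 * d * dot k k.
  by rewrite /q -/k /X2 bilDm bil_scalar; ring.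
have wz : w z <= w y + dot p k + bil X k k + d * dot k k by rewrite zE; apply: hr1; lra.
have vz := v3 z (sub _ zm).
have dk : d * enorm k ^+ 2 <= 2 * s by move: zy wz; rewrite qy qz -enormE; lra.
have k0 := enorm_ge0 k.
have kd : enorm k <= d.
  rewrite -(@ler_pXn2r _ 2)// ?nnegrE ?(ltW d0)// -(ler_pM2l d0).
  by apply: (le_trans dk); move: s2; rewrite -exprS; lra.
have km' : enorm k < m / 2.
  rewrite lt_neqAle km andbT; apply/eqP => e; move: dk; rewrite e.
  have : 0 < d * (m / 2) ^+ 2 by rewrite mulr_gt0// exprn_gt0// divr_gt0.
  by lra.
have := v1 z (p + k *m (X2 + X2^T)) X2 (sub _ zm).
have JJ : upper_jet v z (p + k *m (X2 + X2^T)) X2.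
  rewrite zE; apply: jet_touch (jet_quadratic 0 p X2 y k) _.
  exists (m / 2 - enorm k); first by rewrite subr_gt0.
  move=> h hh; rewrite -!/(q _) -zE.
  have : cball y (m / 2) (z + h).
    rewrite /cball/= addrAC -/k; have := enormD k h; lra.
  by move=> /hz/=; lra.
move=> /(_ JJ); have := hK d k; rewrite (ltW d0) d1 => /(_ isT (le_trans kd d1)) /=.
rewrite -/X2 ler_norml => /andP[_ +].
have : K * enorm k <= K * d by rewrite ler_wpM2l.
by lra.
Qed.

End Stability.

(** * Perron's method between two barriers *)

Section Perron.
Context {R : realType} {n : nat}.
Local Notation V := 'rV[R]_n.
Implicit Types (p q h k x y z : V) (r s t b c d eta : R)
  (A B : set V) (X : 'M[R]_n).

(** Testing along small multiples of [g - p] and of [h] isolates the first and the second order. In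
    Perron's method this shows that the inserted paraboloid is itself a subsolution. *)
Lemma jet_exact (f : V -> R) y g (H : 'M[R]_n) p X :
  (forall h, f (y + h) = f y + dot g h + bil H h h) -> upper_jet f y p X ->
  p = g /\ forall h, bil H h h <= bil X h h.
Proof.
move=> fE J.
have pg : p = g.
  apply/eqP; rewrite -subr_eq0; apply/eqP.
  pose e := g - p; suff : e = 0 by move=> /eqP; rewrite subr_eq0 => /eqP ->; rewrite subrr.
  apply: dot_eq0; apply/eqP; rewrite eq_le dot_ge0 andbT.
  have [r r0 hr] := J 1 ltr01.
  pose M := bil X e e + dot e e - bil H e e.
  have e0 := enorm_ge0 e.
  have [c c0 ce] : exists2 c, 0 < c & c * enorm e < r.
    exists (r / (enorm e + 1)); first by rewrite divr_gt0//; lra.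
    rewrite mulrAC ltr_pdivrMr; last lra.
    by rewrite ltr_pM2l//; lra.
  apply: (@le_limit R _ _ (`|M| * c)) => d /andP[d0 d1].
  pose t := d * c.
  have t0 : 0 < t by rewrite mulr_gt0.
  have : enorm (t *: e) < r.
    rewrite enormZ gtr0_norm// /t -mulrA; apply: le_lt_trans ce.
    by rewrite ler_piMl// mulr_ge0// ltW.
  move=> /hr; rewrite fE !dotZr !bilZl !bilZr !dotZl => hh.
  have : t * dot e e <= t * (t * `|M|).
    have := ler_norm M; rewrite {1}/M => hM.
    have -> : dot e e = dot g e - dot p e by rewrite /e dotDl dotNl.
    have : t * (t * (bil X e e + dot e e - bil H e e)) <= t * (t * `|M|).
      by rewrite !ler_wpM2l// ltW.
    by lra.
  by rewrite ler_pM2l// /t; lra.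
split=> // v; apply: (@le_limit R _ _ (dot v v)) => d /andP[d0 d1].
have [r r0 hr] := J d d0.
have v0 := enorm_ge0 v.
pose t := r / (enorm v + 1).
have t0 : 0 < t by rewrite divr_gt0//; lra.
have : enorm (t *: v) < r.
  rewrite enormZ gtr0_norm// /t mulrAC ltr_pdivrMr; last lra.
  by rewrite ltr_pM2l//; lra.
move=> /hr; rewrite fE pg !dotZr !bilZl !bilZr !dotZl => hh.
have : t * (t * bil H v v) <= t * (t * (bil X v v + dot v v * d)) by lra.
by rewrite !ler_pM2l.
Qed.

(* Uniqueness is not needed, so that no comparison principle is required. *)
Theorem perron y0 r0 M (v1 v2 : V -> R) : let A := eball y0 r0 in
  subsol 0 A v1 -> subsol 0 A (fun x => - v2 x) -> econt A v1 -> econt A v2 ->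
  (forall x, A x -> v1 x <= v2 x) -> (forall x, A x -> `|v1 x| <= M /\ `|v2 x| <= M) ->
  exists h : V -> R, [/\ sol 0 A h, econt A h & forall x, A x -> v1 x <= h x <= v2 x].
Proof.
move=> A s1 s2 c1 c2 v12 vM.
(* Competitors are continuous. The local Lipschitz bound for bounded subsolutions is uniform over
   the family, so the supremum is continuous and no semicontinuous envelopes appear. *)
pose F (v : V -> R) := [/\ subsol 0 A v, econt A v & forall x, A x -> v1 x <= v x <= v2 x].
have F1 : F v1 by split=> // x Ax; rewrite lexx v12.
pose E x := [set v x | v in [set v | F v]].
pose h x := sup (E x).
have supE x : A x -> has_sup (E x).
  move=> Ax; split; first by exists (v1 x), v1.
  by exists (v2 x) => _ [v [_ _ hv] <-]; have /andP[] := hv x Ax.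
have hub v x : A x -> F v -> v x <= h x.
  by move=> Ax Fv; apply: sup_upper_bound; [exact: supE|exists v].
have h12 x : A x -> v1 x <= h x <= v2 x.
  move=> Ax; rewrite hub//=; apply: ge_sup; first by exists (v1 x), v1.
  by move=> _ [v [_ _ hv] <-]; have /andP[] := hv x Ax.
have Aball y : A y -> exists2 r, 0 < r & cball y (2 * r) `<=` A.
  rewrite /A/eball/= => hy; exists ((r0 - enorm (y - y0)) / 4); first lra.
  by move=> x; rewrite /cball/= => hx; have := enorm_tri x y y0; lra.
have hlip y : A y -> exists r L, [/\ 0 < r, 0 <= L, cball y (2 * r) `<=` A &
    forall x z, cball y r x -> cball x r z -> h z <= h x + L * enorm (z - x)].
  move=> Ay; have [r r00 hr] := Aball y Ay.
  have M0 : 0 <= M by have [+ _] := vM y Ay; exact: le_trans.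
  exists r, (2 * M / r + 2 * r + 0 + 1); split=> //.
    by rewrite !addr_ge0// ?divr_ge0 ?mulr_ge0// ltW.
  move=> x z xr zr.
  have xA : cball x r `<=` A.
    move=> a; rewrite /cball/= => ha; apply: hr; rewrite /cball/=.
    by move: xr; rewrite /cball/=; have := enorm_tri a x y; lra.
  have Ax : A x by apply: xA; rewrite /cball/= subrr enorm0 ltW.
  apply: ge_sup; first by exists (v1 z), v1 => //.
  move=> _ [v Fv <-]; have [Fv1 Fv2 Fv3] := Fv.
  apply: (@le_trans _ _ (v x + (2 * M / r + 2 * r + 0 + 1) * enorm (z - x))); last first.
    by rewrite lerD2r hub.
  apply: (local_lipschitz _ _ _ _ _ _ r00 (lexx 0) _ Fv1) => //.
  - by move=> a ha; apply: xA; exact: ltW.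
  - exact: econt_sub xA Fv2.
  - move=> a /xA Aa; have [] := vM a Aa; have /andP[] := Fv3 a Aa.
    by rewrite !ler_norml => ? ? /andP[? ?] /andP[? ?]; apply/andP; split; lra.
have ch : econt A h.
  move=> y Ay e e0; have [r [L [r00 L0 hr hL]]] := hlip y Ay.
  exists (Num.min r (e / (L + 1))); first by rewrite lt_min r00 divr_gt0//; lra.
  move=> x Ax; rewrite lt_min ltr_pdivlMr; last lra.
  move=> /andP[xr xe]; have g1 := hL y x; have g2 := hL x y.
  move: g1 g2; rewrite /cball/= subrr enorm0 (enormB y x) => g1 g2.
  have := g1 (ltW r00) (ltW xr); have := g2 (ltW xr) (ltW xr).
  have := enorm_ge0 (x - y); move: xe; set a := enorm _ => *.
  by rewrite ltr_norml; apply/andP; split; nra.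
have sh : subsol 0 A h.
  apply: subsol_stable => y Ay; have [r r00 hr] := Aball y Ay; exists r => // s s0.
  have [_ [v Fv <-] hv] := sup_adherent s0 (supE y Ay).
  have rA : eball y r `<=` A.
    by move=> a; rewrite /eball/= => ha; apply: hr; rewrite /cball/=; lra.
  have [Fv1 Fv2 Fv3] := Fv; exists v; split.
  - by apply: subsolS Fv1 => //; rewrite add0r ltW.
  - exact: econt_sub Fv2.
  - by move=> x /rA Ax; have := hub v x Ax Fv; lra.
  - by move: hv; rewrite -/(h y); lra.
exists h; split=> //; split=> //.
move=> y p X Ay J; rewrite oppr0 leNgt; apply/negP => pX0.
have [r1 r10 rA] := Aball y Ay.
(* Where [h] meets the upper barrier it inherits the supersolution property of [v2]; elsewhere there
   is room to push [h] up. *)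
have [hv2|hv2] : h y = v2 y \/ h y < v2 y.
  by have /andP[_] := h12 y Ay; rewrite le_eqVlt => /orP[/eqP|]; [left|right].
  have : upper_jet (fun x => - v2 x) y p X.
    apply: jet_touch J _; exists r1 => // k hk.
    have /h12/andP[_] : A (y + k).
      by apply: rA; rewrite /cball/= addrC addKr; lra.
    by rewrite -hv2; lra.
  by move=> /(s2 _ _ _ Ay); lra.
have [K K0 hK] := bil_perturb X p.
(* A paraboloid perturbed by [d] and moved by at most [d] loses at most 2 K d, so the sign of
   [bil X p p] survives. *)
have [d [d0 d1 dK]] : exists d, [/\ 0 < d, d <= 1 & d * (2 * (K + 1)) <= - bil X p p].
  exists (Num.min 1 (- bil X p p / (2 * (K + 1)))); split.
  - by rewrite lt_min ltr01 divr_gt0//; lra.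
  - by rewrite ge_min lexx.
  - by rewrite -ler_pdivlMr ?ge_min ?lexx ?orbT//; lra.
have [r2 r20 hr2] := J d d0.
have [C C0 hC] := bil_bound X.
have gap0 : 0 < (v2 y - h y) / 4 by lra.
set gap := (v2 y - h y) / 4 in gap0.
have [r3 r30 hr3] := c2 y Ay gap gap0.
have P0 := enorm_ge0 p.
pose rho := Num.min (Num.min r1 r2) (Num.min (Num.min r3 d) (gap / (enorm p + C))).
have rho0 : 0 < rho by rewrite !lt_min r10 r20 r30 d0 divr_gt0//; lra.
have rho1 : rho <= r1 by rewrite !ge_min lexx.
have rho2 : rho <= r2 by rewrite !ge_min lexx !orbT.
have rho3 : rho <= r3 by rewrite !ge_min lexx !orbT.
have rhod : rho <= d by rewrite !ge_min lexx !orbT.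
have rhog : rho * (enorm p + C) <= gap.
  by rewrite -ler_pdivlMr; [rewrite !ge_min lexx !orbT|lra].
(* The height of the bump: [gap] keeps the lifted paraboloid [q] below [v2], and d rho^2 / 4 keeps
   it below [h] on the ring between rho / 2 and rho, so that the glued function is continuous. *)
pose s := Num.min gap (d * rho ^+ 2 / 4).
have s0 : 0 < s by rewrite lt_min gap0 divr_gt0// mulr_gt0// exprn_gt0.
have sg : s <= gap by rewrite ge_min lexx.
have sd : s <= d * rho ^+ 2 / 4 by rewrite ge_min lexx orbT.
pose X2 := X + (2 * d)%:M.
pose q x := (h y + s) + dot (- p) (x - y) + bil (- X2) (x - y) (x - y).
have qE k : q (y + k) = h y + s - dot p k - bil X k k - 2 * d * enorm k ^+ 2.
  rewrite /q; have -> : y + k - y = k by rewrite addrC addKr.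
  by rewrite bilNm /X2 bilDm bil_scalar dotNl enormE; ring.
have qh k : enorm k < rho -> rho / 2 <= enorm k -> q (y + k) <= h (y + k).
  move=> k1 k2; rewrite qE; have := hr2 k (lt_le_trans k1 rho2).
  rewrite enormE.
  have : d * (rho / 2) ^+ 2 <= d * enorm k ^+ 2.
    by rewrite ler_pM2l// ler_pXn2r// ?nnegrE ?enorm_ge0 ?divr_ge0// ltW.
  have -> : d * (rho / 2) ^+ 2 = d * rho ^+ 2 / 4 by field.
  by lra.
have qv2 k : enorm k < rho -> q (y + k) <= v2 (y + k).
  move=> k1; rewrite qE.
  have Ak : A (y + k) by apply: rA; rewrite /cball/= addrC addKr; lra.
  have := hr3 (y + k) Ak; rewrite addrAC subrr add0r => /(_ (lt_le_trans k1 rho3)).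
  rewrite ltr_norml => /andP[g1 _].
  have := cauchy_schwarz_abs p k; rewrite ler_norml => /andP[g2 _].
  have := hC k k; rewrite ler_norml => /andP[g3 _].
  have k0 := enorm_ge0 k; set m := enorm k in g2 g3 k0 k1 *.
  have mg : m * (enorm p + C) <= gap.
    by apply: le_trans rhog; rewrite ler_wpM2r ?ltW//; lra.
  have g5 : m * m <= m by nra.
  have g6 : C * (m * m) <= C * m by rewrite ler_wpM2l// ltW.
  have g4 : 0 <= 2 * d * m ^+ 2 by rewrite !mulr_ge0 ?sqr_ge0// ltW.
  by rewrite /gap in sg mg g1 *; lra.
pose v x := if enorm (x - y) < rho then Num.max (h x) (q x) else h x.
have hv x : h x <= v x by rewrite /v; case: ifP => // _; rewrite le_max lexx.
have vh z : rho / 2 <= enorm (z - y) -> v z = h z.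
  rewrite /v; case: ifP => // e1 e2; apply: max_l.
  by have := qh (z - y) e1 e2; rewrite addrC subrK.
have cq : econt A q.
  move=> z Az e e0.
  have [D D0 hD] := bil_bound X2; have [D' D'0 hD'] := mulmx_bound (X2 + X2^T).
  pose L := enorm p + D' * enorm (z - y) + D.
  have L0 : 0 < L by rewrite !ltr_wpDl// ?enorm_ge0// addr_ge0// mulr_ge0 ?enorm_ge0// ltW.
  exists (Num.min 1 (e / L)); first by rewrite lt_min ltr01 divr_gt0.
  move=> x _; rewrite lt_min ltr_pdivlMr// => /andP[x1 xe].
  have -> : q x - q z = - (dot p (x - z) + dot ((z - y) *m (X2 + X2^T)) (x - z)
      + bil X2 (x - z) (x - z)).
    rewrite -/(bil (X2 + X2^T) (z - y) (x - z)) bilDm bil_tr.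
    have := subrKA z x (- y); rewrite /q => <-.
    move: (x - z) (z - y) => a b.
    by rewrite !dotNl !bilNm !bilDl !bilDr !dotDr; ring.
  rewrite normrN; apply: le_lt_trans xe.
  have e2 := enorm_ge0 (x - z).
  apply: (le_trans (ler_normD _ _)); rewrite /L !mulrDr.
  apply: lerD.
    apply: (le_trans (ler_normD _ _)); apply: lerD.
      by rewrite mulrC; exact: cauchy_schwarz_abs.
    apply: (le_trans (cauchy_schwarz_abs _ _)); rewrite mulrC.
    by rewrite ler_wpM2l.
  apply: (le_trans (hD _ _)); rewrite mulrC ler_pM2r//.
  by rewrite -[leRHS]mulr1 ler_wpM2l// ltW.
have cv : econt A v.
  move=> z Az e e0.
  have [zr|zr] := ltP (enorm (z - y)) rho.
    have [a a0 ha] := econt_max _ _ _ ch cq z Az e e0.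
    exists (Num.min a (rho - enorm (z - y))); first by rewrite lt_min a0 subr_gt0.
    move=> x Ax; rewrite lt_min => /andP[x1 x2].
    rewrite /v zr ifT; first exact: ha.
    by have := enorm_tri x z y; lra.
  have [a a0 ha] := ch z Az e e0.
  exists (Num.min a (rho / 2)); first by rewrite lt_min a0 divr_gt0.
  move=> x Ax; rewrite lt_min => /andP[x1 x2].
  rewrite !vh; [exact: ha|lra|].
  by have := enorm_tri z x y; rewrite (enormB z x); lra.
have qsub z pz Xz : enorm (z - y) < rho -> upper_jet q z pz Xz -> 0 <= bil Xz pz pz.
  move=> zr Jz; pose k := z - y.
  have [pE XE] : pz = - (p + k *m (X2 + X2^T)) /\ forall h, bil (- X2) h h <= bil Xz h h.
    apply: jet_exact Jz => a.
    rewrite /q; have -> : z + a - y = k + a by rewrite addrAC.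
    rewrite -/k !dotNl dotDl -/(bil (X2 + X2^T) k a) bilDm bil_tr.
    by rewrite !bilNm !bilDl !bilDr !dotDr; ring.
  apply: le_trans (XE pz); rewrite bilNm pE bilNl bilNr opprK.
  have kr : enorm k < rho by [].
  have k1 : enorm k <= 1 by lra.
  have := hK d k; rewrite (ltW d0) d1 => /(_ isT k1) /=; rewrite -/X2.
  rewrite ler_norml => /andP[_].
  have : K * (d + enorm k) <= K * (2 * d) by rewrite ler_wpM2l//; lra.
  by lra.
have Fv : F v.
  split => //.
  - move=> z pz Xz Az Jz; rewrite oppr0.
    have [zr|zr] := ltP (enorm (z - y)) rho; last first.
      have vz : v z = h z by apply: vh; lra.
      have /(sh _ _ _ Az) : upper_jet h z pz Xz; last by rewrite oppr0.
      by apply: jet_touch Jz _; exists 1 => // a _; rewrite vz lerD2r.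
    have vz : v z = h z \/ v z = q z.
      by rewrite /v zr /Num.max; case: ifP; [right|left].
    case: vz => vz.
      have /(sh _ _ _ Az) : upper_jet h z pz Xz; last by rewrite oppr0.
      by apply: jet_touch Jz _; exists 1 => // a _; rewrite vz lerD2r.
    apply: (qsub z) => //; apply: jet_touch Jz _.
    exists (rho - enorm (z - y)); first by rewrite subr_gt0.
    move=> a ha; rewrite vz lerD2r /v ifT ?le_max ?lexx ?orbT//.
    by have := enormD (z - y) a; rewrite addrAC; lra.
  - move=> x Ax; have /andP[g1 g2] := h12 x Ax.
    rewrite (le_trans g1 (hv x))/= /v; case: ifP => // e1.
    by rewrite ge_max g2/=; have := qv2 (x - y) e1; rewrite addrC subrK.
(* At [y] the competitor has value at least h y + s, which exceeds the supremum. *)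
have := hub v y Ay Fv; rewrite /v subrr enorm0 rho0 ge_max => /andP[_].
by have := qE 0; rewrite addr0 => ->; rewrite dot0r bil0l enorm0 expr0n/=; lra.
Qed.

End Perron.

(** * Compactness: small right-hand side implies closeness to an infinity-harmonic function *)

Section Compactness.
Context {R : realType} {n : nat}.
Local Notation V := 'rV[R]_n.
Implicit Types (x y z : V) (r s t d eta : R).

(** Balls of radius 1 / 16 give the slope 32 + 1/8 + eta + 1 <= 36; for points further apart the
    oscillation 2 is at most 36 / 16. *)
Lemma interior_lipschitz eta (w : V -> R) : 0 <= eta <= 1 ->
  subsol eta (eball 0 1) w -> econt (eball 0 1) w ->
  (forall x, eball 0 1 x -> `|w x| <= 1) ->
  forall x y, cball 0 (7 / 8) x -> cball 0 (7 / 8) y ->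
    w x <= w y + 36 * enorm (x - y).
Proof.
move=> /andP[eta0 eta1] hw cw w1 x y hx hy.
have sub : cball y (1 / 16) `<=` eball 0 1.
  move=> z; move: hy; rewrite /cball/eball/= !subr0 => hy hz.
  by have := enorm_tri z y 0; rewrite !subr0; lra.
have e0 := enorm_ge0 (x - y).
have [xy|xy] := leP (enorm (x - y)) (1 / 16); last first.
  have Bx : forall z, cball 0 (7 / 8) z -> eball 0 1 z.
    by move=> z; rewrite /cball/eball/=; lra.
  have := w1 x (Bx x hx); have := w1 y (Bx y hy).
  by rewrite !ler_norml => /andP[? ?] /andP[? ?]; lra.
have r0 : (0 : R) < 1 / 16 by lra.
have H := local_lipschitz eta (eball 0 1) w y (1 / 16) 1 r0 eta0 _ hw
  (econt_sub _ _ _ sub cw) (fun z hz => w1 z (sub z hz)) x xy.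
have {}H := H (fun z hz => sub z (ltW hz)).
apply: (le_trans H); rewrite lerD2l ler_wpM2r//; lra.
Qed.

(** The limit is the supremum of the [t] that lie below almost all terms. An ultrafilter gives the
    limits at all points simultaneously, without diagonal subsequences. *)
Lemma ultra_limit (G : set_system nat) (UG : UltraFilter G) (a : nat -> R) M :
  (forall j, `|a j| <= M) -> exists l, forall e, 0 < e -> G [set j | `|a j - l| < e].
Proof.
move=> aM; pose E := [set t | G [set j | t < a j]].
have FG : ProperFilter G := ultra_proper.
have sE : has_sup E.
  split.
    exists (- M - 1); apply: (@filterS _ G _ setT) => [j _ /=|]; last exact: filterT.
    by have := aM j; rewrite ler_norml => /andP[? ?]; lra.
  exists M => t /= Gt; rewrite leNgt; apply/negP => Mt.
  have : G set0; last exact: filter_not_empty.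
  apply: filterS Gt => j /= tj.
  by have := aM j; rewrite ler_norml => /andP[? ?]; lra.
exists (sup E) => e e0.
have [t Et te] := sup_adherent e0 sE.
have nE : ~ E (sup E + e / 2).
  by move=> /(sup_upper_bound sE); lra.
have [//|G2] := in_ultra_setVsetC [set j | sup E + e / 2 < a j] UG.
apply: (@filterS _ G _ ([set j | t < a j] `&` ~` [set j | sup E + e / 2 < a j])); last exact: filterI.
move=> j [/= g1 /negP]; rewrite -leNgt => g2; rewrite ltr_norml.
by apply/andP; split; lra.
Qed.

(** Counterexamples for eta = 1 / (j + 1) share a Lipschitz constant on the ball of radius 7 / 8.
    Hence their pointwise ultralimit is uniform on the ball of radius 3 / 4, stability makes it
    infinity-harmonic, and it approximates some counterexample. *)
Theorem almost_harmonic_approx d : 0 < d -> exists2 eta, 0 < eta <= 1 &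
  forall w : V -> R, econt (eball 0 1) w -> sol eta (eball 0 1) w ->
    (forall x, eball 0 1 x -> `|w x| <= 1) ->
  exists h : V -> R, [/\ sol 0 (eball 0 (3 / 4)) h, econt (eball 0 (3 / 4)) h &
    forall x, cball 0 (3 / 4) x -> `|w x - h x| <= d].
Proof.
move=> d0; apply: contrapT => /forall2NP H.
have H' (j : nat) : exists w : V -> R, [/\ econt (eball 0 1) w,
     sol (j.+1%:R^-1) (eball 0 1) w, forall x, eball 0 1 x -> `|w x| <= 1 &
     ~ exists h : V -> R, [/\ sol 0 (eball 0 (3 / 4)) h, econt (eball 0 (3 / 4)) h &
       forall x, cball 0 (3 / 4) x -> `|w x - h x| <= d]].
  have [|] := H j.+1%:R^-1.
    by move/negP; rewrite invr_gt0 ltr0Sn/= invf_le1 ?ltr0Sn// ler1n.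
  move=> /existsNP[w]; rewrite !not_implyE => -[cw [sw [w1 nh]]].
  by exists w; split.
have [w hw] := choice H'.
have [G [UG subG]] := @ultraFilterLemma nat \oo _.
have FG : ProperFilter G := ultra_proper.
have FFG : Filter G by exact: _.
have B x : cball 0 (7 / 8) x -> eball 0 1 x by rewrite /cball/eball/=; lra.
have hl x : exists l, cball 0 (7 / 8) x -> forall e, 0 < e -> G [set j | `|w j x - l| < e].
  have [hx|hx] := pselect (cball 0 (7 / 8) x); last by exists 0.
  have [|l hl] := @ultra_limit G UG (fun j => w j x) 1; last by exists l.
  by move=> j; have [_ _ w1 _] := hw j; apply: w1; exact: B.
have [h hh] := choice hl.
have etaj (j : nat) : 0 <= (j.+1%:R^-1 : R) <= 1.
  by rewrite invr_ge0 ler0n/= invf_le1 ?ltr0Sn// ler1n.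
have wlip j x y : cball 0 (7 / 8) x -> cball 0 (7 / 8) y ->
    w j x <= w j y + 36 * enorm (x - y).
  move=> hx hy; have [cw [sw _] w1 _] := hw j.
  exact: (interior_lipschitz _ _ (etaj j) sw cw w1).
have hlip x y : cball 0 (7 / 8) x -> cball 0 (7 / 8) y ->
    h x <= h y + 36 * enorm (x - y).
  move=> hx hy; apply/ler_addgt0Pr => e e0.
  have e20 : 0 < e / 2 by lra.
  have : G ([set j | `|w j x - h x| < e / 2] `&` [set j | `|w j y - h y| < e / 2]).
    by apply: filterI; exact: hh.
  move=> /filter_ex[j [/=]]; rewrite !ltr_norml => /andP[? ?] /andP[? ?].
  by have := wlip j x y hx hy; lra.
have c78 x : cball 0 (3 / 4) x -> cball 0 (7 / 8) x by rewrite /cball/=; lra.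
have unif e : 0 < e -> G [set j | forall x, cball 0 (3 / 4) x -> `|w j x - h x| <= e].
  move=> e0; have /compact_near_coveringP cov := @cball_compact R n 0 (3 / 4).
  have H0 := cov nat G (fun j x => cball 0 (7 / 8) x -> `|w j x - h x| <= e) FFG.
  apply: filterS (H0 _); first by move=> j hj x hx; apply: hj => //; exact: c78.
  (* The Lipschitz constant 36 gives e / 4 for [w j] and e / 4 for [h], which with e / 2 at the
     center adds up to [e]. *)
  move=> x hx; exists ([set y | enorm (y - x) < e / 144], [set j | `|w j x - h x| < e / 2]).
    split=> /=; first by apply/nbhs_enorm; exists (e / 144) => //; lra.
    by apply: hh; [exact: c78|lra].
  move=> [y j] [/= hy +] Ky; rewrite ltr_norml => /andP[? ?].
  have Kx := c78 _ hx; have := wlip j y x Ky Kx; have := wlip j x y Kx Ky.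
  have := hlip y x Ky Kx; have := hlip x y Kx Ky; rewrite !(enormB x y).
  by move=> *; rewrite ler_norml; apply/andP; split; lra.
have e34 x : eball 0 (3 / 4) x -> cball 0 (3 / 4) x by exact: ltW.
have ch : econt (eball 0 (3 / 4)) h.
  apply: (@econt_lipschitz _ _ _ _ 36) => // x y /e34/c78 hx /e34/c78 hy; exact: hlip.
(* The sign treats [h] and [- h] at once. *)
have stab (sg : bool) : subsol 0 (eball 0 (3 / 4)) (fun x => (-1) ^+ sg * h x).
  apply: subsol_stable => y hy.
  exists (3 / 4 - enorm (y - 0)); first by move: hy; rewrite /eball/=; lra.
  move=> s s0.
  have subA : eball y (3 / 4 - enorm (y - 0)) `<=` eball 0 (3 / 4).
    by move=> x; rewrite /eball/=; have := enorm_tri x y 0; lra.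
  have : G ([set j | forall x, cball 0 (3 / 4) x -> `|w j x - h x| <= s] `&`
            [set j | j.+1%:R^-1 < s]).
    apply: filterI; first exact: unif.
    apply: subG; have := @near_infty_natSinv_lt R (PosNum s0); exact.
  move=> /filter_ex[j [/= j1 j2]].
  have [cw [sw1 sw2] w1 _] := hw j.
  have subB : eball y (3 / 4 - enorm (y - 0)) `<=` eball 0 1.
    by move=> x /subA; rewrite /eball/=; lra.
  exists (fun x => (-1) ^+ sg * w j x); split.
  - case: sg; last by under eq_fun do rewrite expr0 mul1r; apply: subsolS sw1 => //; rewrite add0r ltW.
    by under eq_fun do rewrite expr1 mulN1r; apply: subsolS sw2 => //; rewrite add0r ltW.
  - case: sg; last by under eq_fun do rewrite expr0 mul1r; apply: econt_sub cw.
    by under eq_fun do rewrite expr1 mulN1r; apply: econt_sub (econtN _ _ cw).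
  - move=> x /subA/e34/j1; rewrite ler_norml => /andP[? ?].
    by case: sg; rewrite ?expr0 ?expr1 ?mul1r ?mulN1r; lra.
  - have := j1 y (e34 _ hy); rewrite ler_norml => /andP[? ?].
    by case: sg; rewrite ?expr0 ?expr1 ?mul1r ?mulN1r; lra.
have [j hj] := filter_ex (unif d d0).
have [_ _ _] := hw j; apply; exists h; split => //; split.
  by have := stab false; under eq_fun do rewrite expr0 mul1r.
by have := stab true; under eq_fun do rewrite expr1 mulN1r.
Qed.

End Compactness.

(** * Taylor expansions from the differential calculus of the library *)

Section Calculus.
Context {R : realType} {n : nat}.
Local Notation V := 'rV[R]_n.
Implicit Types (p q h k x y z v : V) (r s t d e : R) (f phi : V -> R) (X : 'M[R]_n).

Lemma vec_sum v : v = \sum_i v 0 i *: delta_mx 0 i.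
Proof. exact: row_sum_delta. Qed.

Lemma diff_grad f x v : differentiable f x -> 'd f x v = dot (grad f x) v.
Proof.
move=> df; rewrite {1}(vec_sum v) linear_sum; apply: eq_bigr => i _.
by rewrite linearZ/= mxE /partial deriveE// mulrC.
Qed.

Lemma diff_approx f x : differentiable f x -> forall e, 0 < e ->
  exists2 r, 0 < r & forall h, enorm h < r ->
    `|f (x + h) - f x - dot (grad f x) h| <= e * enorm h.
Proof.
move=> df e e0; have := diff_locally df; set o := 'o _ => E.
have := littleoP [littleo of o] e0; move=> /nbhs_enorm[r r0 hr].
exists r => // h; rewrite -{1}(subr0 h) => /hr /=.
have := congr1 (fun g => g h) E => /= Eh.
have -> : o h = f (x + h) - f x - dot (grad f x) h.
  have {}Eh : f (h + x) = f x + 'd f x h + o h := Eh.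
  rewrite -diff_grad// (addrC x) Eh.
  have gen (a b c : R) : a = c + b + a - c - b by ring.
  exact: gen.
move=> /le_trans; apply; rewrite ler_pM2l//; exact: norm_le_enorm.
Qed.


(** The explicit test functions are polynomials of degree at most two along every line. *)
Lemma is_derive_quadratic (W : normedModType R) (f : W -> R) (x v : W) (a b : R) :
  (forall s, f (x + s *: v) = f x + s * a + s ^+ 2 * b) -> is_derive x v f a.
Proof.
move=> fE.
have H : (fun s => s^-1 *: ((f \o shift x) (s *: v) - f x)) @ 0^' --> a.
  apply/cvgrPdist_le => e e0; near=> s.
  have s0 : s != 0 by near: s; exact: nbhs_dnbhs_neq.
  rewrite /= [s *: v + x]addrC fE; have -> : a - s^-1 *: (f x + s * a + s ^+ 2 * b - f x) = - (s * b).
    by rewrite /GRing.scale/=; field.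
  rewrite normrN normrM.
  have sb : `|s| < e / (`|b| + 1).
    near: s; apply: dnbhs0_lt; rewrite divr_gt0//; have := normr_ge0 b; lra.
  move: sb; rewrite ltr_pdivlMr; last by have := normr_ge0 b; lra.
  by have := normr_ge0 s; lra.
apply: DeriveDef; first by apply/cvg_ex; exists a.
exact: cvg_lim H.
Unshelve. all: by end_near. Qed.

Lemma is_derive_line f y v t : derivable f (y + t *: v) v ->
  is_derive t 1 (fun s => f (y + s *: v)) ('D_v f (y + t *: v)).
Proof.
have E : (fun r => r^-1 *: (((fun s => f (y + s *: v)) \o shift t) (r *: 1) - f (y + t *: v))) =
   (fun r => r^-1 *: ((f \o shift (y + t *: v)) (r *: v) - f (y + t *: v))).
  apply/funext => r /=; congr (_ *: (f _ - _)).
  have -> : r *: (1 : R) = r by rewrite /GRing.scale/= mulr1.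
  by rewrite scalerDl addrCA.
by move=> df; apply: DeriveDef; rewrite /derivable /derive E.
Qed.

(** The mean value theorem for s |-> f (y + s v) - s a - s^2 b: with [a] and [b] the Taylor terms, a
    single intermediate point expresses the remainder of first or of second order. *)
Lemma MVT_line f y v : (forall t, 0 <= t <= 1 -> differentiable f (y + t *: v)) ->
  forall a b, exists2 t, 0 <= t <= 1 &
    f (y + v) - f y - a - b = dot (grad f (y + t *: v)) v - a - 2 * t * b.
Proof.
move=> df a b.
pose F := (fun s => f (y + s *: v)) - (fun s => s * a) - (fun s => s ^+ 2 * b).
have dF t : 0 <= t <= 1 ->
    is_derive t 1 F (dot (grad f (y + t *: v)) v - a - 2 * t * b).
  move=> t01; apply: is_deriveB.
    apply: is_deriveB.
      rewrite -(diff_grad _ _ _ (df t t01)) -(deriveE _ (df t t01)).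
      by apply: is_derive_line; apply: diff_derivable; exact: df.
    by apply: (is_derive_quadratic _ _ _ _ _ 0) => s; rewrite /GRing.scale/=; ring.
  by apply: (is_derive_quadratic _ _ _ _ _ b) => s; rewrite /GRing.scale/=; ring.
have [||c c01 E] := @MVT_segment R F (fun t => dot (grad f (y + t *: v)) v - a - 2 * t * b) 0 1 ler01.
- by move=> t; rewrite in_itv/= => /andP[t0 t1]; apply: dF; rewrite !ltW.
- apply: derivable_within_continuous => t; rewrite in_itv/= => t01.
  by have [] := dF t t01.
exists c; first by move: c01; rewrite in_itv.
move: E; rewrite subr0 mulr1 => <-.
rewrite /F !fctE scale1r scale0r addr0; ring.
Qed.

Lemma bil_hessian phi y h : bil (hessian phi y) h h =
  \sum_j dot (grad (partial j phi) y) h * h 0 j.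
Proof.
rewrite /bil {1}/dot; apply: eq_bigr => j _; rewrite mxE; congr (_ * _).
by rewrite /dot; apply: eq_bigr => i _; rewrite !mxE mulrC.
Qed.

Lemma infty_laplacianE phi y :
  infty_laplacian phi y = bil (hessian phi y) (grad phi y) (grad phi y).
Proof.
by rewrite /infty_laplacian trmx_mul trmxK -/(bil _ _ _) bil_tr.
Qed.

(** The intermediate point reduces the second-order remainder to the first-order remainders of the
    partial derivatives; the factor 1 / [n.+1] pays for summing over coordinates. *)
Lemma C2_expansion A phi y : open A -> C2_on A phi -> A y -> forall d, 0 < d ->
  exists2 r, 0 < r & forall h, enorm h < r ->
    `|phi (y + h) - phi y - dot (grad phi y) h - bil (2^-1 *: hessian phi y) h h|
      <= d * dot h h.
Proof.
move=> oA [[dphi _] C2] Ay d d0.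
have : nbhs y A by apply: open_nbhs_nbhs.
move=> /nbhs_enorm[r r0 rA].
have e0 : 0 < d / n.+1%:R by rewrite divr_gt0.
have [s s0 hs] : exists2 s, 0 < s & forall j h, enorm h < s ->
    `|partial j phi (y + h) - partial j phi y - dot (grad (partial j phi) y) h| <= d / n.+1%:R * enorm h.
  have H j : exists s, 0 < s /\ forall h, enorm h < s ->
    `|partial j phi (y + h) - partial j phi y - dot (grad (partial j phi) y) h| <= d / n.+1%:R * enorm h.
    have [s s0 hs] := diff_approx (partial j phi) y ((C2 j).1 y Ay) _ e0.
    by exists s.
  have [S hS] := choice H.
  exists (\big[Num.min/1]_j S j).
    by apply: lt_bigmin => // j _; have [] := hS j.
  move=> j h hh; have [_] := hS j; apply; apply: lt_le_trans hh _.
  by apply: bigmin_le_cond.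
exists (Num.min r s); first by rewrite lt_min r0.
move=> h; rewrite lt_min => /andP[hr hs'].
have e1 := enorm_ge0 h.
have seg t : 0 <= t <= 1 -> enorm (t *: h) <= enorm h.
  by move=> /andP[t0 t1]; rewrite enormZ ger0_norm// ler_piMl.
have dseg t : 0 <= t <= 1 -> differentiable phi (y + t *: h).
  move=> t01; apply: dphi; apply: rA; rewrite addrC addKr.
  exact: le_lt_trans (seg t t01) hr.
have [t t01] := MVT_line phi y h dseg (dot (grad phi y) h) (bil (2^-1 *: hessian phi y) h h).
have -> : 2 * t * bil (2^-1 *: hessian phi y) h h = t * bil (hessian phi y) h h.
  by rewrite bilZm; field.
move=> E; rewrite E bil_hessian.
have -> : dot (grad phi (y + t *: h)) h - dot (grad phi y) h
    - t * (\sum_j dot (grad (partial j phi) y) h * h 0 j) =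
   \sum_j (partial j phi (y + t *: h) - partial j phi y - dot (grad (partial j phi) y) (t *: h)) * h 0 j.
  rewrite mulr_sumr /dot -!sumrB; apply: eq_bigr => j _; rewrite !mxE.
  by rewrite -/(dot _ _) -/(dot _ _) dotZr; ring.
apply: (le_trans (ler_norm_sum _ _ _)).
apply: (@le_trans _ _ (\sum_(j < n) d / n.+1%:R * dot h h)).
  apply: ler_sum => j _; rewrite normrM.
  rewrite enormE expr2 mulrA; apply: ler_pM => //; last exact: coord_enorm.
  apply: (le_trans (hs j _ _)); first exact: le_lt_trans (seg t t01) hs'.
  by rewrite ler_pM2l// seg.
rewrite sumr_const card_ord -[leLHS]mulr_natl mulrA ler_wpM2r ?dot_ge0//.
by rewrite mulrA ler_pdivrMr// mulrC ler_pM2l// ler_nat leqnSn.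
Qed.

Lemma jet_C2 A phi y : open A -> C2_on A phi -> A y ->
  upper_jet phi y (grad phi y) (2^-1 *: hessian phi y) /\
  upper_jet (fun x => - phi x) y (- grad phi y) (- (2^-1 *: hessian phi y)).
Proof.
move=> oA C2 Ay; split=> d d0; have [r r0 hr] := C2_expansion _ _ _ oA C2 Ay d d0.
  by exists r => // h /hr; rewrite ler_norml => /andP[_]; lra.
by exists r => // h /hr; rewrite ler_norml bilNm dotNl => /andP[]; lra.
Qed.

End Calculus.

(** * Equivalence of jets and smooth test functions *)

Section Bridge.
Context {R : realType} {n : nat}.
Local Notation V := 'rV[R]_n.
Implicit Types (p q h k x y z v : V) (r s t d e : R) (f phi : V -> R) (X : 'M[R]_n).

Lemma differentiable_affine (c : R) p y x : differentiable (fun x => c + dot p (x - y)) x.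
Proof.
have -> : (fun x => c + dot p (x - y)) = cst c + \sum_(i < n) (fun x => p 0 i * (x 0 i - y 0 i)).
  apply/funext => z; rewrite !fctE fct_sumE; congr (_ + _).
  by apply: eq_bigr => i _; rewrite !mxE.
apply: differentiableD => //; apply: differentiable_sum => i.
apply: differentiableM => //; apply: differentiableB => //.
exact: differentiable_coord.
Qed.

Lemma dot_delta v i : dot (delta_mx 0 i) v = v 0 i.
Proof.
rewrite /dot (bigD1 i)//= mxE !eqxx mul1r big1 ?addr0// => j ji.
by rewrite mxE eqxx (negbTE ji) mul0r.
Qed.

Lemma differentiable_quadratic p X y x :
  differentiable (fun x => dot p (x - y) + bil X (x - y) (x - y)) x.
Proof.
pose l (c : R) q := (fun x => c + dot q (x - y)) : V -> R.
have -> : (fun x => dot p (x - y) + bil X (x - y) (x - y)) =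
  \sum_(j < n) (l (p 0 j) (\row_i X i j) * l 0 (delta_mx 0 j)).
  apply/funext => z; rewrite /bil !fct_sumE /dot -big_split/=; apply: eq_bigr => j _.
  rewrite !fctE /l dot_delta add0r mulrDl; congr (_ + _ * _).
  by rewrite mxE /dot; apply: eq_bigr => i _; rewrite !mxE mulrC.
apply: differentiable_sum => j; apply: differentiableM; exact: differentiable_affine.
Qed.

Lemma partial_affine (c : R) p y i x : partial i (fun x => c + dot p (x - y)) x = p 0 i.
Proof.
rewrite /partial; apply: derive_val; apply: (is_derive_quadratic _ _ _ _ _ 0) => s.
rewrite (addrAC x); move: (x - y) => z.
by rewrite dotDr dotZr (dotC p (delta_mx _ _)) dot_delta; ring.
Qed.

Lemma partial_quadratic p X y i x :
  partial i (fun x => dot p (x - y) + bil X (x - y) (x - y)) x =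
  p 0 i + dot (delta_mx 0 i *m (X + X^T)) (x - y).
Proof.
rewrite /partial; apply: derive_val.
apply: (is_derive_quadratic _ _ _ _ _ (bil X (delta_mx 0 i) (delta_mx 0 i))) => s.
rewrite (addrAC x); move: (x - y) => z.
rewrite -/(bil (X + X^T) _ _) bilDm bil_tr !bilDl !bilDr !bilZl !bilZr dotDr dotZr.
by rewrite (dotC p (delta_mx _ _)) dot_delta; ring.
Qed.

Lemma affine_continuous p X y : continuous (fun x => p + (x - y) *m X : V).
Proof.
move=> x; apply/(@cvgrPdist_lt _ _ _ (nbhs x)) => e e0.
have [C C0 hC] := mulmx_bound X.
apply/nbhs_enorm; exists (e / C); first by rewrite divr_gt0.
move=> z; rewrite ltr_pdivlMr// mulrC => hz.
apply: le_lt_trans (norm_le_enorm _) _; apply: le_lt_trans hz.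
rewrite (_ : _ - _ = - ((z - x) *m X)) ?enormN//.
rewrite opprD addrACA subrr add0r -mulmxBl -mulNmx; congr (_ *m _).
by rewrite opprB addrA subrK opprB.
Qed.

Lemma dot_delta_mul X v i : dot (delta_mx 0 i *m X) v = (v *m X^T) 0 i.
Proof. by rewrite -/(bil _ _ _) -bil_tr /bil dotC dot_delta. Qed.

Lemma C2_quadratic A p X y : C2_on A (fun x => dot p (x - y) + bil X (x - y) (x - y)).
Proof.
split; first split.
- by move=> x _; exact: differentiable_quadratic.
- apply: continuous_subspaceT => x.
  rewrite (_ : grad _ = fun x => p + (x - y) *m (X + X^T)); first exact: affine_continuous.
  apply/funext => z; apply/rowP => i; rewrite mxE [RHS]mxE partial_quadratic; congr (_ + _).
  have tX : (X + X^T)^T = X + X^T by rewrite linearD/= trmxK addrC.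
  by rewrite dot_delta_mul tX.
- move=> i; have -> : partial i (fun x => dot p (x - y) + bil X (x - y) (x - y)) =
     (fun x => p 0 i + dot (delta_mx 0 i *m (X + X^T)) (x - y)).
    by apply/funext => x; exact: partial_quadratic.
  split; first by move=> x _; exact: differentiable_affine.
  apply: continuous_subspaceT => x.
  rewrite (_ : grad _ = cst (delta_mx 0 i *m (X + X^T))); first exact: cst_continuous.
  by apply/funext => z; apply/rowP => j; rewrite mxE partial_affine.
Qed.

Lemma grad_quadratic p X y : grad (fun x => dot p (x - y) + bil X (x - y) (x - y)) y = p.
Proof. by apply/rowP => i; rewrite mxE partial_quadratic subrr dot0r addr0. Qed.

Lemma infty_laplacian_quadratic p X y :
  infty_laplacian (fun x => dot p (x - y) + bil X (x - y) (x - y)) y = 2 * bil X p p.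
Proof.
rewrite infty_laplacianE grad_quadratic (_ : hessian _ y = X + X^T).
  by rewrite bilDm bil_tr; ring.
apply/matrixP => i j; rewrite mxE.
have -> : partial j (fun x => dot p (x - y) + bil X (x - y) (x - y)) =
     (fun x => p 0 j + dot (delta_mx 0 j *m (X + X^T)) (x - y)).
  by apply/funext => x; exact: partial_quadratic.
by rewrite partial_affine -rowE !mxE addrC.
Qed.

(** The paraboloid with second-order part [X + d] lies above [u] near [y]. Its gradient at [y] is
    [p] for every [d], so [G] is evaluated at a fixed argument while d tends to 0. *)
Lemma subsolution_jet A G u y p X : viscosity_subsolution A G u -> A y ->
  upper_jet u y p X -> G y (u y) p <= 2 * bil X p p.
Proof.
move=> su Ay J; apply: (@le_limit _ _ _ (2 * dot p p)) => d /andP[d0 d1].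
pose Y := X + d%:M.
have := su (fun x => dot p (x - y) + bil Y (x - y) (x - y)) y (C2_quadratic _ _ _ _) Ay.
rewrite grad_quadratic infty_laplacian_quadratic /Y (bilDm _ _ p p) (bil_scalar _ p p) => H.
suff : G y (u y) p <= 2 * (bil X p p + d * dot p p) by lra.
apply: H; have [r r0 hr] := J d d0; apply/nbhs_enorm; exists r => // z hz.
have := hr _ hz; rewrite subrr dot0r bil0l addr0 subr0 bilDm bil_scalar.
by rewrite addrC subrK; lra.
Qed.

Lemma supersolution_jet A G u y p X : viscosity_supersolution A G u -> A y ->
  upper_jet (fun x => - u x) y p X -> - G y (u y) (- p) <= 2 * bil X p p.
Proof.
move=> su Ay J; apply: (@le_limit _ _ _ (2 * dot p p)) => d /andP[d0 d1].
pose Y := X + d%:M.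
have := su (fun x => dot (- p) (x - y) + bil (- Y) (x - y) (x - y)) y (C2_quadratic _ _ _ _) Ay.
rewrite grad_quadratic infty_laplacian_quadratic (bilNm _ (- p)) bilNl bilNr opprK /Y (bilDm _ _ p p) (bil_scalar _ p p) => H.
suff : - (2 * (bil X p p + d * dot p p)) <= G y (u y) (- p) by lra.
rewrite -mulrN; apply: H; have [r r0 hr] := J d d0; apply/nbhs_enorm; exists r => // z hz.
have := hr _ hz; rewrite subrr dot0r bil0l addr0 subr0 bilNm bilDm bil_scalar dotNl.
by rewrite addrC subrK; lra.
Qed.

(** The passage back to smooth test functions: it makes the functions constructed here subject to
    the regularity hypothesis and to the estimate behind [alphaH]. *)
Lemma sol_infty_harmonic (h : V -> R) : sol 0 (eball 0 1) h -> econt (eball 0 1) h ->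
  infty_harmonic h.
Proof.
move=> [h1 h2] ch; split; first exact/econtP.
split=> phi y C2 Ay /nbhs_enorm[r r0 hr]; rewrite infty_laplacianE;
  have [J1 J2] := jet_C2 _ _ _ (eball_open 0 1) C2 Ay.
  have := h1 y _ _ Ay (jet_touch _ _ y _ _ _ J1 _).
  rewrite bilZm oppr0 pmulr_rge0 ?invr_gt0//; apply.
  by exists r => // k hk; have := hr (y + k); rewrite [y + k - y]addrC addKr => /(_ hk); lra.
have := h2 y _ _ Ay (jet_touch _ _ y _ _ _ J2 _).
rewrite bilNm bilZm bilNl bilNr !opprK oppr0 oppr_ge0 pmulr_rle0 ?invr_gt0//; rewrite ?opprK; apply.
by exists r => // k hk; have := hr (y + k); rewrite [y + k - y]addrC addKr => /(_ hk); lra.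
Qed.

End Bridge.

(** * Rescaling and the uniform C^(1,a) estimate for infinity-harmonic functions *)

Section Regularity.
Context {R : realType} {n : nat}.
Local Notation V := 'rV[R]_n.
Implicit Types (p q k x y z v : V) (r s t d e : R) (f phi : V -> R) (X : 'M[R]_n).

(** Gradients scale by rho / S and Hessians by rho^2 / S, hence the operator, quadratic in one and
    linear in the other, by rho^4 / S^3. *)
Lemma subsol_rescale eta y (rho S c : R) (w : V -> R) : 0 < rho -> 0 < S ->
  subsol eta (eball y rho) w ->
  subsol (eta * rho ^+ 4 / S ^+ 3) (eball 0 1) (fun x => S^-1 * (w (y + rho *: x) - c)).
Proof.
move=> r0 S0 sw x p X Ax J.
have rn : rho != 0 by rewrite gt_eqF.
have Sn : S != 0 by rewrite gt_eqF.
have Aw : eball y rho (y + rho *: x).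
  move: Ax; rewrite /eball/= subr0 addrC addKr enormZ gtr0_norm// => Ax.
  by rewrite gtr_pMr.
have J' : upper_jet w (y + rho *: x) ((S / rho) *: p) ((S / rho ^+ 2) *: X).
  move=> d d0; have d'0 : 0 < d * rho ^+ 2 / S by rewrite divr_gt0// mulr_gt0// exprn_gt0.
  have [r r00 hr] := J _ d'0; exists (rho * r); first by rewrite mulr_gt0.
  move=> h hh; have := hr (rho^-1 *: h).
  rewrite enormZ gtr0_norm ?invr_gt0// mulrC ltr_pdivrMr// [r * rho]mulrC => /(_ hh).
  rewrite scalerDr scalerA divff// scale1r addrA !dotZr !bilZr !bilZl !dotZl bilZm.
  rewrite -(ler_pM2l S0) => H.
  have -> : w (y + rho *: x + h) = S * (S^-1 * (w (y + rho *: x + h) - c)) + c by field.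
  have -> : w (y + rho *: x) = S * (S^-1 * (w (y + rho *: x) - c)) + c by field.
  rewrite -lerBrDr; apply: (le_trans H); rewrite le_eqVlt; apply/orP; left; apply/eqP.
  by field; rewrite rn Sn.
have := sw _ _ _ Aw J'; rewrite bilZm bilZl bilZr => H.
have SR : 0 < rho ^+ 4 / S ^+ 3 by rewrite divr_gt0// exprn_gt0.
move: H; rewrite -(ler_pM2l SR) => H.
rewrite -mulrA -mulNr mulrC; apply: (le_trans H).
by rewrite le_eqVlt; apply/orP; left; apply/eqP; field; rewrite rn Sn.
Qed.

Lemma sol_rescale eta y (rho S c : R) (w : V -> R) : 0 < rho -> 0 < S ->
  sol eta (eball y rho) w ->
  sol (eta * rho ^+ 4 / S ^+ 3) (eball 0 1) (fun x => S^-1 * (w (y + rho *: x) - c)).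
Proof.
move=> r0 S0 [s1 s2]; split; first exact: subsol_rescale.
have := subsol_rescale _ _ _ _ (- c) _ r0 S0 s2.
by under eq_fun do rewrite -opprD mulrN.
Qed.

Lemma econt_rescale y (rho S c : R) (w : V -> R) : 0 < rho -> 0 < S ->
  econt (eball y rho) w -> econt (eball 0 1) (fun x => S^-1 * (w (y + rho *: x) - c)).
Proof.
move=> r0 S0 cw x Ax e e0.
have H z : eball 0 1 z -> eball y rho (y + rho *: z).
  by rewrite /eball/= subr0 addrC addKr enormZ gtr0_norm// => Az; rewrite gtr_pMr.
have [d d0 hd] := cw _ (H x Ax) (S * e) (mulr_gt0 S0 e0).
exists (d / rho); first by rewrite divr_gt0.
move=> z Az; rewrite ltr_pdivlMr// mulrC => hz.
rewrite -mulrBr opprB addrA subrK normrM gtr0_norm ?invr_gt0//.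
rewrite mulrC ltr_pdivrMr// mulrC; apply: hd; first exact: H.
by rewrite opprD addrACA subrr add0r -scalerBr enormZ gtr0_norm.
Qed.

Lemma rescale_point y (rho : R) x : 0 < rho -> y + rho *: (rho^-1 *: (x - y)) = x.
Proof. by move=> r0; rewrite scalerA divff ?gt_eqF// scale1r addrC subrK. Qed.

Lemma sup_norm_le A f (c : R) : (forall x, A x -> `|f x| <= c) -> (sup_norm A f <= c%:E)%E.
Proof. by move=> H; apply: ge_ereal_sup => _ [x Ax <-]; rewrite lee_fin H. Qed.

Lemma sup_norm_ge A f x : A x -> (`|f x|%:E <= sup_norm A f)%E.
Proof. by move=> Ax; apply: ereal_sup_ubound; exists x. Qed.

Section Harmonic.
Variable ahat : R.
Hypotheses (alphaH01 : 0 < alphaH R n < 1) (ahatH : 0 < ahat < alphaH R n)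
  (harmonic_reg : forall h : V -> R, infty_harmonic h -> C1a_loc (alphaH R n) (eball 0 1) h).

(** The supremum [alphaH] may fail to be attained, which is why [ahat] is strictly below it: some
    admissible exponent in between has a uniform constant. The mean value theorem turns its Hoelder
    bound into a first-order expansion. *)
Lemma harmonic_C1a : exists a C, [/\ ahat < a, a <= 1, 0 < C &
  forall h : V -> R, sol 0 (eball 0 1) h -> econt (eball 0 1) h ->
    (forall x, eball 0 1 x -> `|h x| <= 1) ->
  exists p, forall x, enorm x < 1 / 2 ->
    `|h x - h 0 - dot p x| <= C * (enorm x * enorm x `^ a)].
Proof.
have /andP[aH0 aH1] := alphaH01; have /andP[ah0 ah1] := ahatH.
set E := [set a : R | 0 <= a <= 1 /\ exists2 C : R, 0 < C & forall h, XiH R n h ->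
  (C1a_norm a (eball 0 (1 / 2)) h <= C%:E * sup_norm (eball 0 1) h)%E].
have EH : alphaH R n = sup E by [].
have E0 : E !=set0.
  (* The supremum of the empty set is 0 by convention, so a positive [alphaH] means that some
     exponent is admissible. *)
  apply/set0P/negP => /eqP E0; move: aH0; rewrite EH E0 sup0; lra.
have supE : has_sup E by split => //; exists 1 => a [/andP[]].
have e0 : 0 < sup E - ahat by rewrite -EH; lra.
have [a [/andP[a0 a1] [C C0 hC]] aa] := sup_adherent e0 supE.
exists a, C; split => //; first by lra.
move=> h sh ch h1.
have ih := sol_infty_harmonic _ sh ch.
have reg := harmonic_reg _ ih.
have s1 : (sup_norm (eball 0 1) h <= 1%:E)%E by exact: sup_norm_le.
have hXi : XiH R n h.
  split => //; first exact: le_lt_trans s1 (ltry _).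
  by exists (alphaH R n).
have hb : (C1a_norm a (eball 0 (1 / 2)) h <= C%:E)%E.
  apply: (le_trans (hC h hXi)); rewrite -[leRHS]mule1; apply: lee_wpmul2l => //.
  by rewrite lee_fin ltW.
have B0 : eball (0 : V) (1 / 2) 0 by rewrite /eball/= subrr enorm0; lra.
have sn0 f : (0 <= sup_norm (eball 0 (1 / 2)) f)%E.
  by apply: le_trans (sup_norm_ge _ _ _ B0); rewrite lee_fin.
have hh : (holder_seminorm a (eball 0 (1 / 2)) (grad h) <= C%:E)%E.
  apply: le_trans hb; rewrite /C1a_norm -[leLHS]add0e; apply: leeD => //.
  by apply: adde_ge0; exact: sn0.
have gb x : enorm x < 1 / 2 -> enorm (grad h x - grad h 0) <= C * enorm x `^ a.
  move=> hx; have [->|x0] := eqVneq x 0.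
    by rewrite subrr enorm0 mulr_ge0 ?powR_ge0// ltW.
  have : ((enorm (grad h x - grad h 0) / (enorm (x - 0) `^ a))%:E <= C%:E)%E.
    apply: le_trans hh; apply: ereal_sup_ubound; exists x => /=.
      by rewrite /eball/= subr0.
    by exists 0 => //; exact: B0.
  by rewrite lee_fin subr0 ler_pdivrMr// powR_gt0// enorm_gt0.
exists (grad h 0) => x hx.
have [dh _] := reg.1.
have seg t : 0 <= t <= 1 -> enorm (t *: x) <= enorm x.
  by move=> /andP[t0 t1]; rewrite enormZ ger0_norm// ler_piMl ?enorm_ge0.
have dseg t : 0 <= t <= 1 -> differentiable h (0 + t *: x).
  by move=> t01; apply: dh; rewrite add0r /eball/= subr0; have := seg t t01; lra.
have [t t01] := MVT_line h 0 x dseg (dot (grad h 0) x) 0.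
rewrite !add0r mulr0 !subr0 => ->.
rewrite -dotNl -dotDl; apply: (le_trans (cauchy_schwarz_abs _ _)).
rewrite [enorm x * _]mulrC mulrA ler_wpM2r ?enorm_ge0//.
have st := seg t t01; apply: (le_trans (gb (t *: x) _)); first by lra.
apply: ler_wpM2l; first exact: ltW.
by apply: ge0_ler_powR => //; rewrite nnegrE enorm_ge0.
Qed.

Lemma harmonic_flat : exists a C, [/\ ahat < a, a <= 1, 0 < C &
  forall y (rho M : R) (h : V -> R), 0 < rho -> 0 < M ->
    sol 0 (eball y rho) h -> econt (eball y rho) h ->
    (forall x, eball y rho x -> `|h x| <= M) ->
  exists p, forall x, enorm (x - y) < rho / 2 ->
    `|h x - h y - dot p (x - y)| <= C * M / rho * (enorm (x - y) * (enorm (x - y) / rho) `^ a)].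
Proof.
have [a [C [a1 a2 C0 H]]] := harmonic_C1a.
exists a, C; split=> // y rho M h r0 M0 sh ch hM.
have rn : rho != 0 by rewrite gt_eqF.
have Mn : M != 0 by rewrite gt_eqF.
have := sol_rescale _ _ _ _ 0 _ r0 M0 sh; rewrite !mul0r => sh'.
have [x Ax|p hp] := H _ sh' (econt_rescale _ _ _ _ _ r0 M0 ch).
  rewrite subr0 normrM gtr0_norm ?invr_gt0// mulrC ler_pdivrMr// mul1r.
  apply: hM; move: Ax; rewrite /eball/= subr0 addrC addKr enormZ gtr0_norm// => Ax.
  by rewrite gtr_pMr.
exists ((M / rho) *: p) => x hx.
have := hp (rho^-1 *: (x - y)); rewrite rescale_point// scaler0 addr0 !subr0.
rewrite enormZ gtr0_norm ?invr_gt0// [rho^-1 * _]mulrC => /(_ _) H1.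
have {}H1 : enorm (x - y) / rho < 1 / 2 -> _ := H1.
have : enorm (x - y) / rho < 1 / 2 by rewrite ltr_pdivrMr//; lra.
move=> /H1; rewrite -mulrBr dotZr dotZl.
rewrite -(ler_pM2l M0) -[X in X * `|_|](gtr0_norm M0) -normrM => H2.
rewrite (_ : h x - _ - _ = M * (M^-1 * (h x - h y) - rho^-1 * dot p (x - y))); last first.
  by field; rewrite rn Mn.
apply: (le_trans H2); rewrite le_eqVlt; apply/orP; left; apply/eqP.
by move: (_ `^ _) => P; field.
Qed.

End Harmonic.
End Regularity.

(** * Sup-convolution where slopes are bounded below *)

Section SupConvolution.
Context {R : realType} {n : nat}.
Local Notation V := 'rV[R]_n.
Implicit Types (x y z p h : V) (r s t d eta eps L M : R) (X : 'M[R]_n).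

(* At a maximum point [z] of [w] over a ball around [x], comparison with cones of vertex [x]
   bounds the growth of [w] towards [z] from below. *)
Lemma growth_before_max eta eps (w : V -> R) x z :
  0 < eta -> 0 < eps -> eta * eps <= 1 / 160 ->
  subsol eta (eball 0 1) w -> econt (eball 0 1) w ->
  cball x eps `<=` eball 0 1 -> cball x eps z ->
  (forall y, cball x eps y -> w y <= w z) -> eps / 2 <= w z - w x ->
  forall t, 0 <= t <= eps -> exists2 y, enorm (y - z) = t & w y <= w z - 2 / 5 * t.
Proof.
move=> eta0 eps0 etaeps sw cw xA zx zmax wzx t t01.
have [D DE] : exists D, D = w z - w x by eexists.
(* The cones used here keep a slope of at least 2 / 5, and 8 (2/5)^2 > 1 gives strictness. *)
have [c cE] : exists c, c = 8 * eta by eexists.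
have c0 : 0 < c by lra.
have De : D / eps * eps = D by rewrite divfK// gt_eqF.
have De2 : 1 / 2 <= D / eps by rewrite ler_pdivlMr//; lra.
move: (D / eps) De De2 => De DE' De2.
(* The cone reaches exactly the height [D] at radius [eps]. *)
have [b bE] : exists b, b = De + c * eps by eexists.
have ce : c * eps <= 1 / 20 by rewrite cE; lra.
have ce0 : 0 < c * eps by rewrite mulr_gt0.
have b1 : 2 * c * eps < b by lra.
have b2 : eta < c * (b - 2 * c * eps) ^+ 2.
  have : (2 / 5) ^+ 2 <= (b - 2 * c * eps) ^+ 2 by rewrite ler_pXn2r// ?nnegrE; lra.
  by rewrite cE; clear -eta0; nra.
have bD : b * eps - c * eps ^+ 2 = D by rewrite bE mulrDl DE'; ring.
have xA' : eball x eps `<=` eball 0 1 by move=> y hy; apply: xA; exact: ltW.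
have cone := cone_comparison _ _ _ _ _ _ _ eps0 c0 b1 b2 xA' sw (econt_sub _ _ _ xA cw) _.
have {}cone y : enorm (y - x) <= eps ->
    w y <= w x + b * enorm (y - x) - c * enorm (y - x) ^+ 2.
  apply: cone => a ha; rewrite -addrA bD DE addrC subrK; apply: zmax.
  by rewrite /cball/= ha.
(* The cone increases strictly, so height [D] is out of reach inside the ball and [z] lies on the
   sphere. *)
have dE : enorm (z - x) = eps.
  apply/eqP; rewrite eq_le (zx : enorm (z - x) <= eps)/= leNgt; apply/negP => dlt.
  have h := cone z zx; have d0 := enorm_ge0 (z - x).
  move: (enorm (z - x)) dlt d0 h => d dlt d0 h.
  have : 0 < (eps - d) * (b - c * (eps + d)).
    rewrite mulr_gt0 ?subr_gt0//; apply: le_lt_trans b1.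
    have : c * d <= c * eps by rewrite ler_pM2l// ltW.
    by lra.
  by lra.
have /andP[t0 t1] := t01.
exists (z - (t / eps) *: (z - x)).
  rewrite addrAC subrr add0r enormN enormZ dE.
  by rewrite ger0_norm ?divfK ?gt_eqF// divr_ge0// ltW.
have xtx : enorm (z - (t / eps) *: (z - x) - x) = eps - t.
  have -> : z - (t / eps) *: (z - x) - x = (1 - t / eps) *: (z - x).
    by rewrite scalerBl scale1r addrAC.
  rewrite enormZ dE ger0_norm; last by rewrite subr_ge0 ler_pdivrMr// mul1r.
  by rewrite mulrBl mul1r divfK// gt_eqF.
have := cone (z - (t / eps) *: (z - x)); rewrite xtx => /(_ ltac:(lra)) h.
apply: (le_trans h).
have -> : w x + b * (eps - t) - c * (eps - t) ^+ 2 =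
   w x + (b * eps - c * eps ^+ 2) - (b - 2 * c * eps) * t - c * t ^+ 2 by ring.
rewrite bD DE; have : 0 <= c * t ^+ 2 by rewrite mulr_ge0 ?sqr_ge0// ltW.
have : 2 / 5 * t <= (b - 2 * c * eps) * t by rewrite ler_wpM2r//; lra.
by lra.
Qed.

(* Comparison with cones of vertices just before [z] propagates the slope of [w] beyond [z]. *)
Lemma steep_jet eta eps L (w : V -> R) z p X :
  0 < eta <= 1 -> 0 < eps -> 0 <= L ->
  subsol eta (eball 0 1) w -> econt (eball 0 1) w ->
  (forall a b, eball 0 1 a -> eball 0 1 b -> w a <= w b + L * enorm (a - b)) ->
  eball 0 1 z ->
  (forall t, 0 <= t <= eps -> exists2 y, enorm (y - z) = t & w y <= w z - 2 / 5 * t) ->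
  upper_jet w z p X -> 1 / 4 <= enorm p.
Proof.
move=> /andP[eta0 eta1] eps0 L0 sw cw wL zA wt J.
rewrite leNgt; apply/negP => plt.
have [r1 r10 hr1] := J 1 ltr01.
have [C C0 hC] := bil_bound X.
have [r0 r0E] : exists r0, r0 = 1 - enorm (z - 0) by eexists.
have r00 : 0 < r0 by rewrite r0E subr_gt0.
(* A slope below 1 / 4 and second-order terms of at most rho / 20 bound the growth of [w] on the
   ball of radius rho by 3 / 10 rho. The bound 1 / 1600 makes c rho <= 1 / 200. *)
have [rho [rho0 rho1 rho2 [rC reps r1600]]] :
   exists rho, [/\ 0 < rho, rho < r1, rho < r0 &
   [/\ rho * (C + 1) <= 1 / 20, rho <= eps & rho <= 1 / 1600]].
  exists (Num.min (Num.min (r1 / 2) (r0 / 2)) (Num.min (1 / 20 / (C + 1)) (Num.min eps (1 / 1600)))).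
  have C1 : 0 < 1 / 20 / (C + 1) by rewrite divr_gt0//; clear -C0; lra.
  have r1h : 0 < r1 / 2 by rewrite divr_gt0.
  have r0h : 0 < r0 / 2 by rewrite divr_gt0.
  split.
  - by rewrite !lt_min r1h r0h C1 eps0/=; clear; lra.
  - by rewrite !gt_min (_ : r1 / 2 < r1)//; clear -r10; lra.
  - by rewrite !gt_min (_ : r0 / 2 < r0) ?orbT//; clear -r00; lra.
  split.
  - by rewrite -ler_pdivlMr ?ge_min ?lexx ?orbT//; clear -C0; lra.
  - by rewrite !ge_min lexx !orbT.
  - by rewrite !ge_min lexx !orbT.
have wrho y : enorm (y - z) <= rho -> w y <= w z + 3 / 10 * rho.
  move=> hy; have := hr1 (y - z) (le_lt_trans hy rho1).
  rewrite addrC subrK => h; apply: (le_trans h).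
  have := cauchy_schwarz p (y - z); have := le_trans (ler_norm _) (hC (y - z) (y - z)).
  rewrite enormE; have := enorm_ge0 (y - z); move: (enorm (y - z)) hy => m hy m0 g1 g2.
  have g3 : enorm p * m <= 1 / 4 * rho by rewrite ler_pM ?enorm_ge0// ltW.
  have g4 : (C + 1) * (m * m) <= (C + 1) * (rho * rho).
    by rewrite ler_wpM2l ?ler_pM//; clear -C0; lra.
  have g5 : rho * (C + 1) * rho <= 1 / 20 * rho by rewrite ler_wpM2r// ltW.
  by rewrite expr2; clear -g1 g2 g3 g4 g5; lra.
(* So close to [z] the value of [w] changes by at most rho / 20, hence the vertex can be moved from
   [z] to a point at distance [t]. *)
have [t [t0 tL]] : exists t, 0 < t /\ t * (L + 1) = rho / 20.
  exists (rho / (20 * (L + 1))); have L1 : 0 < L + 1 by clear -L0; lra.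
  split; first by rewrite divr_gt0// mulr_gt0.
  by field; rewrite gt_eqF.
have Lt : L * t <= rho / 20 by clear -tL t0; lra.
have tr : t <= rho / 20 by have : 0 <= L * t by [rewrite mulr_ge0// ltW]; clear -tL; lra.
have [c cE] : exists c, c = 8 * eta by eexists.
have c0 : 0 < c by clear -cE eta0; lra.
have crho : c * rho <= 1 / 200 by rewrite cE; clear -eta0 eta1 rho0 r1600; nra.
have tse : 0 <= t <= eps by rewrite ltW//=; clear -tr reps rho0; lra.
have [xt xtz wxt] := wt t tse.
have xtz' : enorm (z - xt) = t by rewrite enormB.
have rt0 : 0 < rho - t by clear -tr rho0; lra.
have subz y : cball xt (rho - t) y -> enorm (y - z) <= rho.
  rewrite /cball/= => hy; have := enorm_tri y xt z.
  by rewrite xtz; clear -hy; lra.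
have subA : cball xt (rho - t) `<=` eball 0 1.
  move=> y /subz/= hy; rewrite /eball/=; have := enorm_tri y z 0.
  by clear -hy rho2 r0E; lra.
have ct : c * (rho - t) <= 1 / 200.
  by apply: le_trans crho; rewrite ler_pM2l//; clear -t0; lra.
have ct0 : 0 < c * (rho - t) by rewrite mulr_gt0.
(* The slope 38 / 100 is steep enough to dominate 3 / 10 rho + rho / 20 on the sphere of radius rho
   - t, yet below the slope 2 / 5 that [w] has between the vertex and [z]: a contradiction. *)
have H1 : 2 * c * (rho - t) < 38 / 100 by clear -ct; lra.
have H2 : eta < c * (38 / 100 - 2 * c * (rho - t)) ^+ 2.
  have : 37 / 100 <= 38 / 100 - 2 * c * (rho - t) by clear -ct; lra.
  rewrite cE; move: (38 / 100 - _) => e e1.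
  have : (37 / 100) ^+ 2 <= e ^+ 2 by rewrite ler_pXn2r// ?nnegrE; clear -e1; lra.
  by clear -eta0; nra.
have xtA : eball 0 1 xt by apply: subA; rewrite /cball/= subrr enorm0 ltW.
have := cone_comparison _ _ _ _ _ _ _ rt0 c0 H1 H2 _ sw (econt_sub _ _ _ subA cw) _ z.
rewrite xtz' => H3.
have wz : w z <= w xt + 38 / 100 * t - c * t ^+ 2.
  apply: H3; last by clear -tr rho0; lra.
    by move=> y hy; apply: subA; exact: ltW.
  move=> y hy; have hy' : cball xt (rho - t) y by rewrite /cball/= hy.
  have g1 := wrho y (subz _ hy').
  have g2 := wL z xt zA xtA; rewrite xtz' in g2.
  have g3 : c * (rho - t) * (rho - t) <= 1 / 200 * (rho - t) by rewrite ler_pM2r.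
  by rewrite expr2; clear -g1 g2 g3 Lt tr rho0 t0; lra.
have ctt : 0 <= c * t ^+ 2 by rewrite mulr_ge0 ?sqr_ge0// ltW.
by clear -wz wxt ctt t0; lra.
Qed.

(* If [g s = s + k s^2] is convex increasing, the jets of [w] are those of [g o w] with the
   second-order part lowered by [k] times the square of the gradient. *)
Lemma jet_convex_change k (w : V -> R) z (p' : V) (X' : 'M[R]_n) :
  0 <= k -> 1 / 2 <= 1 + 2 * k * w z ->
  upper_jet (fun y => w y + k * w y ^+ 2) z p' X' ->
  let g := 1 + 2 * k * w z in let p := g^-1 *: p' in
  upper_jet w z p (g^-1 *: (X' - k *: (p^T *m p))).
Proof.
move=> k0 g12 J /=; set g := 1 + 2 * k * w z in g12 *; set p := g^-1 *: p'.
have g0 : 0 < g by lra.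
have gi : g^-1 * g = 1 by rewrite mulVf// gt_eqF.
have g2 : g^-1 <= 2.
  by rewrite -(ler_pM2r g0) gi; lra.
have gi0 : 0 < g^-1 by rewrite invr_gt0.
have [C' C'0 hC] := bil_bound X'.
set P := enorm p; have P0 : 0 <= P := enorm_ge0 _.
move=> d d0.
have d40 : 0 < d / 4 by lra.
have [r r0 hr] := J (d / 4) d40.
set C := 2 * (C' + k * P ^+ 2 + d + 1).
have kP : 0 <= k * P ^+ 2 by rewrite mulr_ge0 ?sqr_ge0.
have C0 : 0 < C by rewrite /C; lra.
have [r2 [r20 r21 r22]] : exists r2, [/\ 0 < r2, r2 <= 1 & r2 * (k * C * (2 * P + C)) <= d / 4].
  have Q0 : 0 <= k * C * (2 * P + C) by rewrite !mulr_ge0//; lra.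
  exists (Num.min 1 (d / 4 / (k * C * (2 * P + C) + 1))); split.
  - by rewrite lt_min ltr01 divr_gt0//; lra.
  - by rewrite ge_min lexx.
  - set Q := k * C * _ in Q0 *.
    apply: (@le_trans _ _ (d / 4 / (Q + 1) * (Q + 1))); last by rewrite divfK//; lra.
    rewrite ler_pM ?le_min ?ler01 ?divr_ge0//; try lra.
    by rewrite ge_min lexx orbT.
exists (Num.min r r2); first by rewrite lt_min r0.
move=> h; rewrite lt_min => /andP[/hr hh hr2].
have [tau wE] : exists tau, w (z + h) = w z + tau.
  by exists (w (z + h) - w z); rewrite [RHS]addrC subrK.
have e0 := enorm_ge0 h.
rewrite bilZm bilDm bilNm bilZm bil_rank1 (dotC h p) (enormE h).
have pE : dot p' h = g * dot p h by rewrite /p dotZl mulrA divff ?mul1r// gt_eqF.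
rewrite wE pE (enormE h) in hh; rewrite wE.
have := cauchy_schwarz_abs p h; rewrite -/P; set a := dot p h in hh *; set m := enorm h in hh hr2 e0 *.
rewrite ler_norml => /andP[a1 a2].
have hX := hC h h; rewrite -/m in hX.
set xx := bil X' h h in hh hX *.
have {}hh : g * tau <= g * a + xx + d / 4 * m ^+ 2 - k * tau ^+ 2.
  by move: hh; rewrite /g => hh; lra.
suff : g * tau <= g * a + (xx - k * (a * a)) + g * (d * m ^+ 2).
  move: (xx - k * (a * a)) => Y H.
  have : g * tau <= g * (a + g^-1 * Y + d * m ^+ 2).
    by apply: (le_trans H); rewrite !mulrDr [g * (g^-1 * _)]mulrA mulfV ?gt_eqF// mul1r.
  by rewrite ler_pM2l//; lra.
have m2 : 0 <= m ^+ 2 := sqr_ge0 _.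
have gd : 1 / 2 * (d * m ^+ 2) <= g * (d * m ^+ 2) by rewrite ler_wpM2r// mulr_ge0// ltW.
move: hX; rewrite ler_norml -expr2 => /andP[x1 x2].
have aP : a ^+ 2 <= P ^+ 2 * m ^+ 2.
  rewrite -exprMn -real_normK ?num_real// ler_pXn2r ?nnegrE ?mulr_ge0//.
  by rewrite ler_norml a1 a2.
have kaP : k * a ^+ 2 <= k * P ^+ 2 * m ^+ 2 by rewrite -mulrA ler_wpM2l.
(* An increment [tau] far below its linear part [a] satisfies the claim outright. Otherwise tau = a
   + O(|h|^2), and k tau^2 differs from k a^2 by O(|h|^3) only. *)
have [taulo|taulo] := ltP tau (a - C * m ^+ 2).
  have : g * tau <= g * (a - C * m ^+ 2) by rewrite ler_wpM2l// ltW.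
  have : 1 / 2 * (C * m ^+ 2) <= g * (C * m ^+ 2) by rewrite ler_wpM2r// mulr_ge0// ltW.
  rewrite /C; have : 0 <= d * m ^+ 2 by rewrite mulr_ge0// ltW.
  by lra.
have tauhi : tau <= a + C * m ^+ 2.
  have : 0 <= k * tau ^+ 2 by rewrite mulr_ge0 ?sqr_ge0.
  move=> ktau; rewrite -(ler_pM2l g0) mulrDr.
  have : 1 / 2 * (C * m ^+ 2) <= g * (C * m ^+ 2) by rewrite ler_wpM2r// mulr_ge0// ltW.
  rewrite /C; have : 0 <= d * m ^+ 2 by rewrite mulr_ge0// ltW.
  have : 0 <= k * P ^+ 2 * m ^+ 2 by rewrite mulr_ge0.
  by lra.
have : k * (a ^+ 2 - tau ^+ 2) <= d / 4 * m ^+ 2.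
  have hm : m ^+ 2 <= m by rewrite expr2; nra.
  have h1 : (a - tau) * (a + tau) <= C * m ^+ 2 * (m * (2 * P + C)).
    apply: (le_trans (ler_norm _)); rewrite normrM; apply: ler_pM => //.
      by rewrite ler_norml; apply/andP; split; lra.
    have Cm : C * m ^+ 2 <= C * m by rewrite ler_wpM2l// ltW.
    by rewrite ler_norml; apply/andP; split; lra.
  apply: (@le_trans _ _ (k * (C * m ^+ 2 * (m * (2 * P + C))))).
    by rewrite ler_wpM2l// (_ : a ^+ 2 - tau ^+ 2 = (a - tau) * (a + tau))//; ring.
  have -> : k * (C * m ^+ 2 * (m * (2 * P + C))) = m * (k * C * (2 * P + C)) * m ^+ 2 by ring.
  have Q0 : 0 <= k * C * (2 * P + C) by rewrite !mulr_ge0//; lra.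
  by rewrite ler_wpM2r//; apply: le_trans r22; rewrite ler_wpM2r// ltW.
rewrite -(expr2 a) mulrBr; have : 0 <= d * m ^+ 2 by rewrite mulr_ge0// ltW.
by lra.
Qed.

(** The difference quotient 1 + k (a + b) lies between 1 / 2 and 3 / 2. *)
Lemma quadratic_change k M a b : 0 <= k -> 4 * k * M <= 1 -> `|a| <= M -> `|b| <= M ->
  a <= b -> a + k * a ^+ 2 <= b + k * b ^+ 2 <= a + k * a ^+ 2 + 3 / 2 * (b - a).
Proof.
rewrite !ler_norml => k0 kM /andP[a1 a2] /andP[b1 b2] ab.
have h1 : k * (a + b) <= 1 / 2.
  by have : k * (a + b) <= k * (M + M) by [rewrite ler_wpM2l//; lra]; lra.
have h2 : - (1 / 2) <= k * (a + b).
  by have : k * (- M - M) <= k * (a + b) by [rewrite ler_wpM2l//; lra]; lra.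
have -> : b + k * b ^+ 2 = a + k * a ^+ 2 + (b - a) * (1 + k * (a + b)) by ring.
by apply/andP; split; nra.
Qed.

(** The supremum runs over balls instead of carrying a quadratic penalty, and the convex change s +
    k s^2 is built in; where that change is increasing, a maximum point of [w] realizes it. *)
Definition sup_convolution eps k (w : V -> R) x : R :=
  sup [set w z + k * w z ^+ 2 | z in cball x eps].

Section Properties.
Variables (eta eps L k : R) (w : V -> R).
Hypotheses (eta01 : 0 < eta <= 1) (eps01 : 0 < eps <= 1 / 8) (L0 : 0 <= L)
  (etaeps : eta * eps <= 1 / 160) (kE : k = 400 * eta) (kL : 4 * k * L <= 1)
  (sw : subsol eta (eball 0 1) w) (cw : econt (eball 0 1) w)
  (wL : forall x y, eball 0 1 x -> eball 0 1 y -> w x <= w y + L * enorm (x - y))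
  (wM : forall x, eball 0 1 x -> `|w x| <= L)
  (steep : forall x, eball 0 (7 / 8) x -> exists2 z, cball x eps z & eps / 2 <= w z - w x).

Let T := sup_convolution eps k w.

Let k0 : 0 <= k. Proof. by rewrite kE; have /andP[? ?] := eta01; lra. Qed.

Let sub x : eball 0 (7 / 8) x -> cball x eps `<=` eball 0 1.
Proof.
move=> hx y; move: hx; rewrite /eball/cball/= => hx hy; have := enorm_tri y x 0.
by have /andP[? ?] := eps01; lra.
Qed.

Let sup_conv_ub x z : eball 0 (7 / 8) x -> cball x eps z -> w z + k * w z ^+ 2 <= T x.
Proof.
move=> hx hz; apply: sup_upper_bound; last by exists z.
split; first by exists (w z + k * w z ^+ 2), z.
exists (L + k * L ^+ 2) => _ [y hy <-]; have := wM _ (sub _ hx _ hy) => hM.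
have /andP[_ h2] : - L <= w y <= L by rewrite -ler_norml.
apply: lerD => //; rewrite ler_wpM2l//.
by rewrite -(real_normK (num_real (w y))) ler_pXn2r// nnegrE.
Qed.

Let sup_conv_attained x : eball 0 (7 / 8) x -> exists z,
  [/\ cball x eps z, forall y, cball x eps y -> w y <= w z & T x = w z + k * w z ^+ 2].
Proof.
move=> hx; have /andP[eps0 _] := eps01.
have [z zx zm] := cball_argmax _ _ _ (ltW eps0) (econt_sub _ _ _ (sub _ hx) cw).
exists z; split=> //; apply/eqP; rewrite eq_le sup_conv_ub// andbT.
apply: ge_sup; first by exists (w z + k * w z ^+ 2), z.
move=> _ [y hy <-]; have Az := sub _ hx _ zx; have Ay := sub _ hx _ hy.
by have /andP[] := quadratic_change k L _ _ k0 kL (wM _ Ay) (wM _ Az) (zm _ hy).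
Qed.

Lemma sup_convolution_bounds x : eball 0 (7 / 8) x ->
  w x <= T x <= w x + L * eps + k * L ^+ 2.
Proof.
move=> hx; have /andP[eps0 _] := eps01.
have xx : cball x eps x by rewrite /cball/= subrr enorm0 ltW.
have := sup_conv_ub _ _ hx xx; have kw : 0 <= k * w x ^+ 2 by rewrite mulr_ge0 ?sqr_ge0.
move=> h1; apply/andP; split; first lra.
have [z [zx _ ->]] := sup_conv_attained _ hx.
have Az := sub _ hx _ zx; have Ax := sub _ hx _ xx.
have := wL _ _ Az Ax; have : L * enorm (z - x) <= L * eps by rewrite ler_wpM2l.
have : k * w z ^+ 2 <= k * L ^+ 2.
  by rewrite ler_wpM2l// -(real_normK (num_real (w z))) ler_pXn2r// ?nnegrE// wM.
by lra.
Qed.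

Lemma sup_convolution_cont : econt (eball 0 (7 / 8)) T.
Proof.
apply: (@econt_lipschitz _ _ _ _ (3 / 2 * L)); first by rewrite mulr_ge0.
move=> x y hx hy; have [z [zx _ ->]] := sup_conv_attained _ hx.
have zy : cball y eps (z + (y - x)).
  rewrite /cball/= (_ : z + (y - x) - y = z - x)//.
  by apply/rowP => i; rewrite !mxE; ring.
have Az := sub _ hx _ zx; have Az' := sub _ hy _ zy.
have := sup_conv_ub _ _ hy zy; set z' := z + (y - x) in zy Az' *.
have := wL _ _ Az Az'; have -> : z - z' = x - y by apply/rowP => i; rewrite !mxE; ring.
have e0 := enorm_ge0 (x - y).
have Le : 0 <= L * enorm (x - y) by rewrite mulr_ge0.
have [zz|zz] := leP (w z) (w z').
  by have /andP[] := quadratic_change k L _ _ k0 kL (wM _ Az) (wM _ Az') zz; lra.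
by have /andP[] := quadratic_change k L _ _ k0 kL (wM _ Az') (wM _ Az) (ltW zz); lra.
Qed.

(** A jet of [T] at [x] is a jet of w + k w^2 at the maximum point, where the slope of [w] is at
    least 1 / 4. The gain k / 256 with k = 400 eta beats the loss of at most 3 / 2 eta, since 400 /
    256 > 3 / 2. *)
Lemma sup_convolution_subsol : subsol 0 (eball 0 (7 / 8)) T.
Proof.
move=> x p' X' hx J; have [z [zx zm Tz]] := sup_conv_attained _ hx; rewrite oppr0.
have /andP[eps0 eps1] := eps01.
have Jz : upper_jet (fun y => w y + k * w y ^+ 2) z p' X'.
  apply: (jet_touch _ _ _ _ _ _ J); exists (7 / 8 - enorm (x - 0)).
    by move: hx; rewrite /eball/=; lra.
  move=> h hh; rewrite Tz lerD2r; apply: sup_conv_ub.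
    by move: hh; rewrite /eball/= !subr0; have := enormD x h; lra.
  by rewrite /cball/= (_ : z + h - (x + h) = z - x)//; apply/rowP => i; rewrite !mxE; ring.
have Az := sub _ hx _ zx; have kL' := kL.
have wz := wM _ Az; have wz' := wz; move: wz'; rewrite ler_norml => /andP[wz1 wz2].
have g1 : 1 / 2 <= 1 + 2 * k * w z.
  by have : k * - L <= k * w z by [rewrite ler_wpM2l]; lra.
have g2 : 1 + 2 * k * w z <= 3 / 2.
  by have : k * w z <= k * L by [rewrite ler_wpM2l]; lra.
have := jet_convex_change k w z p' X' k0 g1 Jz => /=.
set g := 1 + 2 * k * w z in g1 g2 *.
have [p pE] : exists p, p = g^-1 *: p' by eexists.
rewrite -pE => Jw.
have [y xy wy] := steep _ hx.
have wzx : eps / 2 <= w z - w x by have := zm _ xy; lra.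
have /andP[eta0 _] := eta01.
have gr := growth_before_max _ _ _ _ _ eta0 eps0 etaeps sw cw (sub _ hx) zx zm wzx.
have p14 := steep_jet _ _ _ _ _ _ _ eta01 eps0 L0 sw cw wL Az gr Jw.
have := sw _ _ _ Az Jw.
have g0 : 0 < g by lra.
have -> : p' = g *: p by rewrite pE scalerA mulfV ?gt_eqF// scale1r.
rewrite bilZm bilDm bilNm bilZm bil_rank1 !enormE bilZl bilZr.
set P := enorm p in p14 *; set B := bil X' p p => h.
have {}h : - eta * g <= B - k * (P ^+ 2 * P ^+ 2).
  have := ler_wpM2l (ltW g0) h; rewrite [g * (g^-1 * _)]mulrA mulfV ?gt_eqF// mul1r.
  by lra.
have P2 : 1 / 16 <= P ^+ 2 by rewrite expr2; nra.
have P4 : 1 / 256 <= P ^+ 2 * P ^+ 2 by nra.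
have kP : k * (1 / 256) <= k * (P ^+ 2 * P ^+ 2) by rewrite ler_wpM2l.
have eg : eta * g <= eta * (3 / 2) by rewrite ler_pM2l.
by rewrite !mulr_ge0 ?(ltW g0)//; move: kP; rewrite kE in h *; lra.
Qed.

End Properties.

(** The sup-convolutions of [w] and [- w] exceed these functions by at most c = L eps + k L^2.
    Lowered by [c], they yield ordered barriers on both sides of [w]; growth and decay at scale
    [eps] make both of them admissible. *)
Theorem steep_harmonic_approx eta eps L (w : V -> R) :
  0 < eta <= 1 -> 0 < eps <= 1 / 8 -> 0 <= L -> eta * eps <= 1 / 160 ->
  1600 * eta * L <= 1 ->
  sol eta (eball 0 1) w -> econt (eball 0 1) w ->
  (forall x y, eball 0 1 x -> eball 0 1 y -> w x <= w y + L * enorm (x - y)) ->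
  (forall x, eball 0 1 x -> `|w x| <= L) ->
  (forall x, eball 0 (7 / 8) x -> exists2 z, cball x eps z & eps / 2 <= w z - w x) ->
  (forall x, eball 0 (7 / 8) x -> exists2 z, cball x eps z & eps / 2 <= w x - w z) ->
  exists h : V -> R, [/\ sol 0 (eball 0 (7 / 8)) h, econt (eball 0 (7 / 8)) h &
    forall x, eball 0 (7 / 8) x -> `|w x - h x| <= L * eps + 400 * eta * L ^+ 2].
Proof.
move=> eta01 eps01 L0 etaeps etaL [sw1 sw2] cw wL wM st1 st2.
have [k kE] : exists k, k = 400 * eta by eexists.
rewrite -kE; have kL : 4 * k * L <= 1 by rewrite kE; lra.
pose T1 := sup_convolution eps k w; pose T2 := sup_convolution eps k (fun x => - w x).
set c := L * eps + k * L ^+ 2.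
have wL' x y : eball 0 1 x -> eball 0 1 y -> - w x <= - w y + L * enorm (x - y).
  by move=> hx hy; have := wL y x hy hx; rewrite enormB; lra.
have wM' x : eball 0 1 x -> `|- w x| <= L by rewrite normrN; exact: wM.
have st2' x : eball 0 (7 / 8) x -> exists2 z, cball x eps z & eps / 2 <= - w z - - w x.
  by move=> /st2[z zx h]; exists z => //; lra.
have cw' := econtN _ _ cw.
have b1 x (hx : eball 0 (7 / 8) x) :=
  sup_convolution_bounds _ _ _ _ _ eta01 eps01 L0 kE kL cw wL wM x hx.
have b2 x (hx : eball 0 (7 / 8) x) :=
  sup_convolution_bounds _ _ _ _ _ eta01 eps01 L0 kE kL cw' wL' wM' x hx.
have shift (f : V -> R) A : subsol 0 A f -> subsol 0 A (fun x => f x - c).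
  move=> sf y p X Ay J; apply: sf Ay _; apply: jet_touch J _; exists 1 => // h _; lra.
have [||||||h [h1 h2 h3]] := @perron R n 0 (7 / 8) (L + c)
    (fun x => T1 x - c) (fun x => - (T2 x - c)).
- exact/shift/(sup_convolution_subsol _ _ _ _ _ eta01 eps01 L0 etaeps kE kL sw1 cw wL wM st1).
- under eq_fun do rewrite opprK.
  exact/shift/(sup_convolution_subsol _ _ _ _ _ eta01 eps01 L0 etaeps kE kL sw2 cw' wL' wM' st2').
- apply: econtD; last exact: econt_cst.
  exact: (sup_convolution_cont _ _ _ _ _ eta01 eps01 L0 kE kL cw wL wM).
- apply: econtN; apply: econtD; last exact: econt_cst.
  exact: (sup_convolution_cont _ _ _ _ _ eta01 eps01 L0 kE kL cw' wL' wM').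
-  move=> x hx; have /andP[? ?] := b1 x hx; have := b2 x hx; rewrite /= => /andP[? ?]; rewrite /= /T1 /T2 /c; lra.
- move=> x hx; have /andP[? ?] := b1 x hx; have := b2 x hx; rewrite /= => /andP[? ?].
  have : `|w x| <= L by apply: wM; move: hx; rewrite /eball/=; lra.
  by rewrite !ler_norml => /andP[? ?]; rewrite /= /T1 /T2 /c; split; apply/andP; split; lra.
exists h; split=> // x hx.
have /andP[? ?] := b1 x hx; have := b2 x hx; rewrite /= => /andP[? ?]; have /andP[] := h3 x hx.
rewrite /T1 /T2 -/c ler_norml => g1 g2; rewrite /c in g1 g2 *.
by apply/andP; split; lra.
Qed.

End SupConvolution.

(** * Affine approximation of solutions with small right-hand side *)

Section Flatness.
Context {R : realType} {n : nat}.
Local Notation V := 'rV[R]_n.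
Implicit Types (p q x y z v : V) (r s t d eps : R).

(** The regularity hypothesis enters everything below only in this form. *)
Definition flat_estimate (a C : R) := forall y (rho M : R) (h : V -> R),
  0 < rho -> 0 < M -> sol 0 (eball y rho) h -> econt (eball y rho) h ->
  (forall x, eball y rho x -> `|h x| <= M) ->
  exists p, forall x, enorm (x - y) < rho / 2 ->
    `|h x - h y - dot p (x - y)| <= C * M / rho * (enorm (x - y) * (enorm (x - y) / rho) `^ a).

Lemma dot_bound p r (B : R) : 0 < r -> (forall v, enorm v <= r -> `|dot p v| <= B) ->
  enorm p <= B / r.
Proof.
move=> r0 H; rewrite ler_pdivlMr//; have [->|p0] := eqVneq p 0.
  rewrite enorm0 mul0r; apply: le_trans (H 0 _); first exact: normr_ge0.
  by rewrite enorm0 ltW.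
have pn := enorm_gt0 _ p0.
have := H ((r / enorm p) *: p); rewrite enormZ gtr0_norm ?divr_gt0// divfK ?gt_eqF//.
move=> /(_ (lexx _)); rewrite dotZr enormE expr2 mulrA divfK ?gt_eqF//.
by rewrite gtr0_norm ?mulr_gt0// mulrC.
Qed.

Lemma powR_small (a c : R) : 0 < a -> 0 < c ->
  exists t, 0 < t <= 1 / 4 /\ forall s, 0 <= s <= t -> s `^ a <= c.
Proof.
move=> a0 c0; have ct : 0 < c `^ a^-1 by rewrite powR_gt0.
exists (Num.min (1 / 4) (c `^ a^-1)); split.
  by rewrite lt_min ge_min ct lexx /= andbT; lra.
move=> s /andP[s0]; rewrite le_min => /andP[_ sc].
have -> : c = (c `^ a^-1) `^ a by rewrite -powRrM mulVf ?gt_eqF// powRr1// ltW.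
by apply: ge0_ler_powR => //; rewrite ?nnegrE ?powR_ge0// ltW.
Qed.

Lemma powR_scale (a c s : R) : 0 <= a <= 1 -> 1 <= c -> 0 <= s -> (s * c) `^ a <= c * s `^ a.
Proof.
move=> /andP[a0 a1] c1 s0; rewrite powRM//; last lra.
rewrite mulrC ler_wpM2r ?powR_ge0//.
by rewrite -[leRHS]powRr1 ?ler_powR//; lra.
Qed.

Lemma expr_powR (s a : R) k : 0 <= s -> (s ^+ k) `^ a = (s `^ a) ^+ k.
Proof.
move=> s0; elim: k => [|k IH]; first by rewrite !expr0 powR1.
by rewrite !exprS powRM ?exprn_ge0// IH.
Qed.

Lemma half_small t : 0 < t -> exists k, (1 / 2) ^+ k <= t.
Proof.
move=> t0; have ti : 0 < t^-1 by rewrite invr_gt0.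
exists (Num.truncn t^-1).+1.
rewrite div1r exprVn -[leRHS]invrK lef_pV2 ?posrE ?exprn_gt0//.
have /ltW h := truncnS_gt t^-1; apply: (le_trans h).
by rewrite -natrX ler_nat ltnW// ltn_expl.
Qed.

Theorem almost_harmonic_flat (a C : R) : 0 < a <= 1 -> 0 < C -> flat_estimate a C ->
  forall d, 0 < d -> exists2 eta, 0 < eta <= 1 &
  forall w : V -> R, econt (eball 0 1) w -> sol eta (eball 0 1) w ->
    (forall x, eball 0 1 x -> `|w x| <= 1) ->
  exists p, forall x, enorm x < 3 / 8 ->
    `|w x - w 0 - dot p x| <= 4 * C * (enorm x * enorm x `^ a) + d.
Proof.
move=> /andP[a0 a1] C0 flat d d0.
(* The bound 1 gives |h| <= 2; d / 2 is used because the distance to [h] enters at [x] and at 0. *)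
pose d' := Num.min 1 (d / 2).
have d'0 : 0 < d' by rewrite lt_min; apply/andP; split; lra.
have d'1 : d' <= 1 by rewrite ge_min lexx.
have d'2 : d' <= d / 2 by rewrite ge_min lexx orbT.
have [eta eta01 H] := @almost_harmonic_approx R n d' d'0.
exists eta => // w cw sw w1; have [h [sh ch wh]] := H w cw sw w1.
have r0 : (0 : R) < 3 / 4 by lra.
have [x hx|p hp] := flat 0 (3 / 4) 2 h r0 ltac:(lra) sh ch.
  have hx' : cball 0 (3 / 4) x by exact: ltW.
  have /w1 : eball 0 1 x by move: hx; rewrite /eball/=; lra.
  by have := wh x hx'; rewrite !ler_norml => /andP[? ?] /andP[? ?]; apply/andP; split; lra.
exists p => x hx.
have := hp x; rewrite subr0 => /(_ ltac:(lra)).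
have x0 := enorm_ge0 x.
have : (enorm x / (3 / 4)) `^ a <= 4 / 3 * enorm x `^ a.
  have -> : enorm x / (3 / 4) = enorm x * (4 / 3) by field.
  by apply: powR_scale => //; [rewrite (ltW a0)|lra].
have P0 := powR_ge0 (enorm x) a.
move: (_ `^ a) (enorm x `^ a) P0 => P Q Q0 PQ.
have whx : `|w x - h x| <= d' by apply: wh; rewrite /cball/= subr0; lra.
have wh0 : `|w 0 - h 0| <= d' by apply: wh; rewrite /cball/= subrr enorm0; lra.
have XP : enorm x * P <= enorm x * (4 / 3 * Q) by rewrite ler_wpM2l.
have CXP : C * (enorm x * P) <= C * (enorm x * (4 / 3 * Q)) by rewrite ler_wpM2l// ltW.
have CXQ : 0 <= C * (enorm x * Q) by rewrite mulr_ge0 ?mulr_ge0// ltW.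
have -> : C * 2 / (3 / 4) = C * (8 / 3) by field.
move: whx wh0; rewrite !ler_norml => /andP[? ?] /andP[? ?] /andP[? ?].
by apply/andP; split; lra.
Qed.

End Flatness.

(** * Degenerate scales and the choice of a bad pair *)

Section Slopes.
Context {R : realType} {n : nat}.
Local Notation V := 'rV[R]_n.
Implicit Types (p q x y z v : V) (r s t d eps : R) (w : V -> R).

(** One alternative suffices for flatness, so its negation supplies both the growth and the decay
    needed for the two barriers. *)
Definition flat_at w y r : Prop :=
  (forall x, cball y r x -> w x - w y < r / 2) \/
  (forall x, cball y r x -> w y - w x < r / 2).

Definition bad_pair w y r : Prop := [/\ 0 < r < 1 / 4, enorm y < 1 / 2 & flat_at w y r].

(* Almost maximizing [sqrt r - |y|] over the bad pairs gives a bad pair [(y, eps)] around which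
   the scale of bad pairs grows at most quadratically with the distance. *)
Lemma select_bad_pair w r0 : bad_pair w 0 r0 -> exists y eps,
  [/\ bad_pair w y eps, enorm y <= Num.sqrt eps &
      forall z r, bad_pair w z r -> r <= 8 * eps + 2 * enorm (z - y) ^+ 2].
Proof.
move=> bad0; pose E := [set t | exists y r, bad_pair w y r /\ t = Num.sqrt r - enorm y].
have r00 : 0 < r0 by have [/andP[]] := bad0.
have E0 : E (Num.sqrt r0) by exists 0, r0; split=> //; rewrite enorm0 subr0.
have supE : has_sup E.
  split; first by exists (Num.sqrt r0).
  exists 1 => _ [y [r [[/andP[r1 r2] _ _] ->]]].
  have : Num.sqrt r <= 1 by rewrite -sqrtr1 ler_sqrt//; lra.
  by have := enorm_ge0 y; lra.
(* With this slack the chosen pair has value at least half of sqrt r0. Hence |y| <= sqrt eps, and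
   the slack itself is at most sqrt eps, which gives sqrt r <= 2 sqrt eps + |z - y| for every bad
   pair. *)
have s0 : 0 < Num.sqrt r0 / 2 by rewrite divr_gt0// sqrtr_gt0.
have [_ [y [eps [by_ ->]]] ht] := sup_adherent s0 supE.
have h1 := sup_upper_bound supE E0.
exists y, eps; split=> //; first by lra.
move=> z r bz; have h2 : Num.sqrt r - enorm z <= sup E.
  by apply: sup_upper_bound => //; exists z, r.
have h3 := enorm_sub_ge z y; have y0 := enorm_ge0 y; have zy0 := enorm_ge0 (z - y).
have se0 : 0 <= Num.sqrt eps := sqrtr_ge0 _.
have h4 : Num.sqrt r <= 2 * Num.sqrt eps + enorm (z - y) by lra.
have r0' : 0 <= r by have [/andP[/ltW]] := bz.
have e0' : 0 <= eps by have [/andP[/ltW]] := by_.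
rewrite -(sqr_sqrtr r0') -[X in 8 * X](sqr_sqrtr e0').
apply: (@le_trans _ _ ((2 * Num.sqrt eps + enorm (z - y)) ^+ 2)).
  by rewrite ler_pXn2r// ?nnegrE ?sqrtr_ge0//; lra.
by have := sqr_ge0 (2 * Num.sqrt eps - enorm (z - y)); rewrite !sqrrD; lra.
Qed.

Lemma not_flat_at w y r : ~ flat_at w y r ->
  (exists2 x, cball y r x & r / 2 <= w x - w y) /\
  (exists2 x, cball y r x & r / 2 <= w y - w x).
Proof.
move=> /not_orP[h1 h2]; split.
  by move/existsNP: h1 => [x /not_implyP[xy /negP]]; rewrite -leNgt; exists x.
by move/existsNP: h2 => [x /not_implyP[xy /negP]]; rewrite -leNgt; exists x.
Qed.

(* The window is the ball of radius [R = 8^-k] around [y]: by the last hypothesis, slopes in it are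
   bounded below at the scale [9 eps + 3 R^2]. *)
Lemma window_flat (a C eta eps : R) w y (k : nat) :
  0 < a <= 1 -> 0 < C -> @flat_estimate R n a C ->
  0 < eta <= 1 / (200 * 1000) -> 0 < eps -> 200 * eps <= (1 / 8) ^+ k -> (2 <= k)%N ->
  enorm y <= 1 / 8 ->
  sol eta (eball 0 1) w -> econt (eball 0 1) w ->
  (forall x z, cball 0 (7 / 8) x -> cball 0 (7 / 8) z -> w x <= w z + 72 * enorm (x - z)) ->
  (forall z r, bad_pair w z r -> r <= 8 * eps + 2 * enorm (z - y) ^+ 2) ->
  exists p, forall z, enorm (z - y) <= (1 / 16) ^+ k ->
    `|w z - w y - dot p (z - y)| <=
    (140 * C + 1400) * ((1 / 16) ^+ k * ((1 / 2) ^+ k) `^ a + eps).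
Proof.
move=> /andP[a0 a1] C0 flat /andP[eta0 eta1] eps0 Neps k2 hy sw cw wL hbad.
have [r rE] : exists r, r = (1 / 8 : R) ^+ k by eexists.
have [s sE] : exists s, s = (1 / 2 : R) ^+ k by eexists.
have r0 : 0 < r by rewrite rE exprn_gt0.
have s0 : 0 < s by rewrite sE exprn_gt0.
have r64 : r <= 1 / 64.
  rewrite rE (_ : 1 / 64 = (1 / 8) ^+ 2); last by field.
  by rewrite ler_iXn2l//; lra.
have s4 : s <= 1 / 4.
  rewrite sE (_ : 1 / 4 = (1 / 2) ^+ 2); last by field.
  by rewrite ler_iXn2l//; lra.
have rs : (1 / 16) ^+ k = r * s.
  by rewrite rE sE -exprMn; congr (_ ^+ k); field.
have rss : r = s * s * s.
  by rewrite rE sE -!exprMn; congr (_ ^+ k); field.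
rewrite -rE in Neps; rewrite rs -sE; clear rE sE rs.
have subB : eball y r `<=` cball 0 (7 / 8).
  move=> z; rewrite /eball/cball/= subr0 => hz; have := enorm_sub_ge z y; lra.
have subB1 : eball y r `<=` eball 0 1.
  by move=> z /subB; rewrite /cball/eball/=; lra.
have rn : r != 0 by rewrite gt_eqF.
(* Equal factors for domain and values preserve slopes and multiply the right-hand side by [r]. *)
pose w' x := r^-1 * (w (y + r *: x) - w y).
have sw' : sol (eta * r) (eball 0 1) w'.
  have := sol_rescale _ _ _ _ (w y) w r0 r0 (solS _ _ _ _ _ subB1 (lexx eta) sw).
  by rewrite (_ : eta * r ^+ 4 / r ^+ 3 = eta * r)//; field.
have cw' : econt (eball 0 1) w'.
  exact: (econt_rescale _ _ _ _ _ r0 r0 (econt_sub _ _ _ subB1 cw)).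
have inB x : eball 0 1 x -> eball y r (y + r *: x).
  by rewrite /eball/= subr0 [y + _]addrC addrK enormZ gtr0_norm// => ?; rewrite gtr_pMr.
have yB : cball 0 (7 / 8) y by rewrite /cball/= subr0; lra.
have wE x : w (y + r *: x) = w y + r * w' x.
  by rewrite /w' mulrA mulfV// mul1r [RHS]addrC subrK.
have w'0 : w' 0 = 0 by rewrite /w' scaler0 addr0 subrr mulr0.
have wL' x z : eball 0 1 x -> eball 0 1 z -> w' x <= w' z + 72 * enorm (x - z).
  move=> /inB/subB hx /inB/subB hz; rewrite -(ler_pM2l r0).
  have := wL _ _ hx hz; rewrite !wE opprD addrACA subrr add0r -scalerBr enormZ gtr0_norm//.
  by move: (w' x) (w' z) => *; lra.
clearbody w'.
have wM' x : eball 0 1 x -> `|w' x| <= 72.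
  move=> Bx; have B0 : eball (0 : V) 1 0 by rewrite /eball/= subrr enorm0.
  have := wL' _ _ Bx B0; have := wL' _ _ B0 Bx.
  rewrite enormB subr0 w'0.
  move: Bx; rewrite /eball/= subr0 ler_norml => *.
  by apply/andP; split; lra.
(* In window units; eb r = 9 eps + 3 r^2 exceeds every bad scale in the window, since these are at
   most 8 eps + 2 r^2. *)
have [eb ebE] : exists eb, eb = 9 * eps / r + 3 * r by eexists.
have ebr : eb * r = 9 * eps + 3 * r ^+ 2 by rewrite ebE; field.
have er : eps / r <= 1 / 200 by rewrite ler_pdivrMr//; lra.
have er0 : 0 < eps / r by rewrite divr_gt0.
have eb0 : 0 < eb by rewrite ebE -mulrA; lra.
have eb8 : eb <= 1 / 8 by rewrite ebE -mulrA; lra.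
have steep x : eball 0 (7 / 8) x -> ~ flat_at w (y + r *: x) (eb * r).
  move=> hx fl; have hx1 : eball 0 1 x by move: hx; rewrite /eball/=; lra.
  have yx := inB x hx1.
  have : bad_pair w (y + r *: x) (eb * r).
    split=> //.
      have ebr8 : eb * r <= 1 / 8 * (1 / 64) by rewrite ler_pM// ltW.
      by rewrite mulr_gt0//=; lra.
    move: yx; rewrite /eball/=; have := enorm_sub_ge (y + r *: x) y; lra.
  move=> /hbad; rewrite ebr.
  have : enorm (y + r *: x - y) ^+ 2 <= r ^+ 2.
    by rewrite ler_pXn2r// ?nnegrE ?enorm_ge0 ?(ltW r0)//; exact: ltW.
  have : 0 < r ^+ 2 by rewrite exprn_gt0.
  by clear -eps0; lra.
have steep1 (sg : bool) x : eball 0 (7 / 8) x ->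
    exists2 z, cball x eb z & eb / 2 <= (-1) ^+ sg * (w' z - w' x).
  move=> /steep/not_flat_at[[z1 h11 h12] [z2 h21 h22]].
  pose z := if sg then z2 else z1.
  have zz : cball (y + r *: x) (eb * r) z by rewrite /z; case: (sg).
  have wz : eb * r / 2 <= (-1) ^+ sg * (w z - w (y + r *: x)).
    by rewrite /z; case: (sg); rewrite ?expr1 ?expr0 ?mul1r ?mulN1r ?opprB.
  exists (r^-1 *: (z - y)).
    rewrite /cball/= -(ler_pM2r r0); apply: le_trans zz.
    rewrite mulrC -{1}(gtr0_norm r0) -enormZ scalerBr scalerA mulfV// scale1r.
    by rewrite opprD addrA.
  have := wE (r^-1 *: (z - y)); rewrite rescale_point// => wz'.
  rewrite -(ler_pM2r r0); move: wz; rewrite wz' wE.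
  by rewrite addrAC opprD addrA subrr add0r -mulrN -mulrDr; move: (_ ^+ _) => *; lra.
have er1 : 0 < eta * r <= 1.
  by rewrite mulr_gt0//=; have : eta * r <= 1 / (200 * 1000) * (1 / 64) by [rewrite ler_pM// ltW]; clear; lra.
have er2 : eta * r <= 1 / (200 * 1000) * r by rewrite ler_wpM2r// ltW.
have [||||||h [sh ch wh]] := @steep_harmonic_approx R n (eta * r) eb 72 w' er1 _ _ _ _ sw' cw' wL' wM'.
- by rewrite eb0 eb8.
- by clear; lra.
- have : eta * r * eb <= 1 / (200 * 1000) * 1 * 1.
    have er3 : eta * r <= 1 / (200 * 1000) * 1 by clear -er2 r64 r0; lra.
    apply: ler_pM => //; [by case/andP: er1 => /ltW|exact: ltW|clear -eb8; lra].
  by clear; lra.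
- by lra.
- by move=> x /(steep1 false)[z]; rewrite expr0 mul1r; exists z.
- by move=> x /(steep1 true)[z]; rewrite expr1 mulN1r opprB; exists z.
(* With Lipschitz constant 72, 72 eb is 648 eps / r + 216 r, and the bound on [eta] makes the
   remaining term at most 11 r. *)
have {}wh x : eball 0 (7 / 8) x -> `|w' x - h x| <= 700 * (eps / r + r).
  move=> /wh /le_trans; apply; rewrite ebE.
  by rewrite -[9 * eps / r]mulrA; clear -er2 er0 r0; lra.
clear er1 er2 steep1 steep eb8 eb0 ebr ebE wL wL' inB subB subB1 sw cw sw' cw' hbad Neps yB hy eta0 eta1.
have h78 : (0 : R) < 7 / 8 by clear; lra.
have [|p hp] := flat 0 (7 / 8) 100 h h78 ltac:(lra) sh ch.
  move=> x hx; have hx1 : eball 0 1 x by move: hx; rewrite /eball/=; lra.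
  have := wh x hx; have := wM' x hx1; rewrite !ler_norml => /andP[? ?] /andP[? ?].
  by apply/andP; split; lra.
exists p => z hz.
have [x zx] : exists x, y + r *: x = z.
  by exists (r^-1 *: (z - y)); exact: rescale_point.
have zy : z - y = r *: x by rewrite -zx addrC addKr.
have xs : enorm x <= s.
  by move: hz; rewrite zy enormZ gtr0_norm// ler_pM2l.
have x0 := enorm_ge0 x.
have := hp x; rewrite subr0 => /(_ ltac:(lra)).
have B0 : eball (0 : V) (7 / 8) 0 by rewrite /eball/= subrr enorm0.
have Bx : eball (0 : V) (7 / 8) x by rewrite /eball/= subr0; lra.
have := wh 0 B0; have := wh x Bx.
rewrite w'0.
have wzE : w z - w y = r * w' x by rewrite -zx wE addrAC subrr add0r.
rewrite wzE zy dotZr -mulrBr normrM gtr0_norm//.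
have g1 : (enorm x / (7 / 8)) `^ a <= 8 / 7 * s `^ a.
  apply: (@le_trans _ _ ((s * (8 / 7)) `^ a)).
    apply: ge0_ler_powR => //; rewrite ?nnegrE.
    - exact: ltW.
    - by rewrite divr_ge0//; clear; lra.
    - by rewrite mulr_ge0//; clear -s0; lra.
    - rewrite (_ : enorm x / (7 / 8) = enorm x * (8 / 7)); last by field.
      by rewrite ler_wpM2r//; clear; lra.
  by apply: powR_scale; rewrite ?(ltW a0)//; clear -s0; lra.
have sQs : s <= s `^ a.
  by rewrite ger1_powR ?s0//; clear -s4; lra.
have Q0 := powR_ge0 s a; move: (s `^ a) ((enorm x / (7 / 8)) `^ a) Q0 (powR_ge0 (enorm x / (7 / 8)) a) g1 sQs.
move=> Q P Q0 P0 g1 sQs.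
have g2 : enorm x * P <= s * (8 / 7 * Q) by rewrite ler_pM.
have g3 : C * (enorm x * P) <= C * (s * (8 / 7 * Q)) by rewrite ler_wpM2l// ltW.
have sQ : 0 <= C * (s * Q).
  by apply: mulr_ge0; [exact: ltW|apply: mulr_ge0; [exact: ltW|]].
rewrite (_ : C * 100 / (7 / 8) = C * (800 / 7)); last by field.
rewrite !ler_norml => /andP[b1 b2] /andP[b3 b4] /andP[b5 b6].
have wx : `|w' x - dot p x| <= 140 * (C * (s * Q)) + 1400 * (eps / r + r).
  by rewrite ler_norml; apply/andP; clear -b1 b2 b3 b4 b5 b6 g3 sQ; split; lra.
apply: (le_trans (ler_wpM2l (ltW r0) wx)).
have -> : r * (140 * (C * (s * Q)) + 1400 * (eps / r + r)) =
  140 * C * (r * s * Q) + 1400 * eps + 1400 * (r * r) by field.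
(* The window error r^2 = r s^3 is absorbed by r s s^a because s^2 <= s <= s^a. *)
have rsQ : r * r <= r * (s * Q).
  rewrite ler_wpM2l ?(ltW r0)// rss -mulrA ler_wpM2l ?(ltW s0)//.
  by apply: le_trans sQs; rewrite ler_piMr ?(ltW s0)//; clear -s4; lra.
have Ce : 0 <= C * eps by rewrite mulr_ge0// ltW.
by clear -rsQ Ce; lra.
Qed.

End Slopes.

(** * Nearly affine solutions of slope one are not critical *)

Section Nondegeneracy.
Context {R : realType} {n : nat}.
Local Notation V := 'rV[R]_n.
Implicit Types (p q x y z v e : V) (r s t d eps : R) (w : V -> R).

Definition approx_affine w y r (B : R) p : Prop :=
  forall z, enorm (z - y) <= r -> `|w z - w y - dot p (z - y)| <= B.

(** Vanishing derivative as o(|h|), a form that rescales directly. *)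
Definition critical_at w x : Prop := forall s, 0 < s -> exists2 r, 0 < r &
  forall h, enorm h < r -> `|w (x + h) - w x| <= s * enorm h.

(** Consecutive affine approximations, compared on the smaller ball, give |p' - p| <= K (17 q^j + 2
    eps / r), with 17 = 16 + 1. The first terms sum geometrically in [q]; the second grow by 16 and
    are controlled by the last one, with factor 2 (16 / 15). *)
Lemma slopes_telescope (K q eps : R) w y k0 p0 k : 0 < K -> 0 < q < 1 -> 0 < eps -> (k0 <= k)%N ->
  (forall j, (k0 <= j <= k)%N -> exists p,
     approx_affine w y ((1 / 16) ^+ j) (K * ((1 / 16) ^+ j * q ^+ j + eps)) p) ->
  approx_affine w y ((1 / 16) ^+ k0) (K * ((1 / 16) ^+ k0 * q ^+ k0 + eps)) p0 ->
  exists p, approx_affine w y ((1 / 16) ^+ k) (K * ((1 / 16) ^+ k * q ^+ k + eps)) p /\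
    enorm (p - p0) <= 17 * K * (q ^+ k0 - q ^+ k) / (1 - q) + 32 / 15 * K * eps / (1 / 16) ^+ k.
Proof.
move=> K0 /andP[q0 q1] eps0 kk H A0; elim: k kk H => [|k IH] kk H.
  move: kk; rewrite leqn0 => /eqP k00; rewrite k00 in A0 *; exists p0; split=> //.
  by rewrite !subrr enorm0 mulr0 mul0r add0r divr_ge0// !mulr_ge0// ltW.
have [k0k|k0k] := eqVneq k0 k.+1.
  exists p0; rewrite -k0k !subrr enorm0 mulr0 mul0r add0r; split=> //.
  by rewrite divr_ge0 ?exprn_ge0// !mulr_ge0// ltW.
have {}kk : (k0 <= k)%N by rewrite -ltnS ltn_neqAle k0k.
have [|p [pA pp0]] := IH kk.
  by move=> j /andP[j1 j2]; apply: H; rewrite j1 ltnW.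
have [p' p'A] := H k.+1 ltac:(by rewrite leqnn (leq_trans kk)).
exists p'; split=> //.
have [r rE] : exists r, r = (1 / 16 : R) ^+ k.+1 by eexists.
have r0 : 0 < r by rewrite rE exprn_gt0.
have rk : (1 / 16) ^+ k = 16 * r by rewrite rE exprS; field.
rewrite -rE in p'A *; rewrite rk in pA pp0.
have [Q QE] : exists Q, Q = q ^+ k by eexists.
have Q0 : 0 < Q by rewrite QE exprn_gt0.
rewrite exprS -QE in p'A *; rewrite -QE in pA pp0.
have : enorm (p' - p) <= K * (17 * r * Q + 2 * eps) / r.
  apply: dot_bound => // v vr.
  have g1 := pA (y + v); have g2 := p'A (y + v).
  rewrite addrAC subrr add0r in g1 g2.
  have {}g1 := g1 ltac:(lra); have {}g2 := g2 vr.
  have qQ : K * (r * (q * Q)) <= K * (r * Q).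
    by rewrite !ler_pM2l// ler_piMl// ltW.
  rewrite dotDl dotNl; move: g1 g2; rewrite !ler_norml => /andP[? ?] /andP[? ?].
  by apply/andP; split; lra.
have -> : K * (17 * r * Q + 2 * eps) / r = 17 * K * Q + 2 * K * eps / r.
  by field; rewrite gt_eqF.
move=> pp'; apply: (le_trans (enorm_tri _ p _)); apply: (le_trans (lerD pp' pp0)).
rewrite le_eqVlt; apply/orP; left; apply/eqP.
by field; rewrite !gt_eqF// subr_gt0.
Qed.

Lemma lipschitz_twice eta w : 0 <= eta <= 1 -> sol eta (eball 0 1) w -> econt (eball 0 1) w ->
  (forall x, eball 0 1 x -> `|w x| <= 2) ->
  forall x z, cball 0 (7 / 8) x -> cball 0 (7 / 8) z -> w x <= w z + 72 * enorm (x - z).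
Proof.
move=> /andP[eta0 eta1] sw cw wM x z hx hz.
pose w' x := 2^-1 * (w (0 + 1 *: x) - 0).
have w'E y : w' y = 2^-1 * w y by rewrite /w' scale1r add0r subr0.
have [sw' _] := sol_rescale _ _ _ _ 0 _ ltr01 (ltr0n R 2) sw.
have cw' := econt_rescale _ _ _ 0 _ ltr01 (ltr0n R 2) cw.
have := interior_lipschitz _ _ _ sw' cw' _ x z hx hz.
rewrite !scale1r !add0r !subr0 expr1n => H.
suff : 2^-1 * w x <= 2^-1 * w z + 36 * enorm (x - z) by lra.
apply: H.
  apply/andP; split; first by rewrite divr_ge0// mulr1.
  by rewrite mulr1 ler_pdivrMr//; lra.
move=> y hy; rewrite scale1r add0r subr0 normrM gtr0_norm//.
by have := wM y hy; lra.
Qed.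

(** The constants are chosen backwards: [t] depends on [C], the drift budget [b] on [t], the ratio
    [N] of the last telescoping radius to [eps] on [b] and [t], and the compactness accuracy [d] on
    [N]. None depends on [eps], which is known only after [w] is given. *)
Theorem near_affine_not_critical (a C : R) : 0 < a <= 1 -> 0 < C -> @flat_estimate R n a C ->
  exists eta d0, [/\ 0 < eta <= 1, 0 < d0 &
  forall w e, econt (eball 0 1) w -> sol eta (eball 0 1) w -> enorm e = 1 ->
    (forall x, eball 0 1 x -> `|w x - dot e x| <= d0) ->
    ~ critical_at w 0].
Proof.
move=> a01 C0 flat; have /andP[a0 a1] := a01.
pose q : R := (1 / 2) `^ a.
have q0 : 0 < q by rewrite powR_gt0.
have q1 : q < 1.
  have E : (1 : R) `^ a = 1 by rewrite powR1.
  by rewrite -[ltRHS]E; apply: gt0_ltr_powR => //; rewrite ?nnegrE//; lra.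
have [K KE] : exists K, K = 140 * C + 1400 by eexists.
have K0 : 0 < K by rewrite KE; lra.
have [K' K'E] : exists K', K' = 17 * K / (1 - q) + 4 * K by eexists.
have K'0 : 0 < K' by rewrite K'E addr_gt0 ?divr_gt0 ?mulr_gt0// subr_gt0.
(* Up to radius [t] the C^(1,a) error, multiplied by the normalizing factor 72, is at most a
   sixteenth of the radius. *)
have [|t [/andP[t0 t4] ht]] := powR_small a (1 / (72 * 64 * C)) a0.
  by rewrite divr_gt0// !mulr_gt0.
have {}ht s : 0 <= s <= t -> 72 * (4 * C * s `^ a) <= 1 / 16.
  move=> /ht; rewrite ler_pdivlMr ?mulr_gt0// => h; rewrite ler_pdivlMr//; lra.
have [b [b0 b1 b2]] : exists b, [/\ 0 < b, K' * b <= 1 / 16 & K * b <= t / 32].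
  exists (Num.min (1 / 16 / K') (t / 32 / K)); split.
  - by rewrite lt_min !divr_gt0.
  - by rewrite mulrC -ler_pdivlMr// ge_min lexx.
  - by rewrite mulrC -ler_pdivlMr// ge_min lexx orbT.
have [k0 [k02 qk0]] : exists k0, (2 <= k0)%N /\ q ^+ k0 <= b / 2.
  have [|s [/andP[s0 _] hs]] := powR_small a (b / 2) a0; first by rewrite divr_gt0.
  have [k hk] := half_small s s0; exists (maxn 2 k); split; first exact: leq_maxl.
  rewrite /q -expr_powR; last by lra.
  apply: hs; apply/andP; split; first by apply: exprn_ge0; lra.
  apply: le_trans hk.
  by rewrite ler_iXn2l ?leq_maxr//; lra.
have [N [N200 Nb Nt]] : exists N, [/\ 200 <= N, 1 / N <= b / 2 & 1 / N <= t].
  have ti : 0 < 1 / t by rewrite divr_gt0.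
  have bi : 0 < 2 / b by rewrite divr_gt0.
  have [N NE] : exists N, N = 200 + 1 / t + 2 / b by eexists.
  have N0 : 0 < N by rewrite NE; lra.
  exists N; split; first by rewrite NE; lra.
  - have : 2 / b * b = 2 by rewrite divfK ?gt_eqF.
    rewrite ler_pdivrMr// => bb; have : b * (2 / b) <= b * N by rewrite ler_pM2l// NE; lra.
    by lra.
  - have : 1 / t * t = 1 by rewrite divfK ?gt_eqF.
    rewrite ler_pdivrMr// => bb; have : t * (1 / t) <= t * N by rewrite ler_pM2l// NE; lra.
    by lra.
have N0 : 0 < N by lra.
have [d [d_gt0 d1 d2]] : exists d, [/\ 0 < d, 72 * d <= t / 32 & 72 * d <= 1 / (16 * (16 * N))].
  have c1 : 0 < t / 32 / 72 by clear -t0; lra.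
  have c2 : 0 < 1 / (16 * (16 * N)) / 72.
    by clear -N0; apply: divr_gt0; [apply: divr_gt0; [lra|apply: mulr_gt0; lra]|lra].
  exists (Num.min (t / 32 / 72) (1 / (16 * (16 * N)) / 72)); split.
  - by rewrite lt_min c1 c2.
  - by rewrite mulrC -ler_pdivlMr// ge_min lexx.
  - by rewrite mulrC -ler_pdivlMr// ge_min lexx orbT.
have [etaF /andP[etaF0 etaF1] hF] := almost_harmonic_flat a C a01 C0 flat d d_gt0.
have [eta [eta0 eta1 eta2]] : exists eta, [/\ 0 < eta, eta <= etaF & eta <= 1 / (200 * 1000)].
  exists (Num.min etaF (1 / (200 * 1000))); split.
  - have c0 : (0 : R) < 1 / (200 * 1000) by clear; lra.
    by rewrite lt_min etaF0 c0.
  - by rewrite ge_min lexx.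
  - by rewrite ge_min lexx orbT.
have [r0 r0E] : exists r0, r0 = (1 / 16 : R) ^+ k0 by eexists.
have r00 : 0 < r0 by rewrite r0E exprn_gt0.
have r01 : r0 <= 1 / 256.
  rewrite r0E (_ : 1 / 256 = (1 / 16) ^+ 2); last by field.
  by rewrite ler_iXn2l//; clear; lra.
(* Bad scales turn out to be below 4 d0, so this value places [N] times the chosen scale below the
   starting radius [r0]. *)
have [d0 d0E] : exists d0, d0 = r0 / (4 * N) by eexists.
have d0N : d0 * (4 * N) = r0 by rewrite d0E divfK// gt_eqF// mulr_gt0.
have d00 : 0 < d0 by rewrite d0E divr_gt0// mulr_gt0.
have d0r : 2 * d0 <= r0 / 16 by clear -d0N N200 d00; nra.
have d01 : d0 <= 1 / 256 by clear -d0r r01; lra.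
have eta01' : 0 <= eta <= 1 by rewrite (ltW eta0)/=; clear -eta1 etaF1; lra.
exists eta, d0; split=> //; first by rewrite eta0/=; clear -eta1 etaF1; lra.
move=> w e cw sw e1 we Dw.
have eta01 : 0 < eta <= 1 / (200 * 1000) by rewrite eta0.
have wM x : eball 0 1 x -> `|w x| <= 2.
  move=> Bx; have := we x Bx; have := cauchy_schwarz_abs e x; rewrite e1 mul1r.
  move: Bx; rewrite /eball/= subr0 !ler_norml => x1 /andP[g1 g2] /andP[g3 g4].
  by apply/andP; clear -x1 g1 g2 g3 g4 d01; split; lra.
have wL := lipschitz_twice _ _ eta01' sw cw wM.
have [rr [rr0 rr4 bad0]] : exists r, [/\ 0 < r, r < 1 / 4 & flat_at w 0 r].
  have [r r_gt0 hr] := Dw (1 / 4) ltac:(clear; lra).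
  exists (Num.min (r / 2) (1 / 8)); split.
  - by rewrite lt_min divr_gt0//; clear; lra.
  - by rewrite gt_min (_ : 1 / 8 < 1 / 4) ?orbT//; clear; lra.
  - left=> x; rewrite /cball/= subr0 => hx.
    have m1 : Num.min (r / 2) (1 / 8) <= r / 2 by rewrite ge_min lexx.
    have m0 : 0 < Num.min (r / 2) (1 / 8) by rewrite lt_min divr_gt0//; clear; lra.
    have xr : enorm x < r by clear -hx m1 r_gt0; lra.
    by have := hr x xr; rewrite add0r ler_norml => /andP[_]; clear -hx m0; lra.
(* Moving from [z] by r e and by - r e, [w] rises and falls by at least r - 2 d0; flatness at scale
   [r] needs one of these to be below r / 2. *)
have badr z r : bad_pair w z r -> r < 4 * d0.
  move=> [/andP[r_gt0 r4] z2 fl].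
  have B1 (sg : R) : `|sg| = 1 -> eball 0 1 (z + (sg * r) *: e).
    move=> sg1; rewrite /eball/= subr0; have := enormD z ((sg * r) *: e).
    by rewrite enormZ normrM sg1 e1 gtr0_norm//; clear -r4 z2; lra.
  have Bz : eball 0 1 z by rewrite /eball/= subr0; clear -z2; lra.
  have H (sg : R) : `|sg| = 1 -> cball z r (z + (sg * r) *: e) /\
      `|w (z + (sg * r) *: e) - w z - sg * r| <= 2 * d0.
    move=> sg1; rewrite /cball/= addrAC subrr add0r enormZ normrM sg1 e1 gtr0_norm//.
    split; first by rewrite mul1r mulr1.
    have := we _ (B1 _ sg1); have := we _ Bz.
    rewrite dotDr dotZr enormE e1 expr1n !ler_norml => /andP[g1 g2] /andP[g3 g4].
    by apply/andP; clear -g1 g2 g3 g4; split; lra.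
  have [g1 g2] := H 1 (normr1 _); have [g3 g4] := H (-1) (normrN1 _).
  move: g2 g4; rewrite !ler_norml => /andP[h1 h2] /andP[h3 h4].
  by case: fl => [/(_ _ g1)|/(_ _ g3)]; clear -h1 h2 h3 h4; lra.
have [|y [eps [bady yeps hbad]]] := select_bad_pair w rr.
  by split=> //; [rewrite rr0|rewrite enorm0; clear; lra].
have eps4 := badr _ _ bady.
have [/andP[eps0 _] _ fly] := bady.
have y8 : enorm y <= 1 / 8.
  have E : (1 / 8 : R) = Num.sqrt (1 / 64).
    rewrite (_ : 1 / 64 = (1 / 8) ^+ 2 :> R); last by field.
    by rewrite sqrtr_sqr ger0_norm//; clear; lra.
  apply: (le_trans yeps); rewrite E ler_sqrt//.
  by clear -d0r r01 eps4; lra.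
have Neps : eps * N <= r0 by clear -eps4 d0N N0; nra.
have win k : (2 <= k)%N -> eps * N <= (1 / 16) ^+ k -> exists p,
     approx_affine w y ((1 / 16) ^+ k) (K * ((1 / 16) ^+ k * q ^+ k + eps)) p.
  move=> k2 Nk.
  have : 200 * eps <= (1 / 8) ^+ k.
    have : (1 / 16) ^+ k <= (1 / 8 : R) ^+ k by rewrite lerXn2r// ?nnegrE; clear; lra.
    by clear -Nk N200 eps0; nra.
  move=> N8; have [p hp] := window_flat a C eta eps w y k a01 C0 flat eta01 eps0 N8 k2 y8 sw cw wL hbad.
  by exists p => z hz; have := hp z hz; rewrite expr_powR// -/q -KE.
(* The last radius 16^-m still above N eps; it is below 16 N eps, so the ratio to [eps] is
   bounded. *)
have [m [k0m mN mN']] : exists m, [/\ (k0 <= m)%N, eps * N <= (1 / 16) ^+ m &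
    (1 / 16) ^+ m.+1 < eps * N].
  have eN0 : 0 < eps * N by rewrite mulr_gt0.
  have [j hj] : exists j, (1 / 16 : R) ^+ j < eps * N.
    have [j hj] := half_small (eps * N / 2) ltac:(rewrite divr_gt0//).
    exists j; apply: le_lt_trans (_ : eps * N / 2 < _); last by clear -eN0; lra.
    by apply: le_trans hj; rewrite lerXn2r// ?nnegrE; clear; lra.
  have ex : exists j, (1 / 16 : R) ^+ j < eps * N by exists j.
  case: (ex_minnP ex) => -[|m] hm hmin.
    by move: hm; rewrite expr0 => hm; exfalso; clear -hm Neps r01; lra.
  have mN : eps * N <= (1 / 16) ^+ m.
    by rewrite leNgt; apply/negP => /hmin; rewrite ltnn.
  exists m; split=> //; rewrite leqNgt; apply/negP => mk0.
  have : (1 / 16) ^+ k0 <= (1 / 16 : R) ^+ m.+1 by rewrite ler_iXn2l//; clear; lra.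
  by rewrite -r0E; clear -hm Neps; lra.
have m2 : (2 <= m)%N := leq_trans k02 k0m.
have [rho rhoE] : exists rho, rho = (1 / 16 : R) ^+ m by eexists.
have rho0 : 0 < rho by rewrite rhoE exprn_gt0.
have rhoN : rho < 16 * (eps * N).
  by move: mN'; rewrite exprS -rhoE; clear; lra.
have rho_r0 : rho <= r0 by rewrite rhoE r0E ler_iXn2l//; clear; lra.
have dec j : (j <= m)%N -> eps * N <= (1 / 16) ^+ j.
  by move=> jm; apply: (le_trans mN); rewrite ler_iXn2l//; clear; lra.
have [p0 p0A] := win k0 k02 (dec _ k0m).
have q01 : 0 < q < 1 by rewrite q0.
have [|p [pA pp0]] := slopes_telescope K q eps w y k0 p0 m K0 q01 eps0 k0m _ p0A.
  by move=> j /andP[j1 j2]; apply: win; [exact: leq_trans k02 j1|exact: dec].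
have qm : q ^+ m <= q ^+ k0 by rewrite ler_iXn2l// ltW.
have qm0 : 0 <= q ^+ m by rewrite exprn_ge0// ltW.
have eN j : (j <= m)%N -> eps / (1 / 16) ^+ j <= 1 / N.
  by move=> /dec ejN; rewrite ler_pdivrMr ?exprn_gt0// mulrC mulrA mulr1 ler_pdivlMr.
have qN : q ^+ k0 + 1 / N <= b by clear -qk0 Nb; lra.
have p0e : enorm (p0 - e) <= K * b + 1 / 16.
  have r00' : 0 < (1 / 16 : R) ^+ k0 by rewrite -r0E.
  have : enorm (p0 - e) <= (K * (r0 * q ^+ k0 + eps) + 2 * d0) / r0.
    apply: dot_bound => // v vr.
    have := p0A (y + v); rewrite addrAC subrr add0r -r0E => /(_ vr).
    have By : eball 0 1 y by rewrite /eball/= subr0; clear -y8; lra.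
    have Byv : eball 0 1 (y + v).
      by rewrite /eball/= subr0; have := enormD y v; clear -y8 vr r01; lra.
    have := we _ By; have := we _ Byv; rewrite dotDr dotDl dotNl !ler_norml.
    move=> /andP[g1 g2] /andP[g3 g4] /andP[g5 g6].
    by apply/andP; clear -g1 g2 g3 g4 g5 g6; split; lra.
  move=> h; apply: (le_trans h).
  have -> : (K * (r0 * q ^+ k0 + eps) + 2 * d0) / r0 = K * (q ^+ k0 + eps / r0) + 2 * d0 / r0.
    by field; rewrite gt_eqF.
  have := eN k0 k0m; rewrite -r0E => h1.
  apply: lerD; last by rewrite ler_pdivrMr//; clear -d0r; lra.
  by rewrite ler_pM2l//; clear -h1 qN; lra.
have pe : enorm (p - e) <= 1 / 8.
  have : enorm (p - p0) <= K' * b - 2 * K * b.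
    apply: (le_trans pp0); rewrite K'E.
    have i0 : 0 < 1 / (1 - q) by rewrite divr_gt0// subr_gt0.
    have : 17 * K * (q ^+ k0 - q ^+ m) / (1 - q) <= 17 * K / (1 - q) * (q ^+ k0).
      rewrite -mulrA [_ / (1 - q)]mulrC mulrA ler_pM2l ?divr_gt0 ?mulr_gt0 ?subr_gt0//.
      by clear -qm0; lra.
    have : 32 / 15 * K * eps / (1 / 16) ^+ m <= 32 / 15 * K * (1 / N).
      by rewrite -mulrA ler_pM2l ?eN// mulr_gt0.
    have : 17 * K / (1 - q) * q ^+ k0 <= 17 * K / (1 - q) * b.
      rewrite ler_pM2l ?divr_gt0 ?mulr_gt0 ?subr_gt0//; clear -qk0 b0; lra.
    have : K * (1 / N) <= K * (b / 2) by rewrite ler_pM2l.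
    have Kb : 0 < K * b by rewrite mulr_gt0.
    by clear -Kb; lra.
  have := enorm_tri p p0 e; clear -p0e b1 b0 K0.
  have Kb : 0 < K * b by rewrite mulr_gt0.
  by lra.
have S0 : 0 < 72 * rho by rewrite mulr_gt0.
have yr x : eball 0 1 x -> cball 0 (7 / 8) (y + rho *: x).
  rewrite /eball/cball/= !subr0 => x1; have := enormD y (rho *: x).
  rewrite enormZ gtr0_norm//; have : rho * enorm x <= rho * 1 by rewrite ler_pM2l// ltW.
  by clear -y8 rho_r0 r01; lra.
have sub1 : eball y rho `<=` eball 0 1.
  move=> x; rewrite /eball/= subr0 => hx; have := enorm_sub_ge x y.
  by clear -hx y8 rho_r0 r01; lra.
(* The Lipschitz constant 72 makes this rescaling bounded by 1, as the compactness result
   requires. *)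
pose w' x := (72 * rho)^-1 * (w (y + rho *: x) - w y).
have sw' : sol etaF (eball 0 1) w'.
  apply: solS (sol_rescale _ _ _ _ (w y) _ rho0 S0 (solS _ _ _ _ _ sub1 (lexx eta) sw)) => //.
  apply: le_trans eta1.
  rewrite (_ : eta * rho ^+ 4 / (72 * rho) ^+ 3 = eta * (rho / (72 ^+ 3))); last first.
    by field; rewrite gt_eqF.
  rewrite ler_piMr ?(ltW eta0)// ler_pdivrMr ?exprn_gt0// mul1r.
  have : (1 : R) <= 72 ^+ 3 by rewrite exprn_ege1// ler1n.
  by clear -rho_r0 r01; lra.
have cw' : econt (eball 0 1) w' := econt_rescale _ _ _ _ _ rho0 S0 (econt_sub _ _ _ sub1 cw).
have w'E x : w (y + rho *: x) - w y = rho * (72 * w' x).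
  by rewrite /w'; field; rewrite gt_eqF.
have w'0 : w' 0 = 0 by rewrite /w' scaler0 addr0 subrr mulr0.
have wM' x : eball 0 1 x -> `|w' x| <= 1.
  move=> Bx; have B0 : eball (0 : V) 1 0 by rewrite /eball/= subrr enorm0.
  have h1 := wL _ _ (yr _ Bx) (yr _ B0); have h2 := wL _ _ (yr _ B0) (yr _ Bx).
  rewrite scaler0 addr0 enormB addrAC subrr add0r enormZ gtr0_norm// in h2.
  rewrite scaler0 addr0 addrAC subrr add0r enormZ gtr0_norm// in h1.
  have := w'E x => E.
  have x1 : rho * enorm x <= rho * 1.
    by rewrite ler_pM2l//; move: Bx; rewrite /eball/= subr0 => /ltW.
  have g1 : - (72 * rho) <= rho * (72 * w' x) by rewrite -E; clear -h1 h2 x1; lra.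
  have g2 : rho * (72 * w' x) <= 72 * rho by rewrite -E; clear -h1 h2 x1; lra.
  by rewrite ler_norml; apply/andP; split; rewrite -(ler_pM2l S0); clear -g1 g2; lra.
clearbody w'.
have [pt hpt] := hF w' cw' sw' wM'.
have {}hpt x : enorm x <= t -> `|72 * w' x - 72 * dot pt x| <= enorm x / 16 + 72 * d.
  move=> xt; have x0 := enorm_ge0 x.
  have := hpt x ltac:(clear -xt t4; lra); rewrite w'0 subr0 => h.
  have := ht (enorm x) ltac:(by rewrite x0); move=> h2.
  have h3 : enorm x * (72 * (4 * C * enorm x `^ a)) <= enorm x * (1 / 16) by rewrite ler_wpM2l.
  by move: h; rewrite !ler_norml => /andP[g1 g2]; apply/andP; clear -h3 g1 g2; split; lra.
have ptp : enorm (72 *: pt - p) <= 1 / 8.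
  have : enorm (72 *: pt - p) <= (t / 8) / t.
    apply: dot_bound => // v vt.
    have rv : enorm (rho *: v) <= rho.
      by rewrite enormZ gtr0_norm// ler_piMr ?(ltW rho0)//; clear -vt t4; lra.
    have := pA (y + rho *: v); rewrite -rhoE addrAC subrr add0r => /(_ rv).
    rewrite dotZr w'E -mulrBr normrM gtr0_norm//.
    have : K * (rho * q ^+ m + eps) <= rho * (K * b).
      rewrite (_ : rho * (K * b) = K * (rho * b)); last by ring.
      rewrite ler_pM2l//.
      have := eN m (leqnn m); rewrite -rhoE ler_pdivrMr// => h1.
      have : rho * (q ^+ m + 1 / N) <= rho * b by rewrite ler_pM2l//; clear -qm qN; lra.
      by clear -h1; lra.
    move=> h1 h2; have := le_trans h2 h1; rewrite ler_pM2l// => h3.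
    have := hpt v vt; rewrite dotDl dotNl dotZl.
    move: h3; rewrite !ler_norml => /andP[g1 g2] /andP[g3 g4].
    have vt' : enorm v / 16 <= t / 16 by clear -vt; lra.
    by apply/andP; clear -d1 b2 vt' g1 g2 g3 g4; split; lra.
  by rewrite mulrAC divff ?gt_eqF// mul1r.
(* The scale [eps] in units of rho. It exceeds 1 / (16 N), so the accuracy [d] is still negligible
   there. *)
have [tau tauE] : exists tau, tau = eps / rho by eexists.
have tau0 : 0 < tau by rewrite tauE divr_gt0.
have tauN : tau <= 1 / N by rewrite tauE rhoE eN.
have taut : tau <= t := le_trans tauN Nt.
have taud : 72 * d <= tau / 16.
  apply: (le_trans d2); rewrite tauE ler_pdivrMr; last by rewrite !mulr_gt0.
  rewrite (_ : eps / rho / 16 * _ = eps * (16 * N) / rho); last by field; rewrite gt_eqF.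
  by rewrite ler_pdivlMr// mul1r; clear -rhoN; lra.
have rt : rho * tau = eps by rewrite tauE mulrC divfK// gt_eqF.
have key (sg : R) : `|sg| = 1 -> `|72 * w' ((sg * tau) *: e) - sg * tau| <= 3 / 8 * tau.
  move=> sg1.
  have en : enorm ((sg * tau) *: e) = tau by rewrite enormZ normrM sg1 e1 gtr0_norm// mul1r mulr1.
  have := hpt ((sg * tau) *: e); rewrite en => /(_ taut) h1.
  have h2 : `|dot (72 *: pt - e) ((sg * tau) *: e)| <= 1 / 4 * tau.
    apply: (le_trans (cauchy_schwarz_abs _ _)); rewrite en ler_pM2r//.
    by have := enorm_tri (72 *: pt) p e; clear -ptp pe; lra.
  move: h2; rewrite dotDl dotNl dotZl (dotZr _ e e) enormE e1 expr1n mulr1 => h2.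
  move: h1 h2; rewrite !ler_norml => /andP[g1 g2] /andP[g3 g4].
  by apply/andP; clear -g1 g2 g3 g4 taud; split; lra.
have pt_in (sg : R) : `|sg| = 1 -> cball y eps (y + rho *: ((sg * tau) *: e)).
  move=> sg1; rewrite /cball/= addrAC subrr add0r scalerA enormZ e1 !normrM sg1.
  by rewrite (gtr0_norm rho0) (gtr0_norm tau0) mulr1 mul1r rt.
have := key 1 (normr1 _); have := key (-1) (normrN1 _).
rewrite !ler_norml => /andP[_ k1] /andP[k2 _].
(* The slope is within 1 / 4 of [e], and the errors add 1 / 8: along e and - e the function rises
   and falls by at least 5 / 8 eps, against the eps / 2 of both alternatives. *)
case: fly => [/(_ _ (pt_in 1 (normr1 _)))|/(_ _ (pt_in (-1) (normrN1 _)))].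
  rewrite w'E -rt.
  have : rho * (5 / 8 * tau) <= rho * (72 * w' ((1 * tau) *: e)).
    by rewrite ler_pM2l//; clear -k2; lra.
  by have : 0 < rho * tau by [rewrite mulr_gt0]; clear; lra.
rewrite -opprB w'E -rt.
have : rho * (72 * w' ((-1 * tau) *: e)) <= rho * (- (5 / 8) * tau).
  by rewrite ler_pM2l//; clear -k1; lra.
by have : 0 < rho * tau by [rewrite mulr_gt0]; clear; lra.
Qed.

End Nondegeneracy.

(** * Improvement of flatness and its iteration *)

Section Decay.
Context {R : realType} {n : nat}.
Local Notation V := 'rV[R]_n.
Implicit Types (p q x y z v e : V) (r s t d eps : R) (w : V -> R).

Lemma critical_rescale w y (rho S c : R) : 0 < rho -> 0 < S -> critical_at w y ->
  critical_at (fun x => S^-1 * (w (y + rho *: x) - c)) 0.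
Proof.
move=> r0 S0 cw s s0; have [r r_gt0 hr] := cw (s * S / rho) ltac:(rewrite divr_gt0// mulr_gt0//).
exists (r / rho); first by rewrite divr_gt0.
move=> h hh; rewrite add0r scaler0 addr0 -mulrBr opprB addrA subrK.
have := hr (rho *: h); rewrite enormZ gtr0_norm// mulrC -ltr_pdivlMr// => /(_ hh).
rewrite normrM gtr0_norm ?invr_gt0// => H.
rewrite mulrC ler_pdivrMr//; apply: (le_trans H).
by rewrite le_eqVlt; apply/orP; left; apply/eqP; field; rewrite gt_eqF.
Qed.

Lemma improve_flatness (ahat a C : R) : 0 < ahat < a -> a <= 1 -> 0 < C ->
  @flat_estimate R n a C ->
  exists rho eta, [/\ 0 < rho <= 1 / 4, 0 < eta <= 1 &
  forall w, econt (eball 0 1) w -> sol eta (eball 0 1) w ->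
    (forall x, eball 0 1 x -> `|w x| <= 1) -> w 0 = 0 -> critical_at w 0 ->
    forall x, enorm x <= rho -> `|w x| <= rho * rho `^ ahat].
Proof.
move=> /andP[ah0 aha] a1 C0 flat.
have a0 : 0 < a := lt_trans ah0 aha.
have a01 : 0 < a <= 1 by rewrite a0.
have [eta1 [d0 [/andP[eta10 eta11] d00 nondeg]]] := near_affine_not_critical a C a01 C0 flat.
have [||rho [/andP[rho0 rho4] hrho]] := powR_small (a - ahat) (1 / (16 * C)).
- by rewrite subr_gt0.
- by rewrite divr_gt0// mulr_gt0.
have [P PE] : exists P, P = rho `^ ahat by eexists.
have P0 : 0 < P by rewrite PE powR_gt0.
have rhoa : 4 * C * rho `^ a <= P / 4.
  have -> : rho `^ a = rho `^ (a - ahat) * P.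
    by rewrite PE -powRD ?subrK// gt_eqF ?implybT.
  have := hrho rho; rewrite (ltW rho0) lexx => /(_ isT).
  rewrite ler_pdivlMr ?mulr_gt0// => h.
  have : rho `^ (a - ahat) * (16 * C) * P <= 1 * P by rewrite ler_pM2r.
  by clear; lra.
(* For a slope |p| > P / 2, on the ball of radius [t] the distance to the affine part, divided by t
   |p|, is at most [d0]; half of it comes from the C^(1,a) error and half from [d]. *)
have [t [/andP[t0 t4] ht]] := powR_small a (d0 * P / (16 * C)) a0 ltac:(rewrite divr_gt0 ?mulr_gt0//).
have ta : 4 * C * t `^ a <= d0 * P / 4.
  have := ht t; rewrite (ltW t0) lexx => /(_ isT).
  by rewrite ler_pdivlMr ?mulr_gt0//; clear; lra.
have [d [d_gt0 d1 d2]] : exists d, [/\ 0 < d, d <= rho * P / 4 & d <= d0 * P / 4 * t].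
  exists (Num.min (rho * P / 4) (d0 * P / 4 * t)); split.
  - by rewrite lt_min; apply/andP; split; [rewrite divr_gt0 ?mulr_gt0|rewrite !mulr_gt0 ?divr_gt0 ?mulr_gt0].
  - by rewrite ge_min lexx.
  - by rewrite ge_min lexx orbT.
have [etaF /andP[etaF0 etaF1] hF] := almost_harmonic_flat a C a01 C0 flat d d_gt0.
have P3 : 0 < (P / 2) ^+ 3 by rewrite exprn_gt0// divr_gt0.
(* Normalizing by t |p| multiplies the right-hand side by t / |p|^3, hence the factor (P / 2)^3. *)
have [eta [eta0 etaF' eta1']] : exists eta, [/\ 0 < eta, eta <= etaF & eta <= eta1 * (P / 2) ^+ 3].
  exists (Num.min etaF (eta1 * (P / 2) ^+ 3)); split.
  - by rewrite lt_min etaF0 mulr_gt0.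
  - by rewrite ge_min lexx.
  - by rewrite ge_min lexx orbT.
exists rho, eta; split; [by rewrite rho0|by rewrite eta0 (le_trans etaF')|].
move=> w cw sw w1 w00 crit x xrho; rewrite -PE.
have [p hp] := hF w cw (solS _ _ _ _ _ (@subset_refl _ _) etaF' sw) w1.
have {}hp y (s : R) : enorm y <= s -> s <= 1 / 4 -> `|w y - dot p y| <= s * (4 * C * s `^ a) + d.
  move=> ys s4; have := hp y ltac:(clear -ys s4; lra); rewrite w00 subr0 => h.
  apply: (le_trans h); rewrite lerD2r mulrCA; apply: ler_pM => //; rewrite ?enorm_ge0//.
    by rewrite !mulr_ge0 ?powR_ge0// ltW.
  apply: ler_wpM2l; first by rewrite mulr_ge0// ltW.
  have y0 := enorm_ge0 y.
  by apply: ge0_ler_powR => //; rewrite ?nnegrE ?(ltW a0)//; apply: le_trans ys.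
(* A small slope contributes P / 2 and the two errors P / 4 each, which add up to P rho. *)
have [pP|pP] := leP (enorm p) (P / 2).
  have := hp x rho xrho rho4; have := cauchy_schwarz_abs p x.
  have : enorm p * enorm x <= P / 2 * rho by rewrite ler_pM ?enorm_ge0.
  have : rho * (4 * C * rho `^ a) <= rho * (P / 4) by rewrite ler_pM2l.
  rewrite !ler_norml => g1 g2 /andP[g3 g4] /andP[g5 g6].
  by apply/andP; clear -g1 g2 g3 g4 g5 g6 d1; split; lra.
have p0 : 0 < enorm p by apply: lt_trans pP; rewrite divr_gt0.
have S0 : 0 < t * enorm p by rewrite mulr_gt0.
have sub1 : eball (0 : V) t `<=` eball 0 1.
  by move=> y; rewrite /eball/=; clear -t4; lra.
have := nondeg (fun y => (t * enorm p)^-1 * (w (0 + t *: y) - 0)) ((enorm p)^-1 *: p).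
case.
- exact: (econt_rescale _ _ _ _ _ t0 S0 (econt_sub _ _ _ sub1 cw)).
- apply: solS (sol_rescale _ _ _ _ 0 _ t0 S0 (solS _ _ _ _ _ sub1 (lexx eta) sw)) => //.
  rewrite (_ : eta * t ^+ 4 / (t * enorm p) ^+ 3 = eta / enorm p ^+ 3 * t); last first.
    by field; rewrite !gt_eqF.
  have : eta / enorm p ^+ 3 <= eta1.
    rewrite ler_pdivrMr ?exprn_gt0//; apply: (le_trans eta1'); rewrite ler_pM2l//.
    by rewrite lerXn2r// ?nnegrE ltW// divr_gt0.
  have : 0 < eta / enorm p ^+ 3 by rewrite divr_gt0// exprn_gt0.
  by clear -t0 t4; nra.
- by rewrite enormZ gtr0_norm ?invr_gt0// mulVf// gt_eqF.
- move=> y y1; rewrite add0r subr0.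
  have yt : enorm (t *: y) <= t.
    rewrite enormZ gtr0_norm// ler_piMr ?(ltW t0)//.
    by move: y1; rewrite /eball/= subr0 => /ltW.
  have := hp (t *: y) t yt t4.
  rewrite (_ : _ * _ - _ = (t * enorm p)^-1 * (w (t *: y) - dot p (t *: y))); last first.
    by rewrite dotZl dotZr; field; rewrite !gt_eqF.
  move=> h; rewrite normrM gtr0_norm ?invr_gt0// mulrC ler_pdivrMr//; apply: (le_trans h).
  have : t * (4 * C * t `^ a) <= t * (d0 * P / 4) by rewrite ler_pM2l.
  have : d0 * (t * (P / 2)) <= d0 * (t * enorm p) by rewrite !ler_pM2l// ltW.
  by clear -d2; lra.
- exact: (critical_rescale w 0 t _ 0 t0 S0 crit).
Qed.

(** Domain and values both start at scale [r0], so that the rescaled right-hand side carries the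
    factor [r0] that makes it small, while the powers of rho contribute a factor of at most one. *)
Lemma decay_iteration (ahat rho eta m kappa Cf r0 : R) w x0 :
  0 < ahat -> 0 <= m -> 0 <= kappa -> ahat * (3 - (m + kappa)) <= 1 + m ->
  0 < rho <= 1 / 4 -> 0 < eta <= 1 -> 0 <= Cf ->
  (forall w, econt (eball 0 1) w -> sol eta (eball 0 1) w ->
    (forall x, eball 0 1 x -> `|w x| <= 1) -> w 0 = 0 -> critical_at w 0 ->
    forall x, enorm x <= rho -> `|w x| <= rho * rho `^ ahat) ->
  0 < r0 <= 1 -> Cf * r0 <= eta -> econt (eball x0 r0) w -> w x0 = 0 -> critical_at w x0 ->
  (forall r S, 0 < r <= r0 -> 0 < S <= r -> (forall x, eball x0 r x -> `|w x| <= S) ->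
     sol (Cf * S `^ m * (S / r) `^ kappa) (eball x0 r) w) ->
  (forall x, eball x0 r0 x -> `|w x| <= r0) ->
  forall k x, eball x0 (r0 * rho ^+ k) x -> `|w x| <= r0 * (rho ^+ k * (rho ^+ k) `^ ahat).
Proof.
move=> ah0 m0 ka0 ahG /andP[rho0 rho4] /andP[eta0 eta1] Cf0 imp /andP[r00 r01] Cfr cw wx crit scaled wr0.
elim=> [|k IH] x; first by rewrite expr0 powR1 !mulr1; exact: wr0.
have [l lE] : exists l, l = rho ^+ k by eexists.
have l0 : 0 < l by rewrite lE exprn_gt0.
have l1 : l <= 1 by rewrite lE exprn_ile1 ?ltW//; clear -rho4; lra.
rewrite -lE in IH.
have [s sE] : exists s, s = l `^ ahat by eexists.
have s0 : 0 < s by rewrite sE powR_gt0.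
have s1 : s <= 1 by rewrite sE -(powRr0 l) ger_powR ?l0// ltW.
rewrite -sE in IH.
set r := r0 * l in IH; have rE : r = r0 * l by [].
set S := r0 * (l * s) in IH; have SE : S = r0 * (l * s) by [].
clearbody r S.
have r_gt0 : 0 < r by rewrite rE mulr_gt0.
have S_gt0 : 0 < S by rewrite SE !mulr_gt0.
have rr0 : r <= r0 by rewrite rE ler_piMr// ltW.
have Sr : S <= r by rewrite SE rE mulrA ler_piMr// mulr_ge0// ltW.
have subr : eball x0 r `<=` eball x0 r0 by move=> z; rewrite /eball/=; clear -rr0; lra.
have sw := scaled r S ltac:(by rewrite r_gt0) ltac:(by rewrite S_gt0) IH.
have Sovr : S / r = s by rewrite SE rE; field; rewrite !gt_eqF.
have small : Cf * S `^ m * (S / r) `^ kappa * r ^+ 4 / S ^+ 3 <= eta.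
  apply: le_trans Cfr; rewrite Sovr.
  have -> : S `^ m = r0 `^ m * (l * s) `^ m by rewrite SE powRM// ?mulr_ge0// ltW.
  have -> : Cf * (r0 `^ m * (l * s) `^ m) * s `^ kappa * r ^+ 4 / S ^+ 3 =
     Cf * (r0 `^ m * r0) * ((l * s) `^ m * s `^ kappa * l / s ^+ 3).
    by rewrite SE rE; move: (_ `^ m) (_ `^ m) (_ `^ kappa) => *; field; rewrite !gt_eqF.
  (* The quotient is [l] to the power 1 + m - ahat (3 - (m + kappa)), nonnegative by the second
     restriction on [ahat], and l <= 1. *)
  have h1 : (l * s) `^ m * s `^ kappa * l / s ^+ 3 <= 1.
    rewrite ler_pdivrMr ?exprn_gt0// mul1r.
    have -> : (l * s) `^ m * s `^ kappa * l = l `^ (m + ahat * m + ahat * kappa + 1).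
      have D (u v : R) : l `^ (u + v) = l `^ u * l `^ v by rewrite powRD ?(gt_eqF l0) ?implybT.
      rewrite !D powRr1 ?ltW// powRM ?(ltW l0) ?(ltW s0)// sE -!powRrM.
      by [].
    have -> : s ^+ 3 = l `^ (ahat * 3).
      by rewrite sE -powR_mulrn ?powR_ge0// -powRrM.
    by apply: ger_powR; rewrite ?l0//; clear -ahG; lra.
  have h2 : r0 `^ m <= 1 by rewrite -(powRr0 r0) ger_powR ?r00.
  have h3 : 0 <= Cf * (r0 `^ m * r0) by rewrite !mulr_ge0 ?powR_ge0// ltW.
  apply: (@le_trans _ _ (Cf * (r0 `^ m * r0) * 1)); first by rewrite ler_wpM2l.
  by rewrite mulr1 ler_wpM2l// ler_piMl// ltW.
pose v y := S^-1 * (w (x0 + r *: y) - 0).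
have inB y : eball 0 1 y -> eball x0 r (x0 + r *: y).
  by rewrite /eball/= subr0 [x0 + _]addrC addrK enormZ gtr0_norm// => ?; rewrite gtr_pMr.
have := imp v (econt_rescale _ _ _ _ _ r_gt0 S_gt0 (econt_sub _ _ _ subr cw)).
have sv : sol eta (eball 0 1) v.
  exact: solS small (sol_rescale _ _ _ _ 0 _ r_gt0 S_gt0 sw).
have v1 y : eball 0 1 y -> `|v y| <= 1.
  move=> /inB/IH h; rewrite /v subr0 normrM gtr0_norm ?invr_gt0// mulrC.
  by rewrite ler_pdivrMr// mul1r.
have v0 : v 0 = 0 by rewrite /v scaler0 addr0 wx subrr mulr0.
move=> /(_ sv v1 v0 (critical_rescale _ _ _ _ _ r_gt0 S_gt0 crit)) H hx.
have := H (r^-1 *: (x - x0)); rewrite /v rescale_point// subr0 normrM.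
rewrite gtr0_norm ?invr_gt0// mulrC ler_pdivrMr// => {}H.
apply: le_trans (H _) _.
  rewrite enormZ gtr0_norm ?invr_gt0// mulrC ler_pdivrMr// mulrC rE -mulrA lE -exprSr.
  exact: ltW.
rewrite exprSr -lE powRM ?(ltW l0) ?(ltW rho0)// -sE SE le_eqVlt; apply/orP; left; apply/eqP; ring.
Qed.

End Decay.

(** * From the structure condition to the decay estimate *)

(** The structure condition is applied with factors [S] and [S / r] to u / S, of modulus at most 1,
    and to the gradient times r / S. The minimum with 1 makes the bound independent of the
    gradient. *)
Lemma structure_sol (R : realType) (n : nat) (G : 'rV[R]_n -> R -> 'rV[R]_n -> R)
    (Cstar F m kappa : R) (f u : 'rV[R]_n -> R) x0 (r S : R) :
  0 < Cstar -> 0 <= m -> structure_condition G Cstar f m kappa ->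
  viscosity_solution (eball 0 1) G u -> (forall x, eball 0 1 x -> `|f x| <= F) ->
  0 < r <= 1 -> 0 < S <= r -> eball x0 r `<=` eball 0 1 ->
  (forall x, eball x0 r x -> `|u x| <= S) ->
  sol (Cstar * F * S `^ m * (S / r) `^ kappa) (eball x0 r) u.
Proof.
move=> C0 m0 str [sub super] fF /andP[r0 r1] /andP[S0 Sr] sub1 uS.
have Sr01 : 0 < S / r <= 1 by rewrite divr_gt0//= ler_pdivrMr// mul1r.
have GB y q : eball x0 r y ->
    `|G y (u y) q| <= Cstar * F * S `^ m * (S / r) `^ kappa.
  move=> By; have := str S (S / r) y (u y / S) ((r / S) *: q).
  rewrite S0 (le_trans Sr r1) Sr01 => /(_ isT isT (sub1 _ By)).
  rewrite mulrC divfK ?gt_eqF// scalerA.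
  rewrite (_ : S / r * (r / S) = 1) ?scale1r; last by field; rewrite !gt_eqF.
  move=> h; apply: (le_trans h).
  set P := S `^ m; set Q := (S / r) `^ kappa; set T := _ `^ m; set M := Num.min _ _.
  have P0 : 0 <= P := powR_ge0 _ _.
  have Q0 : 0 <= Q := powR_ge0 _ _.
  have T0 : 0 <= T := powR_ge0 _ _.
  have T1 : T <= 1.
    have E : (1 : R) `^ m = 1 by rewrite powR1.
    rewrite /T -[leRHS]E; apply: ge0_ler_powR => //; rewrite ?nnegrE//.
    rewrite normrM normfV (gtr0_norm S0) ler_pdivrMr// mul1r; exact: uS.
  have M0 : 0 <= M by rewrite le_min ler01 powR_ge0.
  have M1 : M <= 1 by rewrite ge_min lexx.
  have F1 := fF y (sub1 _ By).
  rewrite (_ : Cstar * P * Q * `|f y| * T * M = Cstar * P * Q * (`|f y| * (T * M))); last by ring.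
  rewrite (_ : Cstar * F * P * Q = Cstar * P * Q * F); last by ring.
  rewrite ler_wpM2l ?mulr_ge0 ?(ltW C0)//; apply: le_trans F1.
  by rewrite ler_piMr// mulr_ile1.
have B0 y : eball x0 r y -> 0 <= Cstar * F * S `^ m * (S / r) `^ kappa.
  by move=> /(GB y 0); apply: le_trans.
split=> y p X By J; have B := B0 y By.
  have := subsolution_jet _ _ _ _ _ _ sub (sub1 _ By) J; have := GB y p By.
  by rewrite ler_norml => /andP[? ?]; lra.
have := supersolution_jet _ _ _ _ _ _ super (sub1 _ By) J; have := GB y (- p) By.
by rewrite ler_norml => /andP[? ?]; lra.
Qed.

Theorem theorem1p3 (R : realType) (n : nat) (n_gt0 : (0 < n)%N)
    (G : 'rV[R]_n -> R -> 'rV[R]_n -> R)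
    (Cstar : R) (f : 'rV[R]_n -> R) (m kappa : R)
    (Cstar_gt0 : 0 < Cstar)
    (f_cont : {within eball 0 1, continuous f})
    (f_bounded : (sup_norm (eball 0 1) f < +oo)%E)
    (m_bounds : 0 <= m < 3) (kappa_bounds : 0 <= kappa < 4)
    (m_kappa : m < 3 - kappa)
    (G_struct : structure_condition G Cstar f m kappa)
    (u : 'rV[R]_n -> R)
    (u_cont : {within eball 0 1, continuous u})
    (u_sol : viscosity_solution (eball 0 1) G u)
    (u_norm : (sup_norm (eball 0 1) u <= 1)%E)
    (x0 : 'rV[R]_n) (x0_crit : critical_zeros u x0)
    (Xi_neq0 : XiH R n !=set0)
    (alphaH_bounds : 0 < alphaH R n < 1)
    (harmonic_reg : forall h : 'rV[R]_n -> R,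
        infty_harmonic h -> C1a_loc (alphaH R n) (eball 0 1) h)
    (ahat : R) (ahat_alphaH : 0 < ahat < alphaH R n)
    (ahat_G : 0 < ahat <= (1 + m) / (3 - (m + kappa))) :
  exists2 C0 : R, 0 < C0 &
    \forall r \near 0^'+,
      (sup_norm (eball x0 r) u <= (C0 * r `^ (1 + ahat))%:E)%E.
Proof.
have /andP[ah0 _] := ahat_G.
have /andP[m0 _] := m_bounds; have /andP[ka0 _] := kappa_bounds.
have [x01 ux0 du gu] := x0_crit.
have [a [C [aha a1 C0 flat]]] := harmonic_flat ahat alphaH_bounds ahat_alphaH harmonic_reg.
have [|rho [eta [/andP[rho0 rho4] eta01 imp]]] := improve_flatness ahat a C _ a1 C0 flat.
  by rewrite ah0.
have /andP[eta0 _] := eta01.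
have [F F0 fF] : exists2 F : R, 0 <= F & forall x, eball 0 1 x -> `|f x| <= F.
  have B0 : eball (0 : 'rV[R]_n) 1 0 by rewrite /eball/= subrr enorm0.
  have s0 : (0 <= sup_norm (eball 0 1) f)%E.
    by apply: le_trans (sup_norm_ge _ _ _ B0); rewrite lee_fin.
  exists (fine (sup_norm (eball 0 1) f)); first exact: fine_ge0.
  move=> x Bx; rewrite -lee_fin fineK; first exact: sup_norm_ge.
  by rewrite ge0_fin_numE.
have crit : critical_at u x0.
  move=> s s0; have [r r0 hr] := diff_approx u x0 du s s0; exists r => // h /hr.
  by rewrite gu dot0l subr0.
have ahG : ahat * (3 - (m + kappa)) <= 1 + m.
  by have /andP[_] := ahat_G; rewrite ler_pdivlMr//; lra.
have CF0 : 0 <= Cstar * F by rewrite mulr_ge0// ltW.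
(* Criticality with constant 1 gives |u| <= |x - x0| near x0, the start of the iteration. *)
have [r1 r10 hr1] := crit 1 ltr01.
have d0 : 0 < 1 - enorm x0 by move: x01; rewrite /eball/= subr0; lra.
have [r0 [r00 r01 r0d r0F]] : exists r0, [/\ 0 < r0, r0 <= 1, r0 <= 1 - enorm x0 &
    r0 <= r1 /\ Cstar * F * r0 <= eta].
  have e0 : 0 < eta / (Cstar * F + 1) by rewrite divr_gt0//; lra.
  exists (Num.min (Num.min 1 (1 - enorm x0)) (Num.min r1 (eta / (Cstar * F + 1)))); split.
  - by rewrite !lt_min ltr01 d0 r10 e0.
  - by rewrite !ge_min lexx.
  - by rewrite !ge_min lexx orbT.
  split; first by rewrite !ge_min lexx !orbT.
  set q := Num.min _ _; have qe : q <= eta / (Cstar * F + 1) by rewrite !ge_min lexx !orbT.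
  have q0 : 0 <= q by rewrite !le_min ler01 !ltW.
  by move: qe; rewrite ler_pdivlMr; clear -q0 CF0; lra.
case: r0F => r0r1 r0F.
have sub1 r : r <= r0 -> eball x0 r `<=` eball 0 1.
  move=> rr0 x; rewrite /eball/= subr0 => hx; by have := enorm_sub_ge x x0; clear -rr0 r0d hx; lra.
have ucont : econt (eball x0 r0) u by apply: econt_sub (sub1 _ (lexx _)) _; apply/econtP.
have decay := decay_iteration ahat rho eta m kappa (Cstar * F) r0 u x0 ah0 m0 ka0 ahG
  _ eta01 CF0 imp _ r0F ucont ux0 crit.
have {}decay k x : eball x0 (r0 * rho ^+ k) x ->
    `|u x| <= r0 * (rho ^+ k * (rho ^+ k) `^ ahat).
  apply: decay; [by rewrite rho0|by rewrite r00| |].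
    move=> r S /andP[r_gt0 rr0] S01 uS.
    apply: (structure_sol _ _ _ _ _ _ _ _ _ _ _ _ Cstar_gt0 m0 G_struct u_sol fF _ S01 (sub1 _ rr0) uS).
    by rewrite r_gt0 (le_trans rr0).
  move=> y hy; have := hr1 (y - x0); rewrite [x0 + _]addrC subrK ux0 subr0 mul1r => h.
  apply: (le_trans (h _)); first exact: lt_le_trans hy r0r1.
  exact: ltW.
have r0rho : 0 < r0 * rho by rewrite mulr_gt0.
have inv0 : 0 < (r0 * rho)^-1 by rewrite invr_gt0.
(* A radius [r] lies between two consecutive radii of the iteration, so rho^k < r / (r0 rho). *)
exists (r0 * (r0 * rho)^-1 `^ (1 + ahat)); first by rewrite mulr_gt0// powR_gt0.
near=> r.
have r_gt0 : 0 < r by [].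
have rr0 : r < r0 by near: r; exact: nbhs_right_lt.
have [k rk rk'] : exists2 k, r <= r0 * rho ^+ k & r0 * rho ^+ k.+1 < r.
  have ex : exists j, r0 * rho ^+ j < r.
    have [j hj] := half_small (r / (2 * r0)) ltac:(by rewrite divr_gt0// mulr_gt0).
    exists j; apply: (@le_lt_trans _ _ (r0 * (r / (2 * r0)))).
      rewrite ler_pM2l//; apply: le_trans hj.
      by rewrite lerXn2r// ?nnegrE ?(ltW rho0)//; clear -rho4; lra.
    by rewrite (_ : r0 * _ = r / 2); [clear -r_gt0; lra|field; rewrite gt_eqF].
  case: (ex_minnP ex) => -[|k] hk hmin.
    by move: hk; rewrite expr0 mulr1; clear -rr0; lra.
  by exists k => //; rewrite leNgt; apply/negP => /hmin; rewrite ltnn.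
apply: sup_norm_le => x hx.
have l0 : 0 < rho ^+ k by rewrite exprn_gt0.
apply: (@le_trans _ _ (r0 * (rho ^+ k * (rho ^+ k) `^ ahat))).
  by apply: decay; apply: lt_le_trans hx rk.
rewrite -mulrA ler_pM2l// -powRM ?(ltW inv0) ?(ltW r_gt0)//.
have -> : rho ^+ k * (rho ^+ k) `^ ahat = (rho ^+ k) `^ (1 + ahat).
  by rewrite powRD ?(gt_eqF l0) ?implybT// powRr1// ltW.
apply: ge0_ler_powR; rewrite ?nnegrE.
- by rewrite addr_ge0// ltW.
- exact: ltW.
- by rewrite mulr_ge0 ?(ltW inv0) ?(ltW r_gt0).
- by rewrite [leRHS]mulrC ler_pdivlMr// mulrC -mulrA -exprS ltW.
Unshelve. all: by end_near.
Qed.
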